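(* Let $k,l,d,q\in\mathbb{N}$. Let $X=\{X_t:t\in\mathbb{R}^k\}$ be an $\mathbb{R}^d$-valued homogeneous Lévy sheet on $\mathbb{R}^k$ and $\Lambda_X$ the homogeneous Lévy basis induced by $X$. Let $T=\{T_t:t\in\mathbb{R}^k\}$ be an $\mathbb{R}_+$-valued homogeneous Lévy sheet on $\mathbb{R}^k$ and $\Lambda_T$ the nonnegative homogeneous Lévy basis induced by $T$. Let $M=\{M(A)\}$, $A$ ranging over the bounded Borel subsets of $\mathbb{R}^k$, be an extended subordination of $\Lambda_X$ by $\Lambda_T$. Let $f:\mathbb{R}^{k-l}\times\mathbb{R}^l\to M_{q\times d}(\mathbb{R})$ be a measurable function such that, for every $t\in\mathbb{R}^l$, the integral of $(B,s)\mapsto f(B,t-s)$ with respect to $M$ exists, and let $$(Y_t)_{t\in\mathbb{R}^l}\stackrel{d}{=}\Big(\int_{\mathbb{R}^{k-l}}\int_{\mathbb{R}^l}f(B,t-s)\,M(dB,ds)\Big)_{t\in\mathbb{R}^l}.$$ Then $(Y_t)_{t\in\mathbb{R}^l}$ is mixing.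
   Context: $M_{q\times d}(\mathbb{R})$ is the set of real $q\times d$ matrices; $\mathcal{B}(\mathbb{R}^k)$ and $\mathcal{B}_b(\mathbb{R}^k)$ denote the Borel sets and the bounded Borel sets of $\mathbb{R}^k$; $\mathrm{Leb}$ is Lebesgue measure; $a\le b$ means $a^i\le b^i$ for all $i$; $\Delta_a^bF$ is the ($k$-dimensional rectangular) increment of a function $F$ over the interval $(a,b]$. Homogeneous Lévy sheet: a family $X=\{X_t\}$ of random vectors in $\mathbb{R}^d$ such that: $X_t=0$ a.s. for all $t$ in $\{t:t^j=0,\ j=1,\dots,k\}$; for $n\ge2$ and disjoint intervals $(a_1,b_1],\dots,(a_n,b_n]$ the increments $\Delta_{a_1}^{b_1}X,\dots,\Delta_{a_n}^{b_n}X$ are independent; $X$ is continuous in probability; $\Delta_{a+t}^{b+t}X\stackrel{d}{=}\Delta_a^bX$ for all $a,b,t$ with $a\le b$; and $X$ is lamp (has limits along monotone paths, the multiparameter analogue of càdlàg). Homogeneous Lévy basis on $\mathbb{R}^k$: an $\mathbb{R}^d$-valued random measure $\Lambda=\{\Lambda(A):A\in\mathcal{B}_b(\mathbb{R}^k)\}$ whose values are infinitely divisible, independent over disjoint sets, and a.s. countably additive over disjoint sets with bounded union, with $\mathbb{E}[e^{i\langle\theta,\Lambda(A)\rangle}]=e^{\psi(\theta)\mathrm{Leb}(A)}$ for the cumulant transform $\psi$ of some infinitely divisible law. The basis induced by $X$ is the one with $\Lambda_X((a,b])=\Delta_a^bX$ a.s. (on $\mathbb{R}^k_+=\{x\in\mathbb{R}^k:x^i\ge0,\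 i=1,\dots,k\}$: $\Lambda_X([0,t])=X_t$ a.s. for all $t$); similarly for $T$. Extended subordination: let $\mathcal{F}^T=\sigma(\Lambda_T(A):A\in\mathcal{B}_b(\mathbb{R}^k))$, and let $\Omega$ be the underlying probability space. There is a map $\phi_T:\Omega\times\mathbb{R}^k\to\mathbb{R}^k$, measurable with respect to $\mathcal{F}^T\otimes\mathcal{B}(\mathbb{R}^k)$ and $\mathcal{B}(\mathbb{R}^k)$, such that for all $\omega\in\Omega$ and $A\in\mathcal{B}_b(\mathbb{R}^k)$ the set $\mathbf{T}(A)(\omega)=\{x\in\mathbb{R}^k:\phi_T(\omega,x)\in A\}$ is bounded and $\Lambda_T(A)(\omega)=\mathrm{Leb}(\mathbf{T}(A)(\omega))$; $\mathbf{T}(\cdot)(\omega)$ is called a meta-time associated with $\Lambda_T(\cdot)(\omega)$. One says that $M$ appears by extended subordination of $\Lambda_X$ by $\Lambda_T$ if $M(A)(\omega)=\Lambda_X(\mathbf{T}(A))(\omega)$ for all $A\in\mathcal{B}_b(\mathbb{R}^k)$. By a cited theorem of Barndorff-Nielsen and Pedersen on extended subordination, $M$ is a homogeneous Lévy basis. Points of $\mathbb{R}^k=\mathbb{R}^{k-l}\times\mathbb{R}^l$ are written $(B,s)$. Integrals with respect to $M$ are limits in probability in the sense of Rajput and Rosinski. Let $\mathcal{T}:=\{(t_n)_{n\in\mathbb{N}}\subset\mathbb{R}^l:\lim_{n\to\infty}\|t_n\|_\infty=\infty\}$. A stationary $\mathbb{R}^q$-valued field $(Y_t)_{t\in\mathbb{R}^l}$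 is called mixing if for all $m\in\mathbb{N}$, all $\lambda=(s_1,\dots,s_m)',\mu=(p_1,\dots,p_m)'\in\mathbb{R}^{ml}$, all $\theta_1,\theta_2\in\mathbb{R}^{mq}$ and all $(t_n)\in\mathcal{T}$, $$\lim_{n\to\infty}\mathbb{E}\big[\exp(i\langle\theta_1,Y_\lambda\rangle+i\langle\theta_2,Y_{\tilde\mu_n}\rangle)\big]=\mathbb{E}\big[\exp(i\langle\theta_1,Y_\lambda\rangle)\big]\,\mathbb{E}\big[\exp(i\langle\theta_2,Y_\mu\rangle)\big],$$ where $Y_\lambda:=(Y_{s_1}',\dots,Y_{s_m}')'\in\mathbb{R}^{mq}$ and $\tilde\mu_n=(p_1+t_n,\dots,p_m+t_n)'$ (a prime denotes transposition). *)

(* Defs.v *)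
From HB Require Import structures.
From mathcomp Require Import all_boot all_order all_algebra.
From mathcomp Require Import all_classical all_reals all_analysis.
From mathcomp Require Import complex.
Import Order.TTheory GRing.Theory Num.Theory.
Import numFieldNormedType.Exports.

Set Implicit Arguments.
Unset Strict Implicit.
Unset Printing Implicit Defensive.

Local Open Scope classical_set_scope.
Local Open Scope ring_scope.

(** Points of R^k and random vectors are column vectors; the topology and the
    norm of [cV[R]_k] are those of the sup norm. *)

Definition borelType (T : ptopologicalType) := g_sigma_algebraType (@open T).

Definition bounded_borel (R : realType) (k : nat) (A : set 'cV[R]_k) : Prop :=
  measurable (A : set (borelType 'cV[R]_k)) /\ bounded_set A.

Definition vle (R : realType) (k : nat) (a b : 'cV[R]_k) : Prop :=
  forall i, a i 0 <= b i 0.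

Definition box_oc (R : realType) (k : nat) (a b : 'cV[R]_k) : set 'cV[R]_k :=
  [set x | forall i, a i 0 < x i 0 <= b i 0].

Definition box_cc (R : realType) (k : nat) (a b : 'cV[R]_k) : set 'cV[R]_k :=
  [set x | forall i, a i 0 <= x i 0 <= b i 0].

(** Sum over the corners of the box: [e] is the set of coordinates that are
    taken from the lower corner [a]. *)
Definition increment (R : realType) (k : nat) (V : lmodType R)
    (F : 'cV[R]_k -> V) (a b : 'cV[R]_k) : V :=
  \sum_(e : {set 'I_k})
    (-1) ^+ #|e| *: F (\col_i (if i \in e then a i 0 else b i 0)).

(** Lebesgue outer measure of R^k, by countable covers with half-open boxes;
    it is only used on Borel sets and to speak of null sets. *)
Definition leb (R : realType) (k : nat) (A : set 'cV[R]_k) : \bar R :=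
  ereal_inf [set v | exists a b : nat -> 'cV[R]_k,
    [/\ forall n, vle (a n) (b n),
        A `<=` \bigcup_n box_oc (a n) (b n)
      & v = (\sum_(0 <= n <oo) (\prod_(i < k) (b n i 0 - a n i 0))%:E)%E]].

Definition expi (R : realType) (x : R) : R[i] := (cos x +i* sin x)%C.

Definition cexp (R : realType) (z : R[i]) : R[i] :=
  (expR (complex.Re z))%:C%C * expi (complex.Im z).

Definition Cexpect (R : realType) (d : measure_display) (T : measurableType d)
    (P : probability T R) (Z : T -> R[i]) : R[i] :=
  ((\int[P]_w complex.Re (Z w))%R +i* (\int[P]_w complex.Im (Z w))%R)%C.

Definition inner (R : realType) (d : nat) (u v : 'cV[R]_d) : R :=
  \sum_(i < d) u i 0 * v i 0.

Definition random_vector (R : realType) (d0 : measure_display)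
    (T : measurableType d0) (m n : nat) (Z : T -> 'M[R]_(m, n)) : Prop :=
  measurable_fun [set: T] (Z : T -> borelType 'M[R]_(m, n)).

Definition eq_law (R : realType) (d1 d2 : measure_display)
    (T1 : measurableType d1) (T2 : measurableType d2)
    (P1 : probability T1 R) (P2 : probability T2 R) (m n : nat)
    (Z1 : T1 -> 'M[R]_(m, n)) (Z2 : T2 -> 'M[R]_(m, n)) : Prop :=
  forall B : set (borelType 'M[R]_(m, n)), measurable B ->
    P1 (Z1 @^-1` B) = P2 (Z2 @^-1` B).

(** The product rule for subfamilies is included, by taking [B i = setT]. *)
Definition independent (R : realType) (d0 : measure_display)
    (T : measurableType d0) (P : probability T R) (n d : nat)
    (Z : 'I_n -> T -> 'cV[R]_d) : Prop :=
  forall B : 'I_n -> set (borelType 'cV[R]_d), (forall i, measurable (B i)) ->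
    P (\bigcap_(i in [set: 'I_n]) (Z i @^-1` B i))
    = (\prod_(i < n) P (Z i @^-1` B i))%E.

Definition cvg_in_prob (R : realType) (d0 : measure_display)
    (T : measurableType d0) (P : probability T R) (d : nat)
    (Zn : nat -> T -> 'cV[R]_d) (Z : T -> 'cV[R]_d) : Prop :=
  random_vector Z /\
  forall e : R, 0 < e ->
    P [set w | e <= `|Zn n w - Z w|] @[n --> \oo] --> 0%E.

Definition charfun (R : realType) (d0 : measure_display)
    (T : measurableType d0) (P : probability T R) (d : nat)
    (Z : T -> 'cV[R]_d) (theta : 'cV[R]_d) : R[i] :=
  Cexpect P (fun w => expi (inner theta (Z w))).

Definition infinitely_divisible (R : realType) (d0 : measure_display)
    (T : measurableType d0) (P : probability T R) (d : nat)
    (Z : T -> 'cV[R]_d) : Prop :=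
  forall n : nat, (0 < n)%N ->
  exists (d1 : measure_display) (T1 : measurableType d1)
         (P1 : probability T1 R) (xi : 'I_n -> T1 -> 'cV[R]_d),
    [/\ forall i, random_vector (xi i),
        independent P1 xi,
        forall i j, eq_law P1 P1 (xi i) (xi j)
      & eq_law P P1 Z (fun w => \sum_i xi i w)].

(** The continuous logarithm, vanishing at 0, of the characteristic function of
    an infinitely divisible law on R^d. *)
Definition cumulant_transform (R : realType) (d : nat)
    (psi : 'cV[R]_d -> R[i]) : Prop :=
  exists mu : probability (borelType 'cV[R]_d) R,
    [/\ infinitely_divisible mu (fun x => x : 'cV[R]_d),
        continuous (psi : 'cV[R]_d -> (R[i] : numFieldType)),
        psi 0 = 0
      & forall theta, charfun mu (fun x => x : 'cV[R]_d) theta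
                      = cexp (psi theta)].

(** Limits exist along each of the 2^k quadrants (half-open: [<] on the
    coordinates in [r], [>=] on the others), and the function is
    right-continuous. *)
Definition quadrant (R : realType) (k : nat) (r : {set 'I_k}) (t : 'cV[R]_k) :
    set 'cV[R]_k :=
  [set s | forall i, if i \in r then s i 0 < t i 0 else t i 0 <= s i 0].

Definition lamp (R : realType) (k d : nat) (F : 'cV[R]_k -> 'cV[R]_d) : Prop :=
  forall t : 'cV[R]_k,
    (forall r : {set 'I_k},
       cvg (F s @[s --> within (quadrant r t) (nbhs t)])) /\
    F s @[s --> within (quadrant finset.set0 t) (nbhs t)] --> F t.

Record homogeneous_levy_sheet (R : realType) (d0 : measure_display)
    (T : measurableType d0) (P : probability T R) (k d : nat)
    (X : 'cV[R]_k -> T -> 'cV[R]_d) : Prop := HomogeneousLevySheet {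
  sheet_measurable : forall t, random_vector (X t) ;
  sheet_zero : forall t : 'cV[R]_k, (forall j, t j 0 = 0) ->
    {ae P, forall w, X t w = 0} ;
  sheet_indep : forall (n : nat) (a b : 'I_n -> 'cV[R]_k),
    (2 <= n)%N -> (forall i, vle (a i) (b i)) ->
    trivIset [set: 'I_n] (fun i => box_oc (a i) (b i)) ->
    independent P (fun i w => increment (X ^~ w) (a i) (b i)) ;
  sheet_continuous : forall (t : 'cV[R]_k) (e : R), 0 < e ->
    P [set w | e <= `|X s w - X t w|] @[s --> t] --> 0%E ;
  sheet_homogeneous : forall a b t : 'cV[R]_k, vle a b ->
    eq_law P P (fun w => increment (X ^~ w) (a + t) (b + t))
               (fun w => increment (X ^~ w) a b) ;
  sheet_lamp : {ae P, forall w, lamp (X ^~ w)} }.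

Record homogeneous_levy_basis (R : realType) (d0 : measure_display)
    (T : measurableType d0) (P : probability T R) (k d : nat)
    (M : set 'cV[R]_k -> T -> 'cV[R]_d) : Prop := HomogeneousLevyBasis {
  basis_measurable : forall A, bounded_borel A -> random_vector (M A) ;
  basis_id : forall A, bounded_borel A -> infinitely_divisible P (M A) ;
  basis_indep : forall (n : nat) (A : 'I_n -> set 'cV[R]_k),
    (forall i, bounded_borel (A i)) -> trivIset [set: 'I_n] A ->
    independent P (fun i => M (A i)) ;
  basis_sigma_additive : forall A : nat -> set 'cV[R]_k,
    (forall i, bounded_borel (A i)) -> trivIset [set: nat] A ->
    bounded_set (\bigcup_i A i) ->
    {ae P, forall w,
       series (fun i => M (A i) w) @ \oo --> M (\bigcup_i A i) w} ;
  basis_charfun : exists psi : 'cV[R]_d -> R[i],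
    cumulant_transform psi /\
    forall A theta, bounded_borel A ->
      charfun P (M A) theta = cexp (psi theta * (fine (leb A))%:C%C) }.

Definition basis_induced_by (R : realType) (d0 : measure_display)
    (T : measurableType d0) (P : probability T R) (k d : nat)
    (L : set 'cV[R]_k -> T -> 'cV[R]_d) (X : 'cV[R]_k -> T -> 'cV[R]_d) :
    Prop :=
  [/\ homogeneous_levy_basis P L,
      forall a b, vle a b ->
        {ae P, forall w, L (box_oc a b) w = increment (X ^~ w) a b}
    & forall t, vle 0 t -> {ae P, forall w, L (box_cc 0 t) w = X t w}].

Definition to_vec1 (R : realType) (I T : Type) (F : I -> T -> R) :
    I -> T -> 'cV[R]_1 :=
  fun i w => (F i w)%:M.

(** Generator of the sigma-algebra of a real-valued basis. *)
Definition basis_events (R : realType) (T : Type) (k : nat)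
    (L : set 'cV[R]_k -> T -> R) : set (set T) :=
  [set C | exists (A : set 'cV[R]_k) (B : set R),
     [/\ bounded_borel A, measurable B & C = L A @^-1` B]].

Definition meta_time (R : realType) (T : pointedType) (k : nat)
    (L : set 'cV[R]_k -> T -> R) (phi : T -> 'cV[R]_k -> 'cV[R]_k) : Prop :=
  measurable_fun
    [set: g_sigma_algebraType (basis_events L) * borelType 'cV[R]_k]
    ((fun p => phi p.1 p.2) :
       g_sigma_algebraType (basis_events L) * borelType 'cV[R]_k ->
       borelType 'cV[R]_k) /\
  forall (w : T) (A : set 'cV[R]_k), bounded_borel A ->
    bounded_set (phi w @^-1` A) /\ (L A w)%:E = leb (phi w @^-1` A).

Definition extended_subordination (R : realType) (T : pointedType) (k d : nat)
    (LX : set 'cV[R]_k -> T -> 'cV[R]_d) (LT : set 'cV[R]_k -> T -> R)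
    (M : set 'cV[R]_k -> T -> 'cV[R]_d) : Prop :=
  exists phi : T -> 'cV[R]_k -> 'cV[R]_k, meta_time LT phi /\
    forall (A : set 'cV[R]_k) (w : T), bounded_borel A ->
      M A w = LX (phi w @^-1` A) w.

Record simple_fun (R : realType) (k q d : nat) := SimpleFun {
  sf_size : nat ;
  sf_coef : 'I_sf_size -> 'M[R]_(q, d) ;
  sf_set : 'I_sf_size -> set 'cV[R]_k ;
  sf_bounded_borel : forall i, bounded_borel (sf_set i) ;
  sf_disjoint : trivIset [set: 'I_sf_size] sf_set }.

Definition sf_eval (R : realType) (k q d : nat) (s : simple_fun R k q d)
    (x : 'cV[R]_k) : 'M[R]_(q, d) :=
  \sum_(i < sf_size s) (\1_(sf_set i) x : R) *: sf_coef i.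

Definition sf_integral (R : realType) (T : Type) (k q d : nat)
    (M : set 'cV[R]_k -> T -> 'cV[R]_d) (A : set 'cV[R]_k)
    (s : simple_fun R k q d) (w : T) : 'cV[R]_q :=
  \sum_(i < sf_size s) sf_coef i *m M (A `&` sf_set i) w.

(** [Z] is (a version of) the integral of [g] over R^k: [g] is integrable, with
    [s] an approximating sequence, and [Z] is the limit in probability. For a
    nonzero homogeneous basis the control measure is a positive multiple of
    Lebesgue measure; for the zero basis all integrals vanish. *)
Definition levy_integral (R : realType) (d0 : measure_display)
    (T : measurableType d0) (P : probability T R) (k q d : nat)
    (M : set 'cV[R]_k -> T -> 'cV[R]_d) (g : 'cV[R]_k -> 'M[R]_(q, d))
    (Z : T -> 'cV[R]_q) : Prop :=
  exists s : nat -> simple_fun R k q d,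
    [/\ leb [set x | ~ (sf_eval (s n) x @[n --> \oo] --> g x)] = 0%E,
        forall A : set 'cV[R]_k, measurable (A : set (borelType 'cV[R]_k)) ->
          exists ZA, cvg_in_prob P (fun n => sf_integral M A (s n)) ZA
      & cvg_in_prob P (fun n => sf_integral M setT (s n)) Z].

Definition random_field (R : realType) (d0 : measure_display)
    (T : measurableType d0) (l q : nat) (Y : 'cV[R]_l -> T -> 'cV[R]_q) :
    Prop :=
  forall t, random_vector (Y t).

(** [(Y_{t_1}, ..., Y_{t_m})], as the columns of a matrix. *)
Definition marginal (R : realType) (T : Type) (l q m : nat)
    (Y : 'cV[R]_l -> T -> 'cV[R]_q) (t : 'I_m -> 'cV[R]_l) :
    T -> 'M[R]_(q, m) :=
  fun w => \matrix_(i, j) Y (t j) w i 0.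

Definition eq_fdd (R : realType) (d1 d2 : measure_display)
    (T1 : measurableType d1) (T2 : measurableType d2)
    (P1 : probability T1 R) (P2 : probability T2 R) (l q : nat)
    (Y1 : 'cV[R]_l -> T1 -> 'cV[R]_q) (Y2 : 'cV[R]_l -> T2 -> 'cV[R]_q) :
    Prop :=
  forall (m : nat) (t : 'I_m -> 'cV[R]_l),
    eq_law P1 P2 (marginal Y1 t) (marginal Y2 t).

Definition stationary (R : realType) (d0 : measure_display)
    (T : measurableType d0) (P : probability T R) (l q : nat)
    (Y : 'cV[R]_l -> T -> 'cV[R]_q) : Prop :=
  forall h : 'cV[R]_l, eq_fdd P P (fun t => Y (t + h)) Y.

(** [<theta, Y_lambda>], for [theta] in R^(mq) given by its [m] blocks. *)
Definition block_inner (R : realType) (T : Type) (l q m : nat)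
    (theta : 'I_m -> 'cV[R]_q) (Y : 'cV[R]_l -> T -> 'cV[R]_q)
    (s : 'I_m -> 'cV[R]_l) (w : T) : R :=
  \sum_(j < m) inner (theta j) (Y (s j) w).

Definition mixing (R : realType) (d0 : measure_display)
    (T : measurableType d0) (P : probability T R) (l q : nat)
    (Y : 'cV[R]_l -> T -> 'cV[R]_q) : Prop :=
  stationary P Y /\
  forall (m : nat) (s p : 'I_m -> 'cV[R]_l) (theta1 theta2 : 'I_m -> 'cV[R]_q)
         (t : nat -> 'cV[R]_l),
    `|t n| @[n --> \oo] --> +oo ->
    (Cexpect P (fun w =>
       expi (block_inner theta1 Y s w
             + block_inner theta2 Y (fun j => p j + t n) w))
     : (R[i] : numFieldType)) @[n --> \oo]
    --> (Cexpect P (fun w => expi (block_inner theta1 Y s w))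
         * Cexpect P (fun w => expi (block_inner theta2 Y p w))
         : (R[i] : numFieldType)).

Definition coordB (R : realType) (k l : nat) (le_lk : (l <= k)%N)
    (x : 'cV[R]_k) : 'cV[R]_(k - l) :=
  usubmx (castmx (esym (subnK le_lk), erefl 1%N) x).

Definition coordS (R : realType) (k l : nat) (le_lk : (l <= k)%N)
    (x : 'cV[R]_k) : 'cV[R]_l :=
  dsubmx (castmx (esym (subnK le_lk), erefl 1%N) x).

(* Main.v *)
(* Only the fact that M is a homogeneous Levy basis matters. With psi its
   cumulant transform, the integral of a step function sum_i c_i 1_{A_i} with
   disjoint A_i has the characteristic function exp (sum_i psi (c_i) Leb (A_i)),
   which is invariant under translation of the step function and multiplicative
   for step functions with disjoint supports.

   The law of an integral int g dM depends neither on the approximating sequence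
   nor on translations of g: the difference of two approximating sequences tends
   to 0 almost everywhere and its integrals over every Borel set are Cauchy in
   probability, so they tend to 0 by a gliding hump argument of
   Vitali-Hahn-Saks type. This gives stationarity. For mixing, both linear
   combinations of the field are approximated by integrals of step functions with
   bounded support; these become independent once t_n has moved the supports
   apart, and the approximation error does not depend on t_n. *)
Require Import Defs.
From mathcomp Require Import all_boot all_order all_algebra.
From mathcomp Require Import all_classical all_reals all_analysis.
From HB Require Import structures.
From mathcomp Require Import measurable_realfun complex.
From mathcomp Require Import ring lra.
Set Implicit Arguments.
Unset Strict Implicit.
Unset Printing Implicit Defensive.
Import Order.TTheory GRing.Theory Num.Theory.
Import numFieldNormedType.Exports.
Local Open Scope classical_set_scope.
Local Open Scope ring_scope.

(** * Bounded random variables *)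

Section BoundedExpectation.
Context {R : realType} {d0 : measure_display} {T : measurableType d0}.
Variable P : probability T R.
Implicit Types (f g : T -> R).

(** The integrals exist only as limits in probability, along sequences that change with [t], so an
    estimate proved for one [t] cannot be carried to another through the sequences. It is carried
    through laws: the size of a random variable [U] is measured by the expectation of [1 - cos U],
    which is read off from the characteristic function of [U] at 1. Equal characteristic functions
    then give equal approximation errors. Evaluating at 1 loses nothing, since a frequency [theta]
    can be absorbed into the integrand. The price is a factor 2 in the triangle inequality, the
    origin of most tolerances [e / 4] and [e ^+ 2 / 8]. The formula for the characteristic function
    of a step integral needs disjoint sets, while sums and differences of step functions overlap.
    Step functions are therefore arbitrary lists, made disjoint only where the formula is applied.
    Stationarity is a statement about laws, whereas the formula only gives characteristic functions;
    the uniqueness theorem between the two is proved by approximating indicators of orthants with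
    trigonometric polynomials. *)

Definition bounded_rv f :=
  measurable_fun [set: T] f /\ exists C : R, forall w, `|f w| <= C.

Lemma bounded_rv_integrable f : bounded_rv f ->
  P.-integrable [set: T] (EFin \o f).
Proof.
move=> [mf [C hC]]; apply: measurable_bounded_integrable => //.
  by rewrite -ge0_fin_numE// fin_num_measure.
by exists C; split; [exact: num_real|move=> M CM w _ /=; exact/(le_trans (hC w))/ltW].
Qed.

Lemma bounded_rv_cst (c : R) : bounded_rv (fun=> c).
Proof. by split; [exact: measurable_cst|exists `|c|]. Qed.

Lemma bounded_rvD f g : bounded_rv f -> bounded_rv g ->
  bounded_rv (fun w => f w + g w).
Proof.
move=> [mf [C hC]] [mg [D hD]]; split; first exact: measurable_funD.
by exists (C + D) => w; rewrite (le_trans (ler_normD _ _))// lerD.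
Qed.

Lemma bounded_rvM f g : bounded_rv f -> bounded_rv g ->
  bounded_rv (fun w => f w * g w).
Proof.
move=> [mf [C hC]] [mg [D hD]]; split; first exact: measurable_funM.
by exists (C * D) => w; rewrite normrM ler_pM.
Qed.

Lemma bounded_rvN f : bounded_rv f -> bounded_rv (fun w => - f w).
Proof.
move=> [mf [C hC]]; split; first by apply: measurableT_comp mf.
by exists C => w; rewrite normrN.
Qed.

Lemma bounded_rvB f g : bounded_rv f -> bounded_rv g ->
  bounded_rv (fun w => f w - g w).
Proof. by move=> bf bg; apply: bounded_rvD => //; exact: bounded_rvN. Qed.

Lemma bounded_rvZ (c : R) f : bounded_rv f -> bounded_rv (fun w => c * f w).
Proof. exact/bounded_rvM/bounded_rv_cst. Qed.

Lemma bounded_rv_norm f : bounded_rv f -> bounded_rv (fun w => `|f w|).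
Proof.
move=> [mf [C hC]]; split; first by apply: measurableT_comp mf.
by exists C => w; rewrite normr_id.
Qed.

Lemma bounded_rv_sum (I : Type) (s : seq I) (F : I -> T -> R) :
  (forall i, bounded_rv (F i)) -> bounded_rv (fun w => \sum_(i <- s) F i w).
Proof.
move=> bF; elim: s => [|i s ih].
  by under eq_fun do rewrite big_nil; exact: bounded_rv_cst.
by under eq_fun do rewrite big_cons; exact: bounded_rvD.
Qed.

Lemma bounded_rv_cos f : measurable_fun [set: T] f ->
  bounded_rv (fun w => cos (f w)).
Proof.
move=> mf; split; last by exists 1 => w; rewrite ler_norml cos_geN1 cos_le1.
apply: measurableT_comp mf; apply: continuous_measurable_fun.
exact: continuous_cos.
Qed.

Lemma bounded_rv_sin f : measurable_fun [set: T] f ->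
  bounded_rv (fun w => sin (f w)).
Proof.
move=> mf; split; last by exists 1 => w; rewrite ler_norml sin_geN1 sin_le1.
apply: measurableT_comp mf; apply: continuous_measurable_fun.
exact: continuous_sin.
Qed.

Lemma bounded_rv_indic (A : set T) : measurable A -> bounded_rv \1_A.
Proof.
move=> mA; split; first exact: measurable_indic.
by exists 1 => w; rewrite indicE; case: (_ \in _); rewrite ?normr1 ?normr0.
Qed.

Local Notation Ex f := (\int[P]_w f w).

Lemma expectD f g : bounded_rv f -> bounded_rv g ->
  Ex (fun w => f w + g w) = Ex f + Ex g.
Proof. by move=> bf bg; apply: RintegralD => //; exact: bounded_rv_integrable. Qed.

Lemma expectZ (c : R) f : bounded_rv f -> Ex (fun w => c * f w) = c * Ex f.
Proof. by move=> bf; apply: RintegralZl => //; exact: bounded_rv_integrable. Qed.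

Lemma expectB f g : bounded_rv f -> bounded_rv g ->
  Ex (fun w => f w - g w) = Ex f - Ex g.
Proof. by move=> bf bg; apply: RintegralB => //; exact: bounded_rv_integrable. Qed.

Lemma expect_cst (c : R) : Ex (fun=> c) = c.
Proof.
rewrite Rintegral_cst// -[RHS]mulr1; congr (_ * _).
by rewrite -[RHS]/(fine 1%E); congr fine; exact: probability_setT.
Qed.

Lemma le_expect f g : bounded_rv f -> bounded_rv g -> (forall w, f w <= g w) ->
  Ex f <= Ex g.
Proof.
by move=> bf bg fg; apply: le_Rintegral => //; exact: bounded_rv_integrable.
Qed.

Lemma le_expect_cst f (c : R) : bounded_rv f -> (forall w, f w <= c) -> Ex f <= c.
Proof.
move=> bf fc; rewrite -[leRHS](expect_cst c); apply: le_expect => //.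
exact: bounded_rv_cst.
Qed.

Lemma expect_sum (I : Type) (s : seq I) (F : I -> T -> R) :
  (forall i, bounded_rv (F i)) ->
  Ex (fun w => \sum_(i <- s) F i w) = \sum_(i <- s) Ex (F i).
Proof.
move=> bF; elim: s => [|i s ih].
  by rewrite big_nil; under eq_Rintegral do rewrite big_nil; exact: expect_cst.
rewrite big_cons -ih -expectD//; last exact: bounded_rv_sum.
by under eq_Rintegral do rewrite big_cons.
Qed.

Lemma expect_indic (A : set T) : measurable A -> (Ex \1_A)%:E = P A.
Proof.
move=> mA; rewrite /Rintegral.
by rewrite integral_indic// setIT fineK// fin_num_measure.
Qed.

Lemma expect_ae f g : bounded_rv f -> bounded_rv g ->
  {ae P, forall w, f w = g w} -> Ex f = Ex g.
Proof.
move=> [mf _] [mg _] fg; congr fine; apply: ae_eq_integral => //.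
- exact/measurable_EFinP.
- exact/measurable_EFinP.
- by apply: filterS fg => w /= -> _.
Qed.

Lemma bounded_rv_lim (fn : nat -> T -> R) f (C : R) :
  (forall n, measurable_fun [set: T] (fn n)) ->
  (forall n w, `|fn n w| <= C) ->
  (forall w, fn n w @[n --> \oo] --> f w) ->
  bounded_rv f.
Proof.
move=> mfn hC fnf; split.
  by apply: (@measurable_fun_cvg _ _ _ _ fn f) => //.
exists C => w.
have h : `|fn n w| @[n --> \oo] --> `|f w| by apply: cvg_norm; exact: fnf.
rewrite -(cvg_lim _ h)//.
by apply: limr_le; [apply/cvg_ex; eexists; exact: h|exact: nearW].
Qed.

Lemma cvg_expect (fn : nat -> T -> R) f (C : R) :
  (forall n, measurable_fun [set: T] (fn n)) ->
  (forall n w, `|fn n w| <= C) ->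
  (forall w, fn n w @[n --> \oo] --> f w) ->
  Ex (fn n) @[n --> \oo] --> Ex f.
Proof.
move=> mfn hC fnf.
have [mf _] := bounded_rv_lim mfn hC fnf.
have := @dominated_convergence _ T R P setT measurableT
  (fun n w => (fn n w)%:E) (fun w => (f w)%:E) (fun=> C%:E).
case.
- by move=> n; exact/measurable_EFinP.
- exact/measurable_EFinP.
- by apply: aeW => w _; apply: cvg_EFin; [exact: nearW|exact: fnf].
- exact/bounded_rv_integrable/bounded_rv_cst.
- by apply: aeW => w n _ /=; rewrite lee_fin.
move=> intf _ h; apply: fine_cvg; rewrite fineK//.
exact: integrable_fin_num intf.
Qed.

End BoundedExpectation.

(** * Borel sets of matrices *)

Section BorelMatrix.
Context {R : realType} {m n : nat}.
Local Notation borel := (borelType 'M[R]_(m, n)).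

Definition half_spaces : set (set 'M[R]_(m, n)) :=
  [set A | exists i j c, A = [set x : 'M[R]_(m, n) | c < x i j]].

Lemma mx_norm_ltP (x : 'M[R]_(m, n)) (e : R) : 0 < e ->
  (`|x| < e) <-> (forall i j, `|x i j| < e).
Proof.
move=> e0; rewrite -[`|x|]/(mx_norm x) mx_normrE; split=> [/bigmax_ltP[_ h] i j|h].
  exact: (h (i, j)).
by apply/bigmax_ltP; split=> // -[i j] _ /=.
Qed.

Lemma mx_norm_leP (x : 'M[R]_(m, n)) (e : R) : 0 <= e ->
  (`|x| <= e) <-> (forall i j, `|x i j| <= e).
Proof.
move=> e0; rewrite -[`|x|]/(mx_norm x) mx_normrE; split=> [/bigmax_leP[_ h] i j|h].
  exact: (h (i, j)).
by apply/bigmax_leP; split=> // -[i j] _ /=.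
Qed.

Lemma open_half_space i j (c : R) : open [set x : 'M[R]_(m, n) | c < x i j].
Proof.
rewrite (_ : mkset _ = (fun x : 'M[R]_(m, n) => x i j) @^-1` [set y | c < y])//.
by apply: open_comp; [move=> ? _; exact: coord_continuous|exact: open_gt].
Qed.

Lemma measurable_coord_half_spaces i j :
  measurable_fun [set: g_sigma_algebraType half_spaces]
    (fun x : g_sigma_algebraType half_spaces => (x : 'M[R]_(m, n)) i j).
Proof.
apply: (measurability _ (@RGenOInfty.measurableE R)) => //.
move=> _ [_ [c ->] <-]; apply: sub_sigma_algebra; exists i, j, c.
by rewrite setTI; apply/seteqP; split=> x /=; rewrite in_itv/= andbT.
Qed.

Lemma measurable_box_half_spaces (r : 'M[R]_(m, n)) (e : R) :
  half_spaces.-sigma.-measurable [set x : 'M[R]_(m, n) | forall i j, `|x i j - r i j| < e].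
Proof.
have -> : [set x : 'M[R]_(m, n) | forall i j, `|x i j - r i j| < e] =
    \bigcap_(ij in [set: 'I_m * 'I_n])
      [set x : 'M[R]_(m, n) | `|x ij.1 ij.2 - r ij.1 ij.2| < e].
  by apply/seteqP; split=> x /= h => [[i j] _|i j]; [exact: h|exact: (h (i, j))].
apply: fin_bigcap_measurable; first exact: finite_finset.
move=> [i j] _ /=.
have mf : measurable_fun [set: g_sigma_algebraType half_spaces]
    (fun x : g_sigma_algebraType half_spaces => `|(x : 'M[R]_(m, n)) i j - r i j|).
  apply: measurableT_comp => //; apply: measurable_funB => //.
  exact: measurable_coord_half_spaces.
have := mf measurableT `]-oo, e[%classic (measurable_itv _).
by rewrite setTI; congr measurable; apply/seteqP; split=> x /=; rewrite in_itv.
Qed.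

Lemma exists_rat_near (x e : R) : 0 < e -> exists r : rat, `|x - ratr r| < e.
Proof.
move=> e0; have : x - e < x + e by lra.
move=> /rat_in_itvoo[r]; rewrite in_itv/= => /andP[h1 h2].
by exists r; rewrite ltr_norml; lra.
Qed.

(** The boxes with rational centre and radius [1 / (N + 1)] that are contained in [U] are countably
    many, and they cover [U]: if the ball of radius [e] around [x] lies in [U], a box containing [x]
    with [1 / (N + 1) < e / 2] lies in that ball. *)
Lemma open_half_spaces (U : set 'M[R]_(m, n)) : open U ->
  half_spaces.-sigma.-measurable U.
Proof.
move=> oU.
pose box (rN : 'M[rat]_(m, n) * nat) :=
  [set x : 'M[R]_(m, n) | forall i j, `|x i j - ratr (rN.1 i j)| < rN.2.+1%:R^-1].
have -> : U = \bigcup_(rN in [set rN | box rN `<=` U]) box rN.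
  apply/seteqP; split=> [x Ux|x [rN /= sub bx]]; last exact: sub.
  have /nbhs_ballP[e /= e0 sub] : nbhs x U by exact: open_nbhs_nbhs.
  have [N _ hN] : \forall N \near \oo, N.+1%:R^-1 < e / 2 :> R.
    have : (N.+1%:R^-1 : R) @[N --> \oo] --> (0 : R) by exact: cvg_harmonic.
    by move/cvgr_lt; apply; rewrite divr_gt0.
  have {}hN := hN N (leqnn N).
  have d0 : 0 < N.+1%:R^-1 :> R by rewrite invr_gt0.
  have hr i j : exists r : rat, `|x i j - ratr r| < N.+1%:R^-1.
    exact: exists_rat_near.
  pose r := \matrix_(i, j) projT1 (cid (hr i j)).
  have hrP i j : `|x i j - ratr (r i j)| < N.+1%:R^-1.
    by rewrite mxE; case: cid.
  exists (r, N); last by [].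
  move=> y /= hy; apply: sub; rewrite -ball_normE /=; apply/mx_norm_ltP => // i j.
  rewrite !mxE (le_lt_trans (ler_distD (ratr (r i j)) _ _))// [ltRHS]splitr ltrD//.
    exact: lt_trans (hrP i j) hN.
  by rewrite distrC; apply: lt_trans hN; exact: hy.
rewrite bigcup_mkcond; apply: countable_bigcupT_measurable => [|rN].
  exact: countableP.
case: ifPn => _; last exact: measurable0.
rewrite (_ : box rN =
    [set x : 'M[R]_(m, n) | forall i j,
       `|x i j - (map_mx ratr rN.1 : 'M[R]_(m, n)) i j| < rN.2.+1%:R^-1]).
  exact: measurable_box_half_spaces.
by apply/seteqP; split=> x /= h i j; have := h i j; rewrite mxE.
Qed.

(** Reduces measurability of a random matrix to its entries, and the Caratheodory condition for
    Borel sets to half-spaces. *)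
Lemma borel_matrixE : @measurable _ borel = <<s half_spaces>>.
Proof.
apply/seteqP; split=> A.
  apply: smallest_sub; first exact: smallest_sigma_algebra.
  exact: open_half_spaces.
apply: smallest_sub; first exact: smallest_sigma_algebra.
move=> _ [i [j [c ->]]]; apply: sub_sigma_algebra; exact: open_half_space.
Qed.

Lemma measurable_half_space i j (c : R) :
  measurable ([set x : 'M[R]_(m, n) | c < x i j] : set borel).
Proof. by apply: sub_sigma_algebra; exact: open_half_space. Qed.

Lemma measurable_coord i j :
  measurable_fun [set: borel] (fun x : borel => (x : 'M[R]_(m, n)) i j).
Proof.
apply: (measurability _ (@RGenOInfty.measurableE R)) => //.
move=> _ [_ [c ->] <-]; have := measurable_half_space i j c.
by congr measurable; rewrite setTI; apply/seteqP; split=> x /=; rewrite in_itv/= andbT.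
Qed.

Lemma random_vectorP (d0 : measure_display) (T : measurableType d0)
    (Z : T -> 'M[R]_(m, n)) :
  random_vector Z <-> forall i j, measurable_fun [set: T] (fun w => Z w i j).
Proof.
split=> [mZ i j|mZ].
  exact: (measurableT_comp (measurable_coord i j) mZ).
apply: (measurability _ borel_matrixE) => //.
move=> _ [_ [i [j [c ->]]] <-].
have := mZ i j measurableT `]c, +oo[%classic (measurable_itv _).
by congr measurable; apply/seteqP; split=> w /=; rewrite in_itv/= andbT.
Qed.

End BorelMatrix.

(** * Lebesgue measure *)

Section LebesgueOuterMeasure.
Context {R : realType} {k : nat}.
Implicit Types (A X : set 'cV[R]_k) (a b x h : 'cV[R]_k).

Definition box_volume a b : R := \prod_(i < k) (b i 0 - a i 0).

Lemma box_volume_ge0 a b : vle a b -> 0 <= box_volume a b.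
Proof. by move=> ab; apply: prodr_ge0 => i _; rewrite subr_ge0. Qed.

Lemma leb_le_cover A (a b : nat -> 'cV[R]_k) : (forall n, vle (a n) (b n)) ->
  A `<=` \bigcup_n box_oc (a n) (b n) ->
  (leb A <= \sum_(0 <= n <oo) (box_volume (a n) (b n))%:E)%E.
Proof. by move=> ab Aab; apply: ereal_inf_lbound; exists a, b. Qed.

Lemma leb_ge0 A : (0 <= leb A)%E.
Proof.
apply: le_ereal_inf_tmp => _ [a [b [ab _ ->]]].
by apply: nneseries_ge0 => n _ _; rewrite lee_fin box_volume_ge0.
Qed.

Lemma le_leb A X : A `<=` X -> (leb A <= leb X)%E.
Proof.
move=> AX; apply: le_ereal_inf => _ [a [b [ab Xab ->]]].
by exists a, b; split=> //; exact: subset_trans Xab.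
Qed.

(* For k = 0 all boxes have volume 1 (empty product), so [leb set0 = +oo]. *)
Lemma leb_set0 : (0 < k)%N -> leb (set0 : set 'cV[R]_k) = 0%E.
Proof.
move=> k_gt0; apply/eqP; rewrite eq_le leb_ge0 andbT.
have := @leb_le_cover set0 (fun=> 0) (fun=> 0) (fun=> fun=> lexx _) (@sub0set _ _).
move=> /le_trans; apply; rewrite eseries0// => n _ _.
by rewrite /box_volume (bigD1 (Ordinal k_gt0))//= mxE subrr mul0r.
Qed.

(** Covers of the [A n], each within [e / 2 ^ n.+1] of the infimum, are merged into one sequence of
    boxes by a bijection between [nat] and [nat * nat]. A term equal to [+oo] is treated apart,
    since near-optimal covers are taken only for finite values. *)
Lemma leb_sigma_subadditive : sigma_subadditive (@leb R k).
Proof.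
move=> A; have [[i ioo]|] := pselect (exists i, leb (A i) = +oo%E).
  rewrite (eseries_pinfty _ _ ioo) ?leey// => n _.
  by rewrite -ltNye (lt_le_trans _ (leb_ge0 _)).
rewrite -forallNE => Aoo.
suff add2e (e : {posnum R}) :
    (leb (\bigcup_n A n) <= \sum_(i <oo) leb (A i) + e%:num%:E)%E.
  by apply/lee_addgt0Pr => _/posnumP[].
rewrite (le_trans _ (epsilon_trick _ _ _))//; last by move=> n; exact: leb_ge0.
pose Q n (B : (nat -> 'cV[R]_k) * (nat -> 'cV[R]_k)) :=
  [/\ forall i, vle (B.1 i) (B.2 i),
      A n `<=` \bigcup_i box_oc (B.1 i) (B.2 i) &
  (\sum_(0 <= i <oo) (box_volume (B.1 i) (B.2 i))%:E <=
    leb (A n) + (e%:num / (2 ^ n.+1)%:R)%:E)%E].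
have [G QG] : {G & forall n, Q n (G n)}.
  apply: (@choice _ _ Q) => n.
  have en1 : 0 < e%:num / (2 ^ n.+1)%:R :> R by [].
  have lfin : leb (A n) \is a fin_num.
    by rewrite ge0_fin_numE ?leb_ge0// ltey; apply/eqP; exact: Aoo.
  have [_ [a [b [ab Aab ->]]] /ltW h] := lb_ereal_inf_adherent en1 lfin.
  by exists (a, b).
pose v (p : nat * nat) := (box_volume ((G p.1).1 p.2) ((G p.1).2 p.2))%:E.
have v0 p : (0 <= v p)%E by rewrite lee_fin box_volume_ge0//; case: (QG p.1).
apply: (@le_trans _ _ (\esum_(p in setT) v p)%E).
  have /card_esym/ppcard_eqP[f] := card_nat2.
  rewrite (reindex_esum setT setT f)//= -nneseries_esumT//.
  apply: (@leb_le_cover _ (fun i => (G (f i).1).1 (f i).2) (fun i => (G (f i).1).2 (f i).2)).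
    by move=> i; case: (QG (f i).1).
  move=> x [n _ Anx]; have [_ /(_ _ Anx)[j _ Bj] _] := QG n.
  by exists (f^-1%FUN (n, j)) => //; rewrite invK ?inE.
rewrite [leLHS](_ : _ = \esum_(i in setT) \esum_(j in setT) v (i, j))%E; last first.
  rewrite (@esum_esum _ _ _ setT (fun=> setT) (fun i j => v (i, j)))//.
  rewrite (_ : _ `*`` _ = setT); first by apply: eq_esum => -[].
  by apply/seteqP; split.
rewrite -nneseries_esumT//; last by move=> i; exact: esum_ge0.
apply: lee_nneseries => [n _ _|n _]; first exact: esum_ge0.
by rewrite -nneseries_esumT//; case: (QG n).
Qed.

(** A translated cover has boxes of the same volumes, which gives one inequality; the translation by
    [- h] gives the other. *)
Lemma leb_shift A h : leb [set x : 'cV[R]_k | A (x + h)] = leb A.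
Proof.
have main B g : (leb [set x : 'cV[R]_k | B (x + g)%R] <= leb B)%E.
  apply: le_ereal_inf_tmp => _ [a [b [ab Bab ->]]].
  have := @leb_le_cover [set x : 'cV[R]_k | B (x + g)] (fun n => a n - g) (fun n => b n - g).
  move=> /(_ _ _)/le_trans; apply.
  - by move=> n i; rewrite !mxE lerD2r; exact: ab.
  - move=> x /= /Bab[n _ hn]; exists n => // i.
    by have := hn i; rewrite !mxE; lra.
  - rewrite (eq_eseriesr (g := fun n => (box_volume (a n) (b n))%:E))// => n _.
    by congr EFin; apply: eq_bigr => i _; rewrite !mxE; ring.
apply/eqP; rewrite eq_le main/=.
rewrite [leLHS](_ : _ = leb [set x | [set x | A (x + h)] (x - h)])//.
by congr leb; apply/seteqP; split=> x /=; rewrite subrK.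
Qed.

(** Caratheodory's criterion for a half-space: the hyperplane cuts every box of a cover into two
    boxes whose volumes add up. The boxes being open on the left, the strict inequality [c < x i 0]
    matches the cut exactly. *)
Lemma leb_half_space i (c : R) X :
  (leb (X `&` [set x : 'cV[R]_k | (c < x i 0)%R]) + leb (X `&` ~` [set x : 'cV[R]_k | (c < x i 0)%R]) <=
   leb X)%E.
Proof.
apply: le_ereal_inf_tmp => _ [a [b [ab Xab ->]]].
(* The level [c] is clamped to the edge of the box, so that a box missed by the hyperplane has one
   degenerate piece. *)
pose mid n := Order.min (Order.max (a n i 0) c) (b n i 0).
pose lo n := \col_j (if j == i then mid n else a n j 0).
pose hi n := \col_j (if j == i then mid n else b n j 0).
have amid n : a n i 0 <= mid n <= b n i 0.
  by rewrite /mid ge_min lexx orbT le_min le_max lexx ab.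
have le1 : (leb (X `&` [set x : 'cV[R]_k | (c < x i 0)%R]) <=
    \sum_(0 <= n <oo) (box_volume (lo n) (b n))%:E)%E.
  apply: leb_le_cover => [n j|x [/Xab[n _ xab] /= cx]].
    by rewrite mxE; case: eqP => [->|_]; [case/andP: (amid n)|exact: ab].
  exists n => // j; rewrite mxE; case: eqP => [->|_]; last exact: xab.
  have /andP[h1 h2] := xab i.
  by rewrite h2 andbT /mid gt_min gt_max cx h1.
have le2 : (leb (X `&` ~` [set x : 'cV[R]_k | (c < x i 0)%R]) <=
    \sum_(0 <= n <oo) (box_volume (a n) (hi n))%:E)%E.
  apply: leb_le_cover => [n j|x [/Xab[n _ xab] /= /negP]].
    by rewrite mxE; case: eqP => [->|_]; [case/andP: (amid n)|exact: ab].
  rewrite -leNgt => cx; exists n => // j; rewrite mxE; case: eqP => [->|_]; last exact: xab.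
  have /andP[h1 h2] := xab i.
  by rewrite h1/= /mid le_min le_max cx orbT.
apply: le_trans (leeD le1 le2) _; rewrite -nneseriesD; last 2 first.
- move=> n _ _; rewrite lee_fin; apply: box_volume_ge0 => j.
  by rewrite mxE; case: eqP => [->|_]; [case/andP: (amid n)|exact: ab].
- move=> n _ _; rewrite lee_fin; apply: box_volume_ge0 => j.
  by rewrite mxE; case: eqP => [->|_]; [case/andP: (amid n)|exact: ab].
apply: lee_nneseries => [n _ _|n _].
  rewrite -EFinD lee_fin addr_ge0//; apply: box_volume_ge0 => j.
    by rewrite mxE; case: eqP => [->|_]; [case/andP: (amid n)|exact: ab].
  by rewrite mxE; case: eqP => [->|_]; [case/andP: (amid n)|exact: ab].
rewrite -EFinD lee_fin /box_volume (bigD1 i)//= [X in _ + X](bigD1 i)//= [leRHS](bigD1 i)//=.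
rewrite !mxE eqxx.
rewrite (eq_bigr (fun j => b n j 0 - a n j 0)); last first.
  by move=> j ji; rewrite !mxE (negbTE ji).
rewrite [X in _ + _ * X](eq_bigr (fun j => b n j 0 - a n j 0)); last first.
  by move=> j ji; rewrite !mxE (negbTE ji).
by rewrite -mulrDl addrA subrK.
Qed.

End LebesgueOuterMeasure.

Section LebesgueMeasure.
Context {R : realType} {k : nat}.
Hypothesis k_gt0 : (0 < k)%N.
Local Notation borel := (borelType 'cV[R]_k).
Implicit Types A B : set 'cV[R]_k.

Definition leb_outer : {outer_measure set 'cV[R]_k -> \bar R} :=
  HB.pack (@leb R k) (isOuterMeasure.Build _ _ (@leb R k) (leb_set0 k_gt0)
    (@leb_ge0 R k) (@le_leb R k) (@leb_sigma_subadditive R k)).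

Lemma borel_caratheodory A : measurable (A : set borel) ->
  leb_outer.-caratheodory A.
Proof.
rewrite borel_matrixE; apply: smallest_sub.
  split.
  - exact: caratheodory_measurable_set0.
  - by move=> B mB; rewrite setTD; exact: caratheodory_measurable_setC.
  - by move=> F mF; exact: caratheodory_measurable_bigcup.
move=> _ [i [j [c ->]]]; apply: le_caratheodory_measurable => X /=.
by rewrite (ord1 j); exact: leb_half_space.
Qed.

Lemma leb_semi_sigma_additive : semi_sigma_additive (@leb R k : set borel -> _).
Proof.
move=> F mF tF mUF.
apply: (@caratheodory_measure_sigma_additive R 'cV[R]_k leb_outer F) => //.
  by move=> i; exact: borel_caratheodory.
exact: borel_caratheodory.
Qed.

Definition leb_measure : {measure set borel -> \bar R} :=
  HB.pack (@leb R k : set borel -> \bar R)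
    (isMeasure.Build _ borel R (@leb R k) (leb_set0 k_gt0) (@leb_ge0 R k)
       leb_semi_sigma_additive).

Lemma leb_lty A : bounded_set A -> (leb A < +oo)%E.
Proof.
move=> [M [_ hM]]; have {}hM x : A x -> `|x| <= `|M| + 1.
  by apply: hM; rewrite ltr_pwDr// ler_norm.
have M0 : 0 <= `|M| + 1 by [].
(* Coordinates of points of [A] may equal [- (|M| + 1)], and boxes are open on the left, hence the
   extra unit in the lower corner. The other boxes of the cover are degenerate and have volume 0
   because [k > 0]. *)
pose b : 'cV[R]_k := const_mx (`|M| + 1); pose a : 'cV[R]_k := const_mx (- (`|M| + 2)).
pose an (n : nat) : 'cV[R]_k := if n is 0%N then a else 0.
pose bn (n : nat) : 'cV[R]_k := if n is 0%N then b else 0.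
have abn n : vle (an n) (bn n) by case: n => [|n] i /=; rewrite !mxE; lra.
have Aab : A `<=` \bigcup_n box_oc (an n) (bn n).
  move=> x /hM /mx_norm_leP-/(_ M0) hx; exists 0%N => // i /=; rewrite !mxE.
  by have := hx i 0; rewrite ler_norml; lra.
apply: le_lt_trans (leb_le_cover abn Aab) _.
rewrite (nneseries_split _ 1)// ?add0n; last first.
  by move=> n _; rewrite lee_fin box_volume_ge0.
rewrite big_nat1 eseries0 ?adde0 ?ltry// => -[//|n] _ _ /=.
by rewrite /box_volume (bigD1 (Ordinal k_gt0))//= mxE subrr mul0r.
Qed.

End LebesgueMeasure.

(** * Characteristic functions determine laws *)

Section SoftStep.
Context {R : realType}.
Implicit Types y z : R.

(* For y in [0, 1] this tends to 1 if y < 1/2 and to 0 if y > 1/2, since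
   N (2 y)^N then tends to 0 or to infinity; at y = 1/2 it tends to 0 as well. *)
Definition soft_step (N : nat) y : R := (1 - y ^+ N) ^+ (N * 2 ^ N).

(** Bernoulli's inequality. With its companion [expr_subr_le] it encloses [soft_step N y] between
    two expressions in [N (2 y)^N]. *)
Lemma expr_subr_ge (a : R) M : 0 <= a <= 1 -> 1 - M%:R * a <= (1 - a) ^+ M.
Proof.
move=> /andP[a0 a1]; elim: M => [|M ih]; first by rewrite mul0r subr0 expr0.
rewrite exprS; apply: le_trans (_ : (1 - a) * (1 - M%:R * a) <= _).
  have : 0 <= M%:R :> R by [].
  rewrite -natr1; nra.
by rewrite ler_wpM2l// subr_ge0.
Qed.

Lemma expr_subr_le (a : R) M : 0 <= a <= 1 -> (1 - a) ^+ M * (1 + M%:R * a) <= 1.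
Proof.
move=> /andP[a0 a1]; elim: M => [|M ih]; first by rewrite mul0r addr0 expr0 mulr1.
apply: le_trans ih; rewrite exprSr -mulrA ler_wpM2l ?exprn_ge0 ?subr_ge0//.
have : 0 <= M%:R :> R by [].
rewrite -natr1; nra.
Qed.

Lemma soft_step_exponent N y :
  (N * 2 ^ N)%:R * y ^+ N = N%:R * (2 * y) ^+ N.
Proof. by rewrite natrM natrX exprMn mulrA. Qed.

Lemma soft_step_ge0 N y : 0 <= y <= 1 -> 0 <= soft_step N y.
Proof.
move=> /andP[y0 y1]; apply: exprn_ge0; rewrite subr_ge0.
exact: exprn_ile1.
Qed.

Lemma soft_step_le1 N y : 0 <= y <= 1 -> soft_step N y <= 1.
Proof.
move=> /andP[y0 y1]; apply: exprn_ile1; rewrite ?subr_ge0 ?exprn_ile1//.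
by rewrite lerBlDr lerDl exprn_ge0.
Qed.

(** With [w] the square root of [z], the product [N w^N] is bounded by [1 / (1 - w)], and a second
    factor [w^N] tending to 0 remains. *)
Lemma cvg_natr_expr z : 0 <= z < 1 -> N%:R * z ^+ N @[N --> \oo] --> 0.
Proof.
move=> /andP[z0 z1].
pose w := Num.sqrt z.
have w0 : 0 <= w by exact: sqrtr_ge0.
have w1 : w < 1 by rewrite -sqrtr1 ltr_sqrt.
have wN N : N%:R * w ^+ N * (1 - w) <= 1.
  have := @expr_subr_le (1 - w) N; rewrite subKr => /(_ _).
  have := exprn_ge0 N w0; move=> h /(_ _); rewrite mulrDr mulr1 => H.
  have : 0 <= 1 - w <= 1 by apply/andP; lra.
  by move/H; nra.
apply: (@squeeze_cvgr _ _ _ _ (fun=> 0) (fun N => (1 - w)^-1 * w ^+ N)).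
- near=> N; rewrite mulr_ge0 ?exprn_ge0//=.
  rewrite -(sqr_sqrtr z0) -/w -exprM mulnC exprM expr2 mulrA.
  rewrite ler_wpM2r ?exprn_ge0//.
  by rewrite -[leRHS]mul1r ler_pdivlMr// subr_gt0.
- exact: cvg_cst.
- rewrite -(mulr0 (1 - w)^-1); apply: cvgMl_tmp; apply: cvg_expr.
  by rewrite ger0_norm.
Unshelve. all: by end_near. Qed.

Lemma cvg_soft_step y : 0 <= y <= 1 ->
  soft_step N y @[N --> \oo] --> ((y < 2^-1)%R%:R : R).
Proof.
move=> y01; have /andP[y0 y1] := y01.
have yN N : 0 <= y ^+ N <= 1 by rewrite exprn_ge0// exprn_ile1.
have [y2|y2] := ltP y 2^-1.
  apply: (@squeeze_cvgr _ _ _ _ (fun N => 1 - N%:R * (2 * y) ^+ N) (fun=> 1)).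
  - near=> N; rewrite soft_step_le1// andbT -soft_step_exponent.
    exact: expr_subr_ge.
  - rewrite -[X in _ --> X]subr0; apply: cvgB; first exact: cvg_cst.
    by apply: cvg_natr_expr; apply/andP; lra.
  - exact: cvg_cst.
(* Here [(2 y)^N >= 1], so the upper bound [1 / (1 + N (2 y)^N)] is at most [1 / (N + 1)], also at
   the threshold [y = 1/2]. *)
apply: (@squeeze_cvgr _ _ _ _ (fun=> 0) (fun N => N.+1%:R^-1)).
- near=> N; rewrite soft_step_ge0//= -[leRHS]mul1r ler_pdivlMr//.
  have := @expr_subr_le (y ^+ N) (N * 2 ^ N) (yN N).
  rewrite soft_step_exponent; apply: le_trans.
  rewrite ler_wpM2l ?soft_step_ge0// -nat1r lerD2l -[leLHS]mulr1.
  by rewrite ler_wpM2l// exprn_ege1//; lra.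
- exact: cvg_cst.
- exact: cvg_harmonic.
Unshelve. all: by end_near. Qed.

End SoftStep.

Section CharacteristicFunction.
Context {R : realType} {m n : nat}.
Context {d1 d2 : measure_display} {T1 : measurableType d1} {T2 : measurableType d2}.
Variables (P1 : probability T1 R) (P2 : probability T2 R).
Variables (Z1 : T1 -> 'M[R]_(m, n)) (Z2 : T2 -> 'M[R]_(m, n)).
Hypotheses (mZ1 : random_vector Z1) (mZ2 : random_vector Z2).
Local Notation borel := (borelType 'M[R]_(m, n)).
Implicit Types (f g h : 'M[R]_(m, n) -> R) (x t : 'M[R]_(m, n)).

Definition mxinner t x : R := \sum_i \sum_j t i j * x i j.

Lemma mxinnerD t t' x : mxinner (t + t') x = mxinner t x + mxinner t' x.
Proof.
rewrite -big_split; apply: eq_bigr => i _; rewrite -big_split.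
by apply: eq_bigr => j _; rewrite mxE mulrDl.
Qed.

Lemma mxinnerN t x : mxinner (- t) x = - mxinner t x.
Proof.
rewrite -sumrN; apply: eq_bigr => i _; rewrite -sumrN.
by apply: eq_bigr => j _; rewrite mxE mulNr.
Qed.

Lemma mxinner_delta i j (c : R) x : mxinner (c *: delta_mx i j) x = c * x i j.
Proof.
rewrite /mxinner (bigD1 i)//= (bigD1 j)//= !mxE !eqxx mulr1 big1 ?addr0.
  rewrite big1 ?addr0// => i' i'i; rewrite big1// => j' _.
  by rewrite !mxE (negbTE i'i) mulr0 mul0r.
by move=> j' j'j; rewrite !mxE (negbTE j'j) andbF mulr0 mul0r.
Qed.

Lemma measurable_mxinner t :
  measurable_fun [set: borel] (mxinner t : borel -> R).
Proof.
apply: measurable_sum => i; apply: measurable_sum => j.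
by apply: measurable_funM => //; exact: measurable_coord.
Qed.

Let agree h := \int[P1]_w h (Z1 w) = \int[P2]_w h (Z2 w).

Hypothesis agree_cos : forall t, agree (fun x => cos (mxinner t x)).
Hypothesis agree_sin : forall t, agree (fun x => sin (mxinner t x)).

Let bounded h := bounded_rv (T := borel) h.

Let bounded1 h : bounded h -> bounded_rv (fun w => h (Z1 w)).
Proof. by move=> [mh [C hC]]; split; [exact: measurableT_comp mh mZ1|exists C]. Qed.

Let bounded2 h : bounded h -> bounded_rv (fun w => h (Z2 w)).
Proof. by move=> [mh [C hC]]; split; [exact: measurableT_comp mh mZ2|exists C]. Qed.

Let agreeD f g : bounded f -> bounded g -> agree f -> agree g ->
  agree (fun x => f x + g x).
Proof.
move=> bf bg af ag; rewrite /agree !expectD ?af ?ag//.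
- exact: bounded2.
- exact: bounded2.
- exact: bounded1.
- exact: bounded1.
Qed.

Let agreeZ (c : R) f : bounded f -> agree f -> agree (fun x => c * f x).
Proof.
move=> bf af; rewrite /agree !expectZ ?af//; [exact: bounded2|exact: bounded1].
Qed.

Let agree_lim (fn : nat -> 'M[R]_(m, n) -> R) f (C : R) :
  (forall N, bounded (fn N)) -> (forall N x, `|fn N x| <= C) ->
  (forall x, fn N x @[N --> \oo] --> f x) -> (forall N, agree (fn N)) -> agree f.
Proof.
move=> bfn hC fnf afn.
have h1 := @cvg_expect _ _ _ P1 (fun N w => fn N (Z1 w)) (fun w => f (Z1 w)) C
  (fun N => (bounded1 (bfn N)).1) (fun N w => hC N _) (fun w => fnf _).
have h2 := @cvg_expect _ _ _ P2 (fun N w => fn N (Z2 w)) (fun w => f (Z2 w)) C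
  (fun N => (bounded2 (bfn N)).1) (fun N w => hC N _) (fun w => fnf _).
move: h1; rewrite (_ : (fun N => _) = (fun N => \int[P2]_w fn N (Z2 w))); last first.
  by apply/funext => N; exact: afn.
by move=> h1; exact: (cvg_unique _ h1 h2).
Qed.

Let bcos t : bounded (fun x => cos (mxinner t x)).
Proof. exact: (@bounded_rv_cos _ _ borel _ (measurable_mxinner t)). Qed.

Let bsin t : bounded (fun x => sin (mxinner t x)).
Proof. exact: (@bounded_rv_sin _ _ borel _ (measurable_mxinner t)). Qed.

(** Unlike [agree], this property survives multiplication by further cosines and sines, which allows
    multipliers to be composed. The hypotheses on the characteristic functions say that it holds for
    the constant 1. *)
Let trig_agree h := bounded h /\ forall t,
  agree (fun x => h x * cos (mxinner t x)) /\
  agree (fun x => h x * sin (mxinner t x)).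

(* The product formulas make [cos (mxinner t x)] and [sin (mxinner t x)]
   multipliers; multipliers form an algebra closed under bounded pointwise
   limits, which contains the indicators of half-turns of sines, hence those of
   half-spaces, hence those of orthants. *)
Let multiplier g := bounded g /\ forall h, trig_agree h ->
  trig_agree (fun x => h x * g x).

Let agree_ext f g : f =1 g -> agree f -> agree g.
Proof. by move=> /funext ->. Qed.

Let multiplier_ext f g : f =1 g -> multiplier f -> multiplier g.
Proof. by move=> /funext ->. Qed.

Let trig_agree1 : trig_agree (fun=> 1).
Proof.
split; first exact: bounded_rv_cst.
by move=> t; split; [apply: (agree_ext _ (agree_cos t)) => x|
  apply: (agree_ext _ (agree_sin t)) => x]; rewrite mul1r.
Qed.

Let multiplier_cst (c : R) : multiplier (fun=> c).
Proof.
split=> [|h [bh ah]]; first exact: bounded_rv_cst.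
split=> [|t]; first exact/bounded_rvM/bounded_rv_cst.
have [ac as_] := ah t; split.
  by apply: (agree_ext _ (agreeZ c (bounded_rvM bh (bcos t)) ac)) => x; ring.
by apply: (agree_ext _ (agreeZ c (bounded_rvM bh (bsin t)) as_)) => x; ring.
Qed.

Let multiplierM f g : multiplier f -> multiplier g ->
  multiplier (fun x => f x * g x).
Proof.
move=> [bf mf] [bg mg]; split=> [|h ah]; first exact: bounded_rvM.
have := mg _ (mf _ ah); congr (trig_agree _).
by apply/funext => x; rewrite mulrA.
Qed.

Let multiplierD f g : multiplier f -> multiplier g ->
  multiplier (fun x => f x + g x).
Proof.
move=> [bf mf] [bg mg]; split=> [|h ah]; first exact: bounded_rvD.
have [bhf af] := mf _ ah; have [bhg ag] := mg _ ah; split=> [|t].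
  by apply: bounded_rvM; [case: ah|exact: bounded_rvD].
split.
  by apply: (agree_ext _ (agreeD (bounded_rvM bhf (bcos t)) (bounded_rvM bhg (bcos t))
    (proj1 (af t)) (proj1 (ag t)))) => x; ring.
by apply: (agree_ext _ (agreeD (bounded_rvM bhf (bsin t)) (bounded_rvM bhg (bsin t))
  (proj2 (af t)) (proj2 (ag t)))) => x; ring.
Qed.

Let multiplierX g N : multiplier g -> multiplier (fun x => g x ^+ N).
Proof.
move=> mg; elim: N => [|N ih]; first exact: multiplier_cst.
by under eq_fun do rewrite exprS; exact: multiplierM.
Qed.

Let multiplier_lim (gn : nat -> 'M[R]_(m, n) -> R) g (C : R) :
  (forall N, multiplier (gn N)) -> (forall N x, `|gn N x| <= C) ->
  (forall x, gn N x @[N --> \oo] --> g x) -> multiplier g.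
Proof.
move=> mgn hC gng.
have bg : bounded g.
  by apply: (@bounded_rv_lim _ _ borel gn g C) => // N; case: (mgn N) => [[]].
split=> // h ah; split=> [|t]; first by apply: bounded_rvM => //; case: ah.
have [[mh [D hD]] _] := ah.
have D0 x : `|h x| <= `|D| by rewrite (le_trans (hD x))// ler_norm.
split.
  apply: (@agree_lim (fun N x => h x * gn N x * cos (mxinner t x)) _ (`|D| * C)).
  - move=> N; apply: bounded_rvM; last exact: bcos.
    by case: (mgn N) => [_ /(_ _ ah)[]].
  - move=> N x; rewrite normrM -[leRHS]mulr1 ler_pM// ?normrM ?ler_pM//.
    by rewrite ler_norml cos_geN1 cos_le1.
  - move=> x; apply: cvgMr_tmp; apply: cvgMl_tmp; exact: gng.
  - by move=> N; case: (mgn N) => [_ /(_ _ ah)[_ /(_ t)[]]].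
apply: (@agree_lim (fun N x => h x * gn N x * sin (mxinner t x)) _ (`|D| * C)).
- move=> N; apply: bounded_rvM; last exact: bsin.
  by case: (mgn N) => [_ /(_ _ ah)[]].
- move=> N x; rewrite normrM -[leRHS]mulr1 ler_pM// ?normrM ?ler_pM//.
  by rewrite ler_norml sin_geN1 sin_le1.
- move=> x; apply: cvgMr_tmp; apply: cvgMl_tmp; exact: gng.
- by move=> N; case: (mgn N) => [_ /(_ _ ah)[_ /(_ t)[]]].
Qed.

Let multiplier_cos t : multiplier (fun x => cos (mxinner t x)).
Proof.
split=> [|h [bh ah]]; first exact: bcos.
split=> [|u]; first exact: bounded_rvM bh (bcos t).
have [ac1 as1] := ah (u + t); have [ac2 as2] := ah (u - t).
have bc v := bounded_rvM bh (bcos v); have bs v := bounded_rvM bh (bsin v).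
split.
  apply: (agree_ext _ (agreeZ (2^-1) (bounded_rvD (bc _) (bc _))
    (agreeD (bc _) (bc _) ac1 ac2))) => x.
  by rewrite !mxinnerD mxinnerN cosD cosB; field.
apply: (agree_ext _ (agreeZ (2^-1) (bounded_rvD (bs _) (bs _))
  (agreeD (bs _) (bs _) as1 as2))) => x.
by rewrite !mxinnerD mxinnerN sinD sinB; field.
Qed.

Let multiplier_sin t : multiplier (fun x => sin (mxinner t x)).
Proof.
split=> [|h [bh ah]]; first exact: bsin.
split=> [|u]; first exact: bounded_rvM bh (bsin t).
have [ac1 as1] := ah (u + t); have [ac2 as2] := ah (u - t).
have bc v := bounded_rvM bh (bcos v); have bs v := bounded_rvM bh (bsin v).
split.
  apply: (agree_ext _ (agreeZ (2^-1) (bounded_rvD (bs _) (bounded_rvZ (-1) (bs _)))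
    (agreeD (bs _) (bounded_rvZ (-1) (bs _)) as1 (agreeZ (-1) (bs _) as2)))) => x.
  by rewrite !mxinnerD mxinnerN sinD sinB; field.
apply: (agree_ext _ (agreeZ (2^-1) (bounded_rvD (bc _) (bounded_rvZ (-1) (bc _)))
  (agreeD (bc _) (bounded_rvZ (-1) (bc _)) ac2 (agreeZ (-1) (bc _) ac1)))) => x.
by rewrite !mxinnerD mxinnerN cosB cosD; field.
Qed.

(** With [y = (1 - sin) / 2], which lies in [[0, 1]] and is below 1/2 exactly where the sine is
    positive, [soft_step N y] is a polynomial in multipliers and converges boundedly to the
    indicator. *)
Let multiplier_half_turn i j (c L : R) :
  multiplier (fun x => (0 < sin ((x i j - c) / L))%R%:R).
Proof.
pose y x := (1 - sin ((x i j - c) / L)) / 2.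
have y01 x : 0 <= y x <= 1.
  by have := sin_geN1 ((x i j - c) / L); have := sin_le1 ((x i j - c) / L); rewrite /y; lra.
apply: (@multiplier_lim (fun N x => soft_step N (y x)) _ 1) => [N|N x|x].
- pose t : 'M[R]_(m, n) := L^-1 *: delta_mx i j.
  have my : multiplier y.
    apply: (multiplier_ext _ (multiplierD (multiplier_cst (2^-1)) (multiplierD
      (multiplierM (multiplier_cst (- (2^-1 * cos (c / L)))) (multiplier_sin t))
      (multiplierM (multiplier_cst (2^-1 * sin (c / L))) (multiplier_cos t))))) => x.
    rewrite /y mxinner_delta.
    by rewrite (mulrBl _ (x i j)) sinB (mulrC L^-1); field.
  rewrite /soft_step; apply: multiplierX.
  apply: (multiplier_ext _ (multiplierD (multiplier_cst 1)
    (multiplierM (multiplier_cst (-1)) (multiplierX N my)))) => x.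
  by rewrite mulN1r.
- by rewrite ger0_norm ?soft_step_ge0 ?soft_step_le1.
- rewrite (_ : (0 < _) = (y x < 2^-1)); first exact: cvg_soft_step.
  by apply/idP/idP; rewrite /y; lra.
Qed.

(** Division by [N.+1] stretches the period: for fixed [x], the argument eventually lies strictly
    between [- pi] and [pi], where the sine has the sign of [x i j - c]. *)
Let multiplier_half_space i j (c : R) : multiplier (fun x => (c < x i j)%R%:R).
Proof.
apply: (@multiplier_lim (fun N x => (0 < sin ((x i j - c) / N.+1%:R))%R%:R) _ 1).
- by move=> N; exact: multiplier_half_turn.
- by move=> N x; case: (_ < _); rewrite ?normr1 ?normr0.
move=> x; apply: cvg_near_cst.
have pi0 := pi_gt0 R.
pose z := `|x i j - c|.
near=> N.
have zN : z / N.+1%:R < pi.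
  rewrite ltr_pdivrMr// mulrC -ltr_pdivrMr//; near: N.
  exists (Num.truncn (z / pi)) => // N /= hN.
  by rewrite (lt_le_trans (truncnS_gt _))// ler_nat ltnS.
have [xc|xc|<-] := ltgtP c (x i j).
- rewrite sin_gt0_pi// ?divr_gt0 ?subr_gt0//= (le_lt_trans _ zN)//.
  by rewrite ler_pM2r ?invr_gt0// ler_norm.
- apply/eqP; rewrite pnatr_eq0 eqb0 -leNgt -oppr_ge0 -sinN.
  apply: sin_ge0_pi; rewrite -mulNr opprB divr_ge0 ?subr_ge0 1?ltW//=.
  by rewrite (le_lt_trans _ zN)// ler_pM2r ?invr_gt0// /z distrC ler_norm.
- by rewrite subrr mul0r sin0 ltxx.
Unshelve. all: by end_near. Qed.

(** The constraints form a list in which coordinates may be absent or repeated. Intersection is then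
    concatenation, so these sets form a pi-system. *)
Let orthant (s : seq ('I_m * 'I_n * R)) : set 'M[R]_(m, n) :=
  [set x | all (fun p => (p.2 < x p.1.1 p.1.2)%R) s].

Let multiplier_orthant s : multiplier (fun x =>
  (all (fun p : 'I_m * 'I_n * R => (p.2 < x p.1.1 p.1.2)%R) s)%:R).
Proof.
elim: s => [|p s ih]; first exact: multiplier_cst.
apply: (multiplier_ext _
  (multiplierM (multiplier_half_space p.1.1 p.1.2 p.2) ih)) => x /=.
by rewrite -natrM mulnb.
Qed.

Let measurable_orthant s : measurable (orthant s : set borel).
Proof.
elim: s => [|p s ih]; first by rewrite (_ : orthant _ = setT)//; apply/seteqP; split.
have := measurableI _ _ (measurable_half_space p.1.1 p.1.2 p.2) ih.
by congr measurable; apply/seteqP; split=> [x [h1 h2]|x /andP//]; apply/andP; split.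
Qed.

Let orthant_law s : P1 (Z1 @^-1` orthant s) = P2 (Z2 @^-1` orthant s).
Proof.
(* The multiplier is applied to the constant 1 and tested at frequency 0, where the cosine is 1:
   what remains is an equality of probabilities. *)
have [bo /(_ _ trig_agree1)[_ /(_ 0)[]]] := multiplier_orthant s.
rewrite /agree => h _; move: h.
have E x : 1 * (all (fun p : 'I_m * 'I_n * R => (p.2 < x p.1.1 p.1.2)%R) s)%:R *
    cos (mxinner 0 x) = \1_(orthant s) x.
  rewrite mul1r /mxinner big1 ?cos0 ?mulr1; last first.
    by move=> i _; rewrite big1// => j _; rewrite mxE mul0r.
  rewrite indicE; congr (_%:R); congr nat_of_bool; apply/idP/idP => [h|].
    by apply/mem_set.
  by move/set_mem.
under eq_Rintegral do rewrite E.
under [RHS]eq_Rintegral do rewrite E.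
move=> h.
have m1 : measurable (Z1 @^-1` orthant s).
  by rewrite -[_ @^-1` _]setTI; apply: mZ1 => //; exact: measurable_orthant.
have m2 : measurable (Z2 @^-1` orthant s).
  by rewrite -[_ @^-1` _]setTI; apply: mZ2 => //; exact: measurable_orthant.
by rewrite -!expect_indic//; congr EFin; exact: h.
Qed.

(** Dynkin's pi-lambda theorem: the two laws agree on orthants, a pi-system that contains the
    half-spaces and hence generates the Borel sets. *)
Theorem eq_law_charfun : eq_law P1 P2 Z1 Z2.
Proof.
pose G := [set orthant s | s in setT].
have GE : @measurable _ borel = <<s G>>.
  apply/seteqP; split=> A; last first.
    apply: smallest_sub; first exact: sigma_algebra_measurable.
    by move=> _ [s _ <-]; exact: measurable_orthant.
  rewrite borel_matrixE; apply: smallest_sub; first exact: smallest_sigma_algebra.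
  move=> _ [i [j [c ->]]]; apply: sub_sigma_algebra.
  by exists [:: (i, j, c)] => //; apply/seteqP; split=> x; rewrite /orthant /= andbT.
move=> A; rewrite GE; apply: (@dynkin_induction _ borel G
  (fun B => P1 (Z1 @^-1` B) = P2 (Z2 @^-1` B)) GE).
- move=> _ _ [s _ <-] [t _ <-]; exists (s ++ t) => //.
  apply/seteqP; split=> x; rewrite /orthant /= all_cat; first by move/andP.
  by move=> [h1 h2]; apply/andP; split.
- by rewrite !preimage_setT; apply: etrans (probability_setT _) (esym (probability_setT _)).
- by move=> _ [s _ <-]; exact: orthant_law.
- move=> B mB PB; rewrite -!preimage_setC !probability_setC ?PB//.
    by rewrite -[_ @^-1` _]setTI; exact: mZ2.
  by rewrite -[_ @^-1` _]setTI; exact: mZ1.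
- move=> F mF tF PF; rewrite !preimage_bigcup !measure_bigcup//.
  + by apply: eq_eseriesr => i _; exact: PF.
  + by move=> i _; rewrite -[_ @^-1` _]setTI; exact: mZ2.
  + by move=> i j _ _ [w [h1 h2]]; apply: tF => //; exists (Z2 w).
  + by move=> i _; rewrite -[_ @^-1` _]setTI; exact: mZ1.
  + by move=> i j _ _ [w [h1 h2]]; apply: tF => //; exists (Z1 w).
Qed.

End CharacteristicFunction.

(** * Complex expectations and independence *)

Section ComplexExpectation.
Context {R : realType}.
Local Notation Re := complex.Re.
Local Notation Im := complex.Im.

Lemma complex_ext (z z' : R[i]) : Re z = Re z' -> Im z = Im z' -> z = z'.
Proof. by case: z z' => [a b] [c e] /= -> ->. Qed.

Lemma ReM (z z' : R[i]) : Re (z * z') = Re z * Re z' - Im z * Im z'.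
Proof. by case: z z' => [a b] [c e]. Qed.

Lemma ImM (z z' : R[i]) : Im (z * z') = Re z * Im z' + Im z * Re z'.
Proof. by case: z z' => [a b] [c e]. Qed.

Lemma ReD (z z' : R[i]) : Re (z + z') = Re z + Re z'.
Proof. by case: z z' => [a b] [c e]. Qed.

Lemma ImD (z z' : R[i]) : Im (z + z') = Im z + Im z'.
Proof. by case: z z' => [a b] [c e]. Qed.

Lemma expiD (x y : R) : expi (x + y) = expi x * expi y.
Proof.
apply: complex_ext; rewrite ?ReM ?ImM /= ?cosD ?sinD//.
by rewrite addrC (mulrC (cos x)) [X in _ + X]mulrC mulrC [X in X + _]mulrC.
Qed.

Lemma expi0 : expi (0 : R) = 1.
Proof. by rewrite /expi cos0 sin0. Qed.

Lemma cexpD (z z' : R[i]) : cexp (z + z') = cexp z * cexp z'.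
Proof.
apply: complex_ext; rewrite /cexp !(ReM, ImM, ReD, ImD) /= expRD cosD sinD; ring.
Qed.

Lemma cexp0 : cexp (0 : R[i]) = 1.
Proof. by rewrite /cexp /= expR0 expi0 mulr1. Qed.

Context {d0 : measure_display} {T : measurableType d0}.
Variable P : probability T R.

Definition bounded_crv (H : T -> R[i]) :=
  bounded_rv (fun w => Re (H w)) /\ bounded_rv (fun w => Im (H w)).

Lemma bounded_crvM H K : bounded_crv H -> bounded_crv K ->
  bounded_crv (fun w => H w * K w).
Proof.
move=> [h1 h2] [k1 k2]; split.
  by under eq_fun do rewrite ReM; apply: bounded_rvB; exact: bounded_rvM.
by under eq_fun do rewrite ImM; apply: bounded_rvD; exact: bounded_rvM.
Qed.

Lemma bounded_crv_cst (c : R[i]) : bounded_crv (fun=> c).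
Proof. by split; exact: bounded_rv_cst. Qed.

Lemma bounded_crv_prod (I : Type) (s : seq I) (Q : pred I) (F : I -> T -> R[i]) :
  (forall i, bounded_crv (F i)) -> bounded_crv (fun w => \prod_(i <- s | Q i) F i w).
Proof.
move=> bF; elim: s => [|i s ih].
  by under eq_fun do rewrite big_nil; exact: bounded_crv_cst.
under eq_fun do rewrite big_cons; case: (Q i) => //.
exact: bounded_crvM.
Qed.

Lemma bounded_crv_expi (W : T -> R) : measurable_fun [set: T] W ->
  bounded_crv (fun w => expi (W w)).
Proof. by move=> mW; split; [exact: bounded_rv_cos|exact: bounded_rv_sin]. Qed.

Lemma bounded_crv_indic (A : set T) : measurable A ->
  bounded_crv (fun w => (\1_A w : R)%:C%C).
Proof. by move=> mA; split; [exact: bounded_rv_indic|exact: bounded_rv_cst]. Qed.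

Lemma Cexpect_indic (A : set T) : measurable A ->
  Cexpect P (fun w => (\1_A w : R)%:C%C) = (fine (P A))%:C%C.
Proof.
by move=> mA; apply: complex_ext; rewrite /= ?expect_cst// -expect_indic.
Qed.

Lemma Cexpect_ae (H K : T -> R[i]) : bounded_crv H -> bounded_crv K ->
  {ae P, forall w, H w = K w} -> Cexpect P H = Cexpect P K.
Proof.
move=> [h1 h2] [k1 k2] HK; apply: complex_ext => /=; apply: expect_ae => //;
  by apply: filterS HK => w ->.
Qed.

(** The sum counts the integers in [[0, x[] below [N], so it is the ceiling of [x] capped at [N].
    The saturated case [N <= x] carries the induction. *)
Lemma count_below (x : R) (N : nat) : 0 <= x ->
  (x <= N%:R -> x <= \sum_(0 <= i < N) ((i%:R < x)%R%:R : R) <= x + 1) /\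
  (N%:R <= x -> \sum_(0 <= i < N) ((i%:R < x)%R%:R : R) = N%:R).
Proof.
move=> x0; elim: N => [|N [ih1 ih2]].
  by rewrite big_nil; split=> // x0'; apply/andP; lra.
rewrite big_nat_recr//=; have [Nx|xN] := ltP N%:R x; split=> h.
- rewrite (ih2 (ltW Nx)) mulr1n; move: h; rewrite -(natr1 N) => h.
  by apply/andP; lra.
- by rewrite (ih2 (ltW Nx)) mulr1n natr1.
- by rewrite mulr0n addr0; exact: ih1.
- by exfalso; move: h; rewrite -(natr1 N); lra.
Qed.

(* [g] with values in [0, 1] is the uniform limit of the averages of the
   indicators of its superlevel sets [{g > i / N}]. *)
Lemma expect_decouple_unit {d1 : measure_display} {S : measurableType d1}
    (U : T -> S) (h : T -> R) (g : S -> R) :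
  measurable_fun [set: T] U -> bounded_rv h ->
  (forall B, measurable B ->
    \int[P]_w (h w * \1_(U @^-1` B) w) = \int[P]_w h w * fine (P (U @^-1` B))) ->
  measurable_fun [set: S] g -> (forall x, 0 <= g x <= 1) ->
  \int[P]_w (h w * g (U w)) = \int[P]_w h w * \int[P]_w g (U w).
Proof.
move=> mU bh hB mg g01.
pose B N i := [set x | i%:R / N.+1%:R < g x].
have mB N i : measurable (B N i).
  rewrite (_ : B N i = [set: S] `&` g @^-1` `]i%:R / N.+1%:R, +oo[%classic).
    exact: mg.
  by rewrite setTI; apply/seteqP; split=> x; rewrite /B /= in_itv/= andbT.
have mUB N i : measurable (U @^-1` B N i).
  by rewrite -[_ @^-1` _]setTI; exact: mU.
pose G N w := N.+1%:R^-1 * \sum_(0 <= i < N.+1) (\1_(U @^-1` B N i) w : R).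
have bG N : bounded_rv (G N).
  by apply: bounded_rvZ; apply: bounded_rv_sum => i; exact: bounded_rv_indic.
have bgU : bounded_rv (fun w => g (U w)).
  split; first exact: measurableT_comp mg mU.
  by exists 1 => w; case/andP: (g01 (U w)) => ? ?; rewrite ger0_norm.
have Gg N w : `|G N w - g (U w)| <= N.+1%:R^-1.
  have M0 : 0 < N.+1%:R :> R by [].
  have /andP[y0 y1] := g01 (U w).
  have x0 : 0 <= g (U w) * N.+1%:R by rewrite mulr_ge0.
  have xM : g (U w) * N.+1%:R <= N.+1%:R by rewrite ler_piMl.
  have [/(_ xM)/andP[h1 h2] _] := @count_below (g (U w) * N.+1%:R) N.+1 x0.
  rewrite /G (eq_bigr (fun i => ((i%:R < g (U w) * N.+1%:R)%R%:R : R))); last first.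
    move=> i _; rewrite indicE -ltr_pdivrMr//; congr (_%:R); congr nat_of_bool.
    by apply/idP/idP => [/set_mem//|iw]; apply/mem_set.
  rewrite -(@ler_pM2l _ N.+1%:R)// mulfV ?gt_eqF// -[X in X * `|_|]gtr0_norm//.
  by rewrite -normrM mulrBr mulVKf ?gt_eqF// (mulrC _ (g _)) ler_norml; apply/andP; lra.
have EG N : \int[P]_w (h w * G N w) = \int[P]_w h w * \int[P]_w G N w.
  rewrite expectZ; last by apply: bounded_rv_sum => i; exact: bounded_rv_indic.
  rewrite expect_sum; last by move=> i; exact: bounded_rv_indic.
  rewrite (_ : (fun w => _) = (fun w => N.+1%:R^-1 *
    \sum_(0 <= i < N.+1) (h w * \1_(U @^-1` B N i) w))); last first.
    by apply/funext => w; rewrite /G mulrCA big_distrr.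
  rewrite expectZ; last first.
    by apply: bounded_rv_sum => i; apply: bounded_rvM => //; exact: bounded_rv_indic.
  rewrite expect_sum; last first.
    by move=> i; apply: bounded_rvM => //; exact: bounded_rv_indic.
  rewrite [RHS]mulrCA; congr (_ * _); rewrite big_distrr/=; apply: eq_bigr => i _.
  by rewrite hB// -expect_indic.
have [C hC] := bh.2.
have Gg_cvg w : G N w @[N --> \oo] --> g (U w).
  apply/cvgrPdist_le => /= e e0.
  have /cvgrPdist_lt/(_ _ e0) := @cvg_harmonic R.
  apply: filterS => N /=; rewrite sub0r normrN ger0_norm// => /ltW; apply: le_trans.
  by rewrite distrC.
have G01 N w : `|G N w| <= 2.
  have -> : G N w = (G N w - g (U w)) + g (U w) by rewrite subrK.
  rewrite (le_trans (ler_normD _ _))// [leRHS](_ : _ = 1 + 1)// lerD//.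
    rewrite (le_trans (Gg N w))// invf_le1// ler1n//.
  by case/andP: (g01 (U w)) => ? ?; rewrite ger0_norm.
have c1 : \int[P]_w (h w * G N w) @[N --> \oo] --> \int[P]_w (h w * g (U w)).
  apply: (cvg_expect (C := `|C| * 2)).
  - by move=> N; case: (bounded_rvM bh (bG N)).
  - by move=> N w; rewrite normrM ler_pM// (le_trans (hC w))// ler_norm.
  - by move=> w; apply: cvgMl_tmp; exact: Gg_cvg.
have c2 : \int[P]_w h w * \int[P]_w G N w @[N --> \oo] -->
    \int[P]_w h w * \int[P]_w g (U w).
  apply: cvgMl_tmp; apply: (cvg_expect (C := 2)) => //.
  by move=> N; case: (bG N).
have c1' : \int[P]_w h w * \int[P]_w G N w @[N --> \oo] -->
   \int[P]_w (h w * g (U w)).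
  by under eq_fun do rewrite -EG.
exact: (cvg_unique _ c1' c2).
Qed.

Lemma expect_decouple {d1 : measure_display} {S : measurableType d1}
    (U : T -> S) (h : T -> R) (g : S -> R) :
  measurable_fun [set: T] U -> bounded_rv h ->
  (forall B, measurable B ->
    \int[P]_w (h w * \1_(U @^-1` B) w) = \int[P]_w h w * fine (P (U @^-1` B))) ->
  bounded_rv g ->
  \int[P]_w (h w * g (U w)) = \int[P]_w h w * \int[P]_w g (U w).
Proof.
move=> mU bh hB [mg [C hC]].
have C0 : 0 <= C by apply: le_trans (hC point).
(* The affine map [y -> (y + C) / D] sends [[- C, C]] into [[0, 1]]; the added 1 keeps [D] positive
   when [C = 0]. *)
pose D := 2 * (C + 1); have D0 : 0 < D by rewrite /D; lra.
pose g' x := D^-1 * (g x + C).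
have bgU : bounded_rv (fun w => g (U w)).
  by split; [exact: measurableT_comp mg mU|exists C].
have mg' : measurable_fun [set: S] g'.
  by apply: measurable_funM => //; exact: measurable_funD.
have g'01 x : 0 <= g' x <= 1.
  have := hC x; rewrite ler_norml => /andP[h1 h2].
  apply/andP; split; first by apply: mulr_ge0; [rewrite invr_ge0 ltW|lra].
  by rewrite ler_pdivrMl// mulr1 /D; lra.
have bhg := bounded_rvM bh bgU.
have E1 : \int[P]_w (h w * g' (U w)) =
    D^-1 * (\int[P]_w (h w * g (U w)) + C * \int[P]_w h w).
  rewrite -(expectZ P C bh) -expectD//; last exact: bounded_rvZ.
  rewrite -expectZ; last exact/bounded_rvD/bounded_rvZ.
  by apply: eq_Rintegral => w _; rewrite /g'; ring.
have E2 : \int[P]_w g' (U w) = D^-1 * (\int[P]_w g (U w) + C).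
  rewrite -[in RHS](expect_cst P C) -expectD//; last exact: bounded_rv_cst.
  by rewrite -expectZ//; exact/bounded_rvD/bounded_rv_cst.
have := @expect_decouple_unit _ S U h g' mU bh hB mg' g'01.
rewrite E1 E2 => /(congr1 (fun z => D * z)); rewrite mulrA mulfV ?gt_eqF// mul1r.
rewrite mulrCA mulVKf ?gt_eqF// mulrDr => h1.
by apply: (addIr (C * \int[P]_w h w)); rewrite h1 (mulrC C).
Qed.

Lemma Cexpect_decouple {d1 : measure_display} {S : measurableType d1}
    (U : T -> S) (H : T -> R[i]) (g : S -> R[i]) :
  measurable_fun [set: T] U -> bounded_crv H ->
  (forall B, measurable B ->
    Cexpect P (fun w => H w * (\1_(U @^-1` B) w : R)%:C%C) =
    Cexpect P H * (fine (P (U @^-1` B)))%:C%C) ->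
  bounded_rv (fun x => Re (g x)) -> bounded_rv (fun x => Im (g x)) ->
  Cexpect P (fun w => H w * g (U w)) = Cexpect P H * Cexpect P (fun w => g (U w)).
Proof.
move=> mU [h1 h2] hB g1 g2.
have hB1 B : measurable B -> \int[P]_w (Re (H w) * \1_(U @^-1` B) w) =
    \int[P]_w Re (H w) * fine (P (U @^-1` B)).
  move=> mB; have := congr1 (fun z => Re z) (hB _ mB).
  rewrite ReM /= !mulr0 subr0 => <-; apply: eq_Rintegral => w _.
  by rewrite ReM /= mulr0 subr0.
have hB2 B : measurable B -> \int[P]_w (Im (H w) * \1_(U @^-1` B) w) =
    \int[P]_w Im (H w) * fine (P (U @^-1` B)).
  move=> mB; have := congr1 (fun z => Im z) (hB _ mB).
  rewrite ImM /= !mulr0 add0r => <-; apply: eq_Rintegral => w _.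
  by rewrite ImM /= mulr0 add0r.
have bU (f : S -> R) : bounded_rv f -> bounded_rv (fun w => f (U w)).
  by move=> [mf [C hC]]; split; [exact: measurableT_comp mf mU|exists C].
have e11 := expect_decouple mU h1 hB1 g1.
have e12 := expect_decouple mU h1 hB1 g2.
have e21 := expect_decouple mU h2 hB2 g1.
have e22 := expect_decouple mU h2 hB2 g2.
apply: complex_ext; rewrite ?ReM ?ImM /=.
  rewrite -e11 -e22 -expectB; [|exact: (bounded_rvM h1 (bU _ g1))
                               |exact: (bounded_rvM h2 (bU _ g2))].
  by apply: eq_Rintegral => w _; rewrite ReM.
rewrite -e12 -e21 -expectD; [|exact: (bounded_rvM h1 (bU _ g2))
                             |exact: (bounded_rvM h2 (bU _ g1))].
by apply: eq_Rintegral => w _; rewrite ImM.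
Qed.

(** Indicators are replaced by exponentials one factor at a time: [F m] has exponentials at the
    indices below [m] and indicators elsewhere. The induction keeps the sets [B] arbitrary, which is
    exactly what is needed to decouple the next factor from the product of the others. *)
Lemma independent_expi (n d : nat) (Z : 'I_n -> T -> 'cV[R]_d)
    (g : 'I_n -> 'cV[R]_d -> R) :
  (forall j, random_vector (Z j)) -> independent P Z ->
  (forall j, measurable_fun [set: borelType 'cV[R]_d] (g j : borelType 'cV[R]_d -> R)) ->
  Cexpect P (fun w => expi (\sum_j g j (Z j w))) =
  \prod_j Cexpect P (fun w => expi (g j (Z j w))).
Proof.
move=> mZ indZ mg.
have mZB j B : measurable (B : set (borelType 'cV[R]_d)) ->
    measurable (Z j @^-1` B).
  by move=> mB; rewrite -[_ @^-1` _]setTI; exact: mZ.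
have mgZ j : measurable_fun [set: T] (fun w => g j (Z j w)).
  exact: measurableT_comp (mg j) (mZ j).
pose F (m : nat) (B : 'I_n -> set 'cV[R]_d) (j : 'I_n) w : R[i] :=
  if (j < m)%N then expi (g j (Z j w)) else (\1_(Z j @^-1` B j) w : R)%:C%C.
have bF m B j : measurable (B j : set (borelType 'cV[R]_d)) -> bounded_crv (F m B j).
  move=> mB; rewrite /F; case: (j < m)%N; first exact: bounded_crv_expi.
  exact/bounded_crv_indic/mZB.
have main m : (m <= n)%N -> forall B,
    (forall j, measurable (B j : set (borelType 'cV[R]_d))) ->
    Cexpect P (fun w => \prod_j F m B j w) = \prod_j Cexpect P (F m B j).
  elim: m => [_|m ih mn] B mB.
    rewrite (_ : (fun w => _) = fun w =>
        (\1_(\bigcap_(i in [set: 'I_n]) (Z i @^-1` B i)) w : R)%:C%C); last first.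
      apply/funext => w; rewrite indicE; case: (boolP (w \in _)) => [/set_mem h|/negP h].
        by rewrite big1// => j _; rewrite /F ltn0 indicE mem_set//; exact: h.
      have [j hj] : exists j, ~ B j (Z j w).
        by apply/existsNP => h'; apply: h; apply/mem_set => j _; exact: h'.
      rewrite (bigD1 j)//= {1}/F ltn0 indicE (_ : (w \in _) = false) ?mul0r//.
      by apply/negP => /set_mem.
    rewrite Cexpect_indic; last by apply: fin_bigcap_measurable => // j _; exact: mZB.
    rewrite indZ// [RHS](eq_bigr (fun j => (fine (P (Z j @^-1` B j)))%:C%C)); last first.
      by move=> j _; rewrite /F ltn0 Cexpect_indic//; exact: mZB.
    rewrite -rmorph_prod; congr (_%:C)%C.
    rewrite (eq_bigr (fun j => (fine (P (Z j @^-1` B j)))%:E)); last first.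
      by move=> j _; rewrite fineK// fin_num_measure//; exact: mZB.
    by rewrite prodEFin.
  pose jm := Ordinal mn.
  have FS j : j != jm -> F m.+1 B j = F m B j.
    move=> jjm; rewrite /F ltnS leq_eqVlt (_ : (j == m :> nat) = false)//.
    by apply/negbTE.
  pose H w := \prod_(j | j != jm) F m B j w.
  have bH : bounded_crv H by apply: bounded_crv_prod => j; exact: bF.
  pose K := \prod_(j | j != jm) Cexpect P (F m B j).
  (* The induction hypothesis with the set at index [jm] replaced by an arbitrary [B']. *)
  have HK B' : measurable (B' : set (borelType 'cV[R]_d)) ->
      Cexpect P (fun w => H w * (\1_(Z jm @^-1` B') w : R)%:C%C) =
      K * (fine (P (Z jm @^-1` B')))%:C%C.
    move=> mB'; pose B1 j := if j == jm then B' else B j.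
    have B1jm : F m B1 jm = fun w => (\1_(Z jm @^-1` B') w : R)%:C%C.
      by apply/funext => w; rewrite /F /= ltnn /B1 eqxx.
    have B1j j : j != jm -> F m B1 j = F m B j.
      by move=> jjm; apply/funext => w; rewrite /F /B1 (negbTE jjm).
    have := ih (ltnW mn) B1.
    rewrite (bigD1 jm)//= B1jm Cexpect_indic; last exact: mZB.
    rewrite (_ : \prod_(i | _) _ = K); last first.
      by apply: eq_bigr => j jjm; rewrite B1j.
    rewrite mulrC => <-; last by move=> j; rewrite /B1; case: ifP.
    congr Cexpect; apply/funext => w; rewrite (bigD1 jm)//= B1jm mulrC.
    by congr (_ * _); apply: eq_bigr => j jjm; rewrite B1j.
  (* The choice [B' = setT] removes the factor [jm] and identifies the constant [K]. *)
  have HT : Cexpect P H = K.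
    have := HK setT measurableT.
    rewrite preimage_setT (_ : fine (P setT) = 1); last first.
      by rewrite -[RHS]/(fine 1%E); congr fine; exact: probability_setT.
    rewrite mulr1 => <-; congr Cexpect; apply/funext => w.
    by rewrite indicT mulr1.
  rewrite [RHS](bigD1 jm)//= (_ : \prod_(i | _) _ = K); last first.
    by apply: eq_bigr => j jjm; rewrite FS.
  have := @Cexpect_decouple _ (borelType 'cV[R]_d) (Z jm) H (fun x => expi (g jm x)) (mZ jm) bH.
  rewrite HT => /(_ HK) h.
  rewrite mulrC (_ : F m.+1 B jm = fun w => expi (g jm (Z jm w))); last first.
    by apply/funext => w; rewrite /F /= ltnSn.
  rewrite -h; last 2 first.
  - exact: (@bounded_rv_cos _ _ (borelType 'cV[R]_d) _ (mg jm)).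
  - exact: (@bounded_rv_sin _ _ (borelType 'cV[R]_d) _ (mg jm)).
  congr Cexpect; apply/funext => w; rewrite (bigD1 jm)//= mulrC; congr (_ * _).
    by apply: eq_bigr => j jjm; rewrite FS.
  by rewrite /F /= ltnSn.
have FE j : F n (fun=> setT) j = fun w => expi (g j (Z j w)).
  by apply/funext => w; rewrite /F ltn_ord.
have := main n (leqnn n) (fun=> setT) (fun=> measurableT).
rewrite (eq_bigr (fun j => Cexpect P (fun w => expi (g j (Z j w))))); last first.
  by move=> j _; rewrite FE.
move=> <-; congr Cexpect; apply/funext => w.
rewrite (big_morph _ expiD expi0); apply: eq_bigr => j _.
by rewrite FE.
Qed.

End ComplexExpectation.

(** * Convergence in probability through characteristic functions *)

Section Kappa.
Context {R : realType} {d0 : measure_display} {T : measurableType d0}.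
Variable P : probability T R.
Implicit Types U V : T -> R.
Local Notation mfun := (measurable_fun [set: T]).

(* A quasi-norm for convergence in probability that depends on U only through
   its characteristic function at 1. *)
Definition kappa U : R := \int[P]_w (1 - cos (U w)).

Let brv U : mfun U -> bounded_rv (fun w => 1 - cos (U w)).
Proof. by move=> mU; apply: bounded_rvB; [exact: bounded_rv_cst|exact: bounded_rv_cos]. Qed.

Lemma kappaE U : mfun U -> kappa U = 1 - complex.Re (Cexpect P (fun w => expi (U w))).
Proof.
move=> mU; rewrite /kappa expectB ?expect_cst//; first exact: bounded_rv_cst.
exact: bounded_rv_cos.
Qed.

Lemma kappa_ge0 U : 0 <= kappa U.
Proof. by apply: Rintegral_ge0 => w _; rewrite subr_ge0 cos_le1. Qed.

Lemma kappaN U : kappa (fun w => - U w) = kappa U.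
Proof. by apply: eq_Rintegral => w _; rewrite cosN. Qed.

Lemma kappa_ae U V : mfun U -> mfun V -> {ae P, forall w, U w = V w} ->
  kappa U = kappa V.
Proof.
move=> mU mV UV; apply: expect_ae; [exact: brv|exact: brv|].
by apply: filterS UV => w ->.
Qed.

(** [1 - cos u] is half the squared modulus of [1 - exp(i u)], and [1 - exp(i (u + v))] has modulus
    at most the sum of the moduli of [1 - exp(i u)] and [1 - exp(i v)]; squaring this sum costs the
    factor 2. *)
Lemma kappaD U V : mfun U -> mfun V ->
  kappa (fun w => U w + V w) <= 2 * kappa U + 2 * kappa V.
Proof.
move=> mU mV; rewrite /kappa -!expectZ; [|exact: brv..].
rewrite -expectD; [|exact/bounded_rvZ/brv..].
apply: le_expect.
- by apply: brv; exact: measurable_funD.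
- by apply: bounded_rvD; exact/bounded_rvZ/brv.
move=> w; rewrite cosD.
have := cos2Dsin2 (U w); have := cos2Dsin2 (V w).
set a := cos (U w); set b := sin (U w); set c := cos (V w); set e := sin (V w).
(* The squared modulus of [exp(i u) + exp(- i v) - 2]; expanded, it is twice the difference of the
   two sides. *)
move=> h1 h2; have : 0 <= (a + c - 2) ^+ 2 + (b - e) ^+ 2.
  by apply: addr_ge0; exact: sqr_ge0.
rewrite !expr2 in h1 h2 *; nra.
Qed.

Lemma kappaB U V : mfun U -> mfun V ->
  kappa (fun w => U w - V w) <= 2 * kappa U + 2 * kappa V.
Proof.
by move=> mU mV; rewrite -(kappaN V); apply: kappaD => //; exact: measurableT_comp mV.
Qed.

Lemma kappa_triangle U V (W : T -> R) : mfun U -> mfun V -> mfun W ->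
  kappa (fun w => U w - W w) <=
  2 * kappa (fun w => U w - V w) + 2 * kappa (fun w => V w - W w).
Proof.
move=> mU mV mW.
rewrite (_ : (fun w => U w - W w) = fun w => (U w - V w) + (V w - W w)).
  by apply: kappaD; exact: measurable_funB.
by apply/funext => w; rewrite addrA subrK.
Qed.

(** Young's inequality [|u| <= e / 2 + u^2 / (2 e)]. Integrated, it takes the place of
    Cauchy-Schwarz. *)
Let abs_le (u e k : R) : 0 < e -> u ^+ 2 <= 2 * k -> `|u| <= e / 2 + (2 * e)^-1 * (2 * k).
Proof.
move=> e0 uk.
have : `|u| * (2 * e) <= (e / 2 + (2 * e)^-1 * (2 * k)) * (2 * e).
  have -> : (e / 2 + (2 * e)^-1 * (2 * k)) * (2 * e) = e ^+ 2 + 2 * k.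
    by field; exact: lt0r_neq0.
  have := sqr_ge0 (`|u| - e); have := real_normK (num_real u).
  rewrite !expr2 in uk *; nra.
by rewrite ler_pM2r// mulr_gt0.
Qed.

(** The squared distance between [exp(i U)] and [exp(i V)] is [2 (1 - cos (U - V))], whose mean is
    at most [e^2] by hypothesis. Hence the threshold [e ^+ 2 / 2] throughout. *)
Lemma kappa_charfun U V (e : R) : mfun U -> mfun V -> 0 < e ->
  kappa (fun w => U w - V w) <= e ^+ 2 / 2 ->
  `|complex.Re (Cexpect P (fun w => expi (U w))) -
    complex.Re (Cexpect P (fun w => expi (V w)))| <= e /\
  `|complex.Im (Cexpect P (fun w => expi (U w))) -
    complex.Im (Cexpect P (fun w => expi (V w)))| <= e.
Proof.
move=> mU mV e0 ke.
have mUV : mfun (fun w => U w - V w) by exact: measurable_funB.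
have step (f : T -> R) : bounded_rv f ->
    (forall w, f w ^+ 2 <= 2 * (1 - cos (U w - V w))) -> `|\int[P]_w f w| <= e.
  move=> bf hf; apply: le_trans (le_normr_Rintegral _ (bounded_rv_integrable P bf)) _ => //.
  have -> : e = e / 2 + (2 * e)^-1 * (2 * (e ^+ 2 / 2)).
    by field; exact: lt0r_neq0.
  apply: (@le_trans _ _ (e / 2 + (2 * e)^-1 * (2 * kappa (fun w => U w - V w)))).
    rewrite -expectZ; last exact: brv.
    rewrite -expectZ; last exact/bounded_rvZ/brv.
    rewrite -[X in X + _](expect_cst P) -expectD; last 2 first.
    - exact: bounded_rv_cst.
    - exact/bounded_rvZ/bounded_rvZ/brv.
    apply: le_expect.
    - exact: bounded_rv_norm.
    - apply: bounded_rvD; first exact: bounded_rv_cst.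
      exact/bounded_rvZ/bounded_rvZ/brv.
    - by move=> w; apply: abs_le.
  by rewrite lerD2l ler_wpM2l ?invr_ge0 ?ler_wpM2l// mulr_ge0// ltW.
have ptwise w : (cos (U w) - cos (V w)) ^+ 2 + (sin (U w) - sin (V w)) ^+ 2 =
    2 * (1 - cos (U w - V w)).
  rewrite cosB; have := cos2Dsin2 (U w); have := cos2Dsin2 (V w).
  by rewrite !expr2; lra.
split=> /=.
  rewrite -expectB; [|exact: bounded_rv_cos..]; apply: step.
    by apply: bounded_rvB; exact: bounded_rv_cos.
  by move=> w; rewrite -ptwise lerDl sqr_ge0.
rewrite -expectB; [|exact: bounded_rv_sin..]; apply: step.
  by apply: bounded_rvB; exact: bounded_rv_sin.
by move=> w; rewrite -ptwise lerDr sqr_ge0.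
Qed.

Lemma measurable_inner (d : nat) (t : 'cV[R]_d) (Z : T -> 'cV[R]_d) :
  random_vector Z -> mfun (fun w => inner t (Z w)).
Proof.
move=> /random_vectorP mZ; apply: measurable_sum => i.
by apply: measurable_funM => //; exact: mZ.
Qed.

Lemma measurable_norm_ge (m n : nat) (Z : T -> 'M[R]_(m, n)) (e : R) :
  random_vector Z -> measurable [set w | e <= `|Z w|].
Proof.
move=> mZ.
have oB : open [set x : 'M[R]_(m, n) | `|x| < e].
  apply: (@open_comp _ _ (fun x : 'M[R]_(m, n) => `|x|) [set y | y < e]).
    by move=> ? _; exact: norm_continuous.
  exact: open_lt.
have mB : measurable (~` [set x : 'M[R]_(m, n) | `|x| < e] : set (borelType 'M[R]_(m, n))).
  by apply: measurableC; exact: sub_sigma_algebra.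
have := mZ measurableT _ mB; rewrite setTI; congr measurable.
by apply/seteqP; split=> w /=; rewrite leNgt => /negP.
Qed.

Lemma random_vectorB (m n : nat) (Z Z' : T -> 'M[R]_(m, n)) :
  random_vector Z -> random_vector Z' -> random_vector (fun w => Z w - Z' w).
Proof.
move=> /random_vectorP mZ /random_vectorP mZ'; apply/random_vectorP => i j.
under eq_fun do rewrite !mxE; exact: measurable_funB.
Qed.

Lemma inner_le (d : nat) (t x : 'cV[R]_d) :
  `|inner t x| <= (\sum_i `|t i 0|) * `|x|.
Proof.
rewrite big_distrl/=; apply: le_trans (ler_norm_sum _ _ _) _; apply: ler_sum => i _.
rewrite normrM ler_wpM2l//.
by apply: (mx_norm_leP x (normr_ge0 x)).1.
Qed.

Lemma innerBr (d : nat) (t x y : 'cV[R]_d) : inner t (x - y) = inner t x - inner t y.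
Proof. by rewrite -sumrB; apply: eq_bigr => i _; rewrite !mxE mulrBr. Qed.

(** [1 - cos] is small near 0, and it is at most 2 on the event that [Zn n] is far from [Z], whose
    probability tends to 0. *)
Lemma cvg_in_prob_kappa (d : nat) (Zn : nat -> T -> 'cV[R]_d) (Z : T -> 'cV[R]_d)
    (t : 'cV[R]_d) : (forall n, random_vector (Zn n)) -> cvg_in_prob P Zn Z ->
  kappa (fun w => inner t (Zn n w) - inner t (Z w)) @[n --> \oo] --> 0.
Proof.
move=> mZn [mZ hZ]; apply/cvgrPdist_le => /= e e0.
have [dl dl0 hdl] : exists2 dl : R, 0 < dl & forall x : R, `|x| < dl -> 1 - cos x <= e / 2.
  have c0 : cos x @[x --> (0 : R)] --> cos (0 : R) by exact: continuous_cos.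
  have e20 : 0 < e / 2 by rewrite divr_gt0.
  move/cvgrPdist_le : c0 => /(_ _ e20)/nbhs_ballP[dl /= dl0 h]; exists dl => // x xdl.
  have := h x; rewrite /ball/= sub0r normrN cos0 => /(_ xdl).
  by apply: le_trans; rewrite ler_norm.
pose S := \sum_i `|t i 0|; have S0 : 0 <= S by apply: sumr_ge0.
pose r := dl / (S + 1); have r0 : 0 < r by rewrite divr_gt0//; lra.
have e40 : 0 < e / 4 by lra.
have := hZ r r0 => /fine_cvgP[_ /cvgrPdist_le/(_ _ e40)].
apply: filterS => n /=; rewrite sub0r normrN.
set A := [set w | r <= `|Zn n w - Z w|] => hA.
have mA : measurable A by apply: measurable_norm_ge; exact: random_vectorB.
have mU : mfun (fun w => inner t (Zn n w) - inner t (Z w)).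
  by apply: measurable_funB; exact: measurable_inner.
rewrite sub0r normrN ger0_norm ?kappa_ge0//.
apply: (@le_trans _ _ (\int[P]_w (e / 2 + 2 * \1_A w))).
  apply: le_expect; first exact: brv.
    apply: bounded_rvD; first exact: bounded_rv_cst.
    exact/bounded_rvZ/bounded_rv_indic.
  move=> w; rewrite indicE; case: (boolP (w \in A)) => [_|/negP wA].
    by rewrite mulr1n; have := cos_geN1 (inner t (Zn n w) - inner t (Z w)); lra.
  rewrite mulr0n mulr0 addr0; apply: hdl; rewrite -innerBr.
  apply: le_lt_trans (inner_le _ _) _; rewrite -/S.
  have : `|Zn n w - Z w| < r.
    by rewrite ltNge; apply/negP => h; apply: wA; apply/mem_set.
  rewrite /r ltr_pdivlMr; last by lra.
  by have := normr_ge0 (Zn n w - Z w); nra.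
rewrite expectD; [|exact: bounded_rv_cst|exact/bounded_rvZ/bounded_rv_indic].
rewrite expect_cst expectZ; last exact: bounded_rv_indic.
have -> : \int[P]_w \1_A w = fine (P A) by rewrite -expect_indic.
by move: hA; rewrite ler_norml => /andP[_]; lra.
Qed.

End Kappa.

(** * Step functions *)

Section StepFunctions.
Context {R : realType} {k d : nat}.
Hypothesis k_gt0 : (0 < k)%N.
Local Notation point := 'cV[R]_k.
Local Notation borel := (borelType 'cV[R]_k).

(** Overlaps and repetitions are allowed, so that addition is concatenation and negation,
    restriction and translation are maps. Disjointness is a separate predicate. *)
Definition step := seq ('cV[R]_d * set point).
Implicit Types (L D : step) (A B E : set point) (x h : point) (c : 'cV[R]_d).

Fixpoint step_ok L : Prop :=
  if L is p :: L' then bounded_borel p.2 /\ step_ok L' else True.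

Fixpoint step_support L : set point :=
  if L is p :: L' then p.2 `|` step_support L' else set0.

Fixpoint step_disjoint L : Prop :=
  if L is p :: L' then p.2 `&` step_support L' = set0 /\ step_disjoint L'
  else True.

Definition step_eval L x : 'cV[R]_d := \sum_(p <- L) (\1_(p.2) x : R) *: p.1.

Definition step_neg L : step := [seq (- p.1, p.2) | p <- L].
Definition step_restrict A L : step := [seq (p.1, A `&` p.2) | p <- L].
Definition step_shift h L : step := [seq (p.1, [set x | p.2 (x - h)]) | p <- L].

Lemma bounded_set_sub A B : A `<=` B -> bounded_set B -> bounded_set A.
Proof.
move=> AB [M [Mr hM]]; exists M; split=> // N MN x Ax.
exact: (hM N MN x (AB _ Ax)).
Qed.

Lemma bounded_setP A : bounded_set A <-> exists C : R, forall x, A x -> `|x| <= C.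
Proof.
split=> [[M [_ hM]]|[C hC]].
  by exists (M + 1) => x Ax; apply: (hM (M + 1)) => //; rewrite ltrDl.
exists C; split; first exact: num_real.
by move=> N CN x Ax; exact: le_trans (hC x Ax) (ltW CN).
Qed.

Lemma bounded_borelI A B : measurable (A : set borel) -> bounded_borel B ->
  bounded_borel (A `&` B).
Proof.
move=> mA [mB bB]; split; first exact: measurableI.
by apply: bounded_set_sub bB; exact: subIsetr.
Qed.

Lemma bounded_borelD A B : measurable (B : set borel) -> bounded_borel A ->
  bounded_borel (A `\` B).
Proof.
move=> mB bA; rewrite setDE setIC; apply: bounded_borelI => //.
exact: measurableC.
Qed.

Lemma bounded_borel0 : bounded_borel (set0 : set point).
Proof. by split; [exact: measurable0|apply/bounded_setP; exists 0]. Qed.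

Lemma bounded_borelU A B : bounded_borel A -> bounded_borel B ->
  bounded_borel (A `|` B).
Proof.
move=> [mA /bounded_setP[a ha]] [mB /bounded_setP[b hb]]; split.
  exact: measurableU.
apply/bounded_setP; exists (Num.max a b) => x [Ax|Bx]; rewrite le_max.
  by rewrite ha.
by rewrite hb ?orbT.
Qed.

Lemma measurable_shift h A : measurable (A : set borel) ->
  measurable ([set x | A (x - h)] : set borel).
Proof.
have mf : measurable_fun [set: borel] ((fun x : point => x - h) : borel -> borel).
  apply/random_vectorP => i j.
  rewrite (_ : (fun w => _) = fun w : borel => (w : point) i j - h i j).
    by apply: measurable_funB => //; exact: measurable_coord.
  by apply/funext => x; rewrite !mxE.
by move=> mA; have := mf measurableT _ mA; rewrite setTI.
Qed.

Lemma bounded_borel_shift h A : bounded_borel A ->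
  bounded_borel [set x | A (x - h)].
Proof.
move=> [mA /bounded_setP[a ha]]; split; first exact: measurable_shift.
apply/bounded_setP; exists (a + `|h|) => x /ha xa.
by rewrite -(subrK h x) (le_trans (ler_normD _ _))// lerD2r.
Qed.

Lemma step_ok_cat L L' : step_ok L -> step_ok L' -> step_ok (L ++ L').
Proof. by move=> oL oL'; elim: L oL => [//|p L ih] /= [bp /ih]. Qed.

Lemma step_ok_neg L : step_ok L -> step_ok (step_neg L).
Proof. by elim: L => [//|p L ih] /= [bp /ih]. Qed.

Lemma step_ok_restrict A L : measurable (A : set borel) -> step_ok L ->
  step_ok (step_restrict A L).
Proof.
move=> mA; elim: L => [//|p L ih] /= [bp /ih]; split=> //.
exact: bounded_borelI.
Qed.

Lemma step_ok_shift h L : step_ok L -> step_ok (step_shift h L).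
Proof.
elim: L => [//|p L ih] /= [bp /ih]; split=> //.
exact: bounded_borel_shift.
Qed.

Lemma step_support_bounded L : step_ok L -> bounded_borel (step_support L).
Proof.
elim: L => [_|p L ih /= [bp oL]]; first exact: bounded_borel0.
by apply: bounded_borelU => //; exact: ih.
Qed.

Lemma step_support_cat L L' :
  step_support (L ++ L') = step_support L `|` step_support L'.
Proof. by elim: L => [|p L ih] /=; rewrite ?set0U// ih setUA. Qed.

Lemma step_support_shift h L x :
  step_support (step_shift h L) x <-> step_support L (x - h).
Proof.
elim: L => [//|p L ih] /=; split=> -[hp|hL]; [by left|by right; apply/ih|by left|].
by right; apply/ih.
Qed.

Lemma step_eval_cons p L x :
  step_eval (p :: L) x = (\1_(p.2) x : R) *: p.1 + step_eval L x.
Proof. by rewrite /step_eval big_cons. Qed.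

Lemma step_eval_cat L L' x : step_eval (L ++ L') x = step_eval L x + step_eval L' x.
Proof. by rewrite /step_eval big_cat. Qed.

Lemma step_eval_neg L x : step_eval (step_neg L) x = - step_eval L x.
Proof.
rewrite /step_eval /step_neg big_map -sumrN; apply: eq_bigr => p _.
by rewrite scalerN.
Qed.

Lemma step_eval_restrict A L x :
  step_eval (step_restrict A L) x = (\1_A x : R) *: step_eval L x.
Proof.
rewrite /step_eval /step_restrict big_map scaler_sumr; apply: eq_bigr => p _ /=.
by rewrite scalerA indicI.
Qed.

Lemma step_eval_shift h L x : step_eval (step_shift h L) x = step_eval L (x - h).
Proof.
rewrite /step_eval /step_shift big_map; apply: eq_bigr => p _ /=.
by congr (_ *: _); rewrite !indicE; congr (_%:R); congr nat_of_bool.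
Qed.

Lemma step_eval_notin L x : ~ step_support L x -> step_eval L x = 0.
Proof.
elim: L => [_|p L ih /= hx]; first by rewrite /step_eval big_nil.
rewrite step_eval_cons ih ?addr0; last by move=> h; apply: hx; right.
by rewrite indicE memNset ?scale0r// => h; apply: hx; left.
Qed.

Lemma step_disjoint_cat D D' : step_disjoint D -> step_disjoint D' ->
  step_support D `&` step_support D' = set0 -> step_disjoint (D ++ D').
Proof.
move=> dD dD'; elim: D dD => [//|p D ih] /= [pD dD] h; split.
  rewrite step_support_cat setIUr pD set0U.
  by apply/seteqP; split=> // x [px Dx]; rewrite -h; split=> //; left.
by apply: ih => //; apply/seteqP; split=> // x [Dx Dx']; rewrite -h; split=> //; right.
Qed.

Lemma step_disjoint_shift h D : step_disjoint D -> step_disjoint (step_shift h D).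
Proof.
elim: D => [//|p D ih] /= [pD /ih dD]; split=> //.
apply/seteqP; split=> // x [px /step_support_shift Dx].
by have : (p.2 `&` step_support D) (x - h) by []; rewrite pD.
Qed.

(* Adds c 1_A to a step function, keeping the sets disjoint if they were. *)
Fixpoint step_insert c A L : step :=
  if L is p :: L' then
    (p.1 + c, p.2 `&` A) :: (p.1, p.2 `\` A) :: step_insert c (A `\` p.2) L'
  else [:: (c, A)].

Lemma step_insert_ok c A L : bounded_borel A -> step_ok L ->
  step_ok (step_insert c A L).
Proof.
elim: L A => [//|p L ih] A bA /= [bp oL]; split; [|split].
- by apply: bounded_borelI => //; case: bp.
- by apply: bounded_borelD => //; case: bA.
- by apply: ih => //; apply: bounded_borelD => //; case: bp.
Qed.

Lemma step_insert_support c A L :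
  step_support (step_insert c A L) `<=` A `|` step_support L.
Proof.
elim: L A => [|p L ih] A /=; first by rewrite !setU0.
by move=> x [[px Ax]|[[px Ax]|/ih[[Ax px]|Lx]]]; [left|right; left|left|right; right].
Qed.

Lemma step_insert_disjoint c A L : step_disjoint L ->
  step_disjoint (step_insert c A L).
Proof.
elim: L A => [|p L ih] A /=; first by rewrite setI0.
move=> [pL dL]; split; [|split; [|exact: ih]]; apply/seteqP; split=> // x.
  move=> [[px Ax] [[//]|/step_insert_support[[]//|Lx]]].
  by rewrite -pL.
move=> [[px Ax] /step_insert_support[[]//|Lx]].
by rewrite -pL.
Qed.

Lemma step_insert_eval c A L x :
  step_eval (step_insert c A L) x = (\1_A x : R) *: c + step_eval L x.
Proof.
elim: L A => [|p L ih] A /=; first by rewrite step_eval_cons.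
rewrite !step_eval_cons ih /= !indicE !in_setD !in_setI.
case: (x \in p.2); case: (x \in A); rewrite /= ?(mulr1n, mulr0n, scale1r, scale0r, add0r, addr0)//.
by rewrite addrA (addrC c).
Qed.

(** The sum is the integral of [r] composed with the step function, which vanishes off [E] because
    [r 0 = 0]. In the induction [E] loses the piece [p.2]; pieces with coefficient 0 may leave [E]
    but contribute nothing. *)
Lemma step_sum_bound (r : 'cV[R]_d -> R) (C S : R) D E :
  0 <= S -> r 0 = 0 -> (forall c, `|c| <= C -> `|r c| <= S) ->
  step_ok D -> step_disjoint D -> bounded_borel E ->
  (forall x, `|step_eval D x| <= C) -> (forall x, step_eval D x != 0 -> E x) ->
  `|\sum_(p <- D) r p.1 * fine (leb p.2)| <= S * fine (leb E).
Proof.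
move=> S0 r0 hr; elim: D E => [|p D ih] E /=.
  by move=> _ _ _ _ _; rewrite big_nil normr0 mulr_ge0// fine_ge0// leb_ge0.
move=> [bp oD] [pD dD] bE evC evE.
have pDx x : p.2 x -> step_eval D x = 0.
  move=> px; apply: step_eval_notin => Dx.
  by have : (p.2 `&` step_support D) x by []; rewrite pD.
have evpD x : ~ p.2 x -> step_eval (p :: D) x = step_eval D x.
  by move=> px; rewrite step_eval_cons indicE memNset// scale0r add0r.
have evp x : p.2 x -> step_eval (p :: D) x = p.1.
  by move=> px; rewrite step_eval_cons pDx// addr0 indicE mem_set// scale1r.
have evCD x : `|step_eval D x| <= C.
  have [px|px] := pselect (p.2 x); last by rewrite -evpD.
  by rewrite pDx// normr0; apply: le_trans (evC x).
rewrite big_cons; have [p0|pN0] := eqVneq p.1 0.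
  rewrite p0 r0 mul0r add0r; apply: ih => // x Dx; apply: evE.
  rewrite evpD// => px; move: Dx; rewrite pDx// eqxx.
  done.
have pE : p.2 `<=` E by move=> x px; apply: evE; rewrite evp.
have bEp : bounded_borel (E `\` p.2) by apply: bounded_borelD => //; case: bp.
have {}ih := ih (E `\` p.2) oD dD bEp evCD.
have lebE : fine (leb E) = fine (leb p.2) + fine (leb (E `\` p.2)).
  rewrite -fineD; last 2 first.
  - by rewrite ge0_fin_numE ?leb_ge0// leb_lty//; case: bp.
  - by rewrite ge0_fin_numE ?leb_ge0// leb_lty//; case: bEp.
  congr fine; rewrite -[leb _]/(leb_measure k_gt0 _) -[leb p.2]/(leb_measure k_gt0 _).
  rewrite -[leb (E `\` _)]/(leb_measure k_gt0 _) -measureU; last 3 first.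
  - by case: bp.
  - by case: bEp.
  - by rewrite setDE setICA setICr setI0.
  by rewrite setDUK.
rewrite lebE mulrDr (le_trans (ler_normD _ _))// lerD//; last first.
  apply: ih => x Dx; have px : ~ p.2 x by move=> px; move: Dx; rewrite pDx// eqxx.
  by split=> //; apply: evE; rewrite evpD.
have l0 : 0 <= fine (leb p.2) by rewrite fine_ge0// leb_ge0.
rewrite normrM (ger0_norm l0).
(* The bound [C] concerns values of the step function, so it reaches the coefficient [p.1] only
   through a point of [p.2]; an empty piece has measure 0. *)
have [->|/set0P[x px]] := eqVneq p.2 set0.
  by rewrite leb_set0//= !mulr0.
by rewrite ler_wpM2r// hr// -(evp x px).
Qed.

End StepFunctions.

(** * Continuity of complex-valued functions through real and imaginary parts *)

Section ContinuousComplex.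

Lemma cvg_norm_near (K : numFieldType) (V : Type) (F : set_system V) (f : V -> K) (l : K)
    (e : K) : Filter F -> f x @[x --> F] --> l -> 0 < e ->
  F [set x | `|l - f x| < e].
Proof. by move=> FF /cvgrPdist_lt fl e0; exact: fl. Qed.

Lemma normc_lt_Re_Im (R : rcfType) (z : R[i]) (e : R) :
  `|z| < e%:C%C -> `|complex.Re z| < e /\ `|complex.Im z| < e.
Proof.
case: z => a b; rewrite ltcR => h.
by split; apply: le_lt_trans h; rewrite -sqrtr_sqr ler_wsqrtr// ?lerDl ?lerDr sqr_ge0.
Qed.

Lemma continuous_matrix_complex (R : realType) (d : nat) (psi : 'cV[R]_d -> R[i])
    (c : 'cV[R]_d) (e : R) :
  continuous (psi : 'cV[R]_d -> (R[i] : numFieldType)) -> 0 < e ->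
  exists2 dl : R, 0 < dl & forall c', `|c - c'| < dl ->
  `|complex.Re (psi c) - complex.Re (psi c')| < e /\
  `|complex.Im (psi c) - complex.Im (psi c')| < e.
Proof.
move=> cpsi e0; have ec0 : 0 < e%:C%C :> R[i] by rewrite ltcR.
have H := @cvg_norm_near (R[i] : numFieldType) _ (nbhs c) psi (psi c) e%:C%C
  (nbhs_filter c) (cpsi c) ec0.
have [dl /= dl0 h] := (@nbhs_ballP R 'cV[R]_d c _).1 H.
exists dl => // c' cc'; have {}h : `|psi c - psi c'| < e%:C%C.
  by apply: h; rewrite -ball_normE.
have [] := normc_lt_Re_Im h.
by case: (psi c) (psi c') => [a b] [a' b'].
Qed.

End ContinuousComplex.

(** * Integrals of step functions against a Levy basis *)

Section LevyBasis.
Context {R : realType} {k d : nat} {d0 : measure_display} {T : measurableType d0}.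
Hypothesis k_gt0 : (0 < k)%N.
Variables (P : probability T R) (M : set 'cV[R]_k -> T -> 'cV[R]_d).
Hypothesis basisM : homogeneous_levy_basis P M.
Local Notation point := 'cV[R]_k.
Local Notation borel := (borelType 'cV[R]_k).
Local Notation step := (@step R k d).
Local Notation mfun := (measurable_fun [set: T]).
Local Notation Re := complex.Re.
Local Notation Im := complex.Im.
Implicit Types (L D : step) (A B E : set point) (x h : point) (c : 'cV[R]_d).

Definition step_integral L (w : T) : R := \sum_(p <- L) inner p.1 (M p.2 w).
Local Notation J := step_integral.
Local Notation phi U := (Cexpect P (fun w => expi (U w))).

Lemma step_integral_cat L L' w : J (L ++ L') w = J L w + J L' w.
Proof. by rewrite /J big_cat. Qed.

Lemma step_integral_cons p L w : J (p :: L) w = inner p.1 (M p.2 w) + J L w.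
Proof. by rewrite /J big_cons. Qed.

Lemma innerNl c c' : inner (- c) c' = - inner c c'.
Proof. by rewrite -sumrN; apply: eq_bigr => i _; rewrite !mxE mulNr. Qed.

Lemma innerDl c c' c'' : inner (c + c') c'' = inner c c'' + inner c' c''.
Proof. by rewrite -big_split; apply: eq_bigr => i _; rewrite !mxE mulrDl. Qed.

Lemma innerDr c c' c'' : inner c (c' + c'') = inner c c' + inner c c''.
Proof. by rewrite -big_split; apply: eq_bigr => i _; rewrite !mxE mulrDr. Qed.

Lemma inner0l c : inner 0 c = 0.
Proof. by rewrite /inner big1// => i _; rewrite mxE mul0r. Qed.

Lemma inner0r c : inner c 0 = 0.
Proof. by rewrite /inner big1// => i _; rewrite mxE mulr0. Qed.

Lemma step_integral_neg L w : J (step_neg L) w = - J L w.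
Proof.
rewrite /J /step_neg big_map -sumrN; apply: eq_bigr => p _.
by rewrite innerNl.
Qed.

Lemma measurable_step_integral L : step_ok L -> mfun (J L).
Proof.
elim: L => [_|p L ih /= [bp /ih mL]].
  by rewrite (_ : J [::] = fun=> 0)//; apply/funext => w; rewrite /J big_nil.
rewrite (_ : J _ = fun w => inner p.1 (M p.2 w) + J L w); last first.
  by apply/funext => w; rewrite step_integral_cons.
apply: measurable_funD => //; apply: measurable_inner; exact: (basis_measurable basisM).
Qed.

(** The empty set is a disjoint union of countably many copies of itself, and the terms of a
    convergent series tend to 0. *)
Lemma basis_set0 : {ae P, forall w, M set0 w = 0}.
Proof.
have := basis_sigma_additive basisM (A := fun=> set0) (fun=> bounded_borel0) _ _.
rewrite bigcup_const; last by exists 0%N.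
move=> /(_ _ (proj2 bounded_borel0)) H.
have /H : trivIset [set: nat] (fun=> set0 : set point) by move=> i j _ _ [x []].
apply: filterS => w cw.
have := @cvg_series_cvg_0 _ _ (fun=> M set0 w).
move=> /(_ _)H0; have /H0 c0 : cvgn (series (fun=> M set0 w)).
  by apply/cvg_ex; eexists; exact: cw.
by apply: cvg_unique c0 => //; exact: cvg_cst.
Qed.

Lemma basisU A B : bounded_borel A -> bounded_borel B -> A `&` B = set0 ->
  {ae P, forall w, M (A `|` B) w = M A w + M B w}.
Proof.
move=> bA bB AB.
have bb i : bounded_borel (bigcup2 A B i).
  by case: i => [//|[//|i]]; exact: bounded_borel0.
have := basis_sigma_additive basisM (A := bigcup2 A B) bb _ _.
rewrite bigcup2E => H; have {}H := H _ (proj2 (bounded_borelU bA bB)).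
have /H {}H : trivIset [set: nat] (bigcup2 A B).
  by apply/trivIsetP => -[|[|i]] [|[|j]] //= _ _ _; rewrite ?setI0 ?set0I// setIC.
apply: filterS2 H basis_set0 => w cw M0.
apply: (cvg_unique _ cw) => //.
apply: cvg_near_cst; exists 2%N => // -[//|[//|n]] _ /=.
by rewrite /series/= big_nat_recl// big_nat_recl//= big1 ?addr0.
Qed.

Lemma basisIC A B : bounded_borel A -> bounded_borel B ->
  {ae P, forall w, M A w = M (A `&` B) w + M (A `\` B) w}.
Proof.
move=> bA bB; have := @basisU (A `&` B) (A `\` B).
rewrite setUIDK => /(_ _ _ _); apply.
- by apply: bounded_borelI => //; case: bA.
- by apply: bounded_borelD => //; case: bB.
- by rewrite setDE setIACA setICr setI0.
Qed.

Lemma step_insert_integral c A L : bounded_borel A -> step_ok L ->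
  {ae P, forall w, J (step_insert c A L) w = inner c (M A w) + J L w}.
Proof.
elim: L A => [|p L ih] A bA /=.
  by move=> _; apply: aeW => w; rewrite step_integral_cons.
move=> [bp oL].
have bAp : bounded_borel (A `\` p.2) by apply: bounded_borelD => //; case: bp.
have H1 := basisIC bA bp; have H2 := basisIC bp bA; have H3 := ih _ bAp oL.
apply: filterS3 H1 H2 H3 => w h1 h2 h3.
rewrite !step_integral_cons h3 /= h1 [in RHS]h2 !innerDr !innerDl setIC.
by ring.
Qed.

(** A normal form that changes neither the function nor, almost surely, its integral: the
    characteristic function is computed on [D] and transferred to [L]. *)
Lemma step_disjointify L : step_ok L -> exists D, [/\ step_ok D, step_disjoint D,
  step_support D `<=` step_support L, forall x, step_eval D x = step_eval L x
  & {ae P, forall w, J D w = J L w}].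
Proof.
elim: L => [_|p L ih /= [bp /ih[D [oD dD sD eD jD]]]].
  by exists [::]; split=> //; exact: aeW.
exists (step_insert p.1 p.2 D); split.
- exact: step_insert_ok.
- exact: step_insert_disjoint.
- by move=> x /step_insert_support[|/sD]; [left|right].
- by move=> x; rewrite step_insert_eval eD step_eval_cons.
- apply: filterS2 jD (step_insert_integral p.1 bp oD) => w h1 h2.
  by rewrite h2 h1 step_integral_cons.
Qed.

(** In disjoint form each piece is either empty, where [M] vanishes almost surely, or has
    coefficient 0. Consequently the integral depends only on the function, not on the list
    representing it. *)
Lemma step_integral_eval0 L : step_ok L -> (forall x, step_eval L x = 0) ->
  {ae P, forall w, J L w = 0}.
Proof.
move=> /step_disjointify[D [oD dD _ eD jD]] eL.
have {}eD x : step_eval D x = 0 by rewrite eD.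
suff : {ae P, forall w, J D w = 0} by apply: filterS2 jD => w <-.
elim: D oD dD eD {jD} => [_ _ _|p D ih /= [bp oD] [pD dD] eD].
  by apply: aeW => w; rewrite /J big_nil.
have pDx x : p.2 x -> step_eval D x = 0.
  move=> px; apply: step_eval_notin => Dx.
  by have : (p.2 `&` step_support D) x by []; rewrite pD.
have D0 x : step_eval D x = 0.
  have [/pDx//|px] := pselect (p.2 x).
  by have := eD x; rewrite step_eval_cons indicE memNset// scale0r add0r.
apply: filterS2 (ih oD dD D0) basis_set0 => w h1 h2.
rewrite step_integral_cons h1 addr0.
have [->|/set0P[x px]] := eqVneq p.2 set0; first by rewrite h2 inner0r.
have := eD x; rewrite step_eval_cons pDx// addr0 indicE mem_set// scale1r => ->.
by rewrite inner0l.
Qed.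

Lemma step_integral_eq L L' : step_ok L -> step_ok L' ->
  (forall x, step_eval L x = step_eval L' x) -> {ae P, forall w, J L w = J L' w}.
Proof.
move=> oL oL' e; have := @step_integral_eval0 (L ++ step_neg L').
move=> /(_ _ _)H; have {H} : {ae P, forall w, J (L ++ step_neg L') w = 0}.
  apply: H; first by apply: step_ok_cat => //; exact: step_ok_neg.
  by move=> x; rewrite step_eval_cat step_eval_neg e subrr.
apply: filterS => w; rewrite step_integral_cat step_integral_neg => /eqP.
by rewrite subr_eq0 => /eqP.
Qed.

Lemma phi_ae (U V : T -> R) : mfun U -> mfun V -> {ae P, forall w, U w = V w} ->
  phi U = phi V.
Proof.
move=> mU mV UV; apply: Cexpect_ae; [exact: bounded_crv_expi..|].
by apply: filterS UV => w ->.
Qed.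

Lemma phi_step_eq L L' : step_ok L -> step_ok L' ->
  (forall x, step_eval L x = step_eval L' x) -> phi (J L) = phi (J L').
Proof.
move=> oL oL' e; apply: phi_ae; [exact: measurable_step_integral..|].
exact: step_integral_eq.
Qed.

Variable psi : 'cV[R]_d -> R[i].
Hypothesis psi_continuous : continuous (psi : 'cV[R]_d -> (R[i] : numFieldType)).
Hypothesis psi0 : psi 0 = 0.
Hypothesis psiM : forall A theta, bounded_borel A ->
  charfun P (M A) theta = cexp (psi theta * (fine (leb A))%:C%C).

Lemma step_support_nth D i : (i < size D)%N ->
  (nth (0, set0) D i).2 `<=` step_support D.
Proof.
elim: D i => [//|p D ih] [_|i] /=; first by left.
by rewrite ltnS => /ih h x /h; right.
Qed.

Lemma step_disjoint_nth D i j : step_disjoint D -> (i < j < size D)%N ->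
  (nth (0, set0) D i).2 `&` (nth (0, set0) D j).2 = set0.
Proof.
elim: D i j => [//|p D ih] i j /=; first by rewrite andbC.
move=> [pD dD]; case: i j => [|i] [|j]//=; rewrite ltnS; last exact: ih.
move=> jD; apply/seteqP; split=> // x [px /(step_support_nth jD) Dx].
by rewrite -pD.
Qed.

Lemma step_ok_nth D i : step_ok D -> (i < size D)%N ->
  bounded_borel (nth (0, set0) D i).2.
Proof. by elim: D i => [//|p D ih] [|i] /= [bp oD]//; exact: ih. Qed.

Lemma phi_disjoint D : step_ok D -> step_disjoint D ->
  phi (J D) = cexp (\sum_(p <- D) psi p.1 * (fine (leb p.2))%:C%C).
Proof.
move=> oD dD.
pose A (i : 'I_(size D)) := (nth (0, set0) D i).2.
pose c (i : 'I_(size D)) := (nth (0, set0) D i).1.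
have bA i : bounded_borel (A i) by exact: step_ok_nth.
have tA : trivIset [set: 'I_(size D)] A.
  apply/trivIsetP => i j _ _ ij.
  have [lij|lji|/val_inj ij'] := ltngtP i j; last by rewrite ij' eqxx in ij.
    by apply: step_disjoint_nth => //; rewrite lij/=.
  by rewrite setIC; apply: step_disjoint_nth => //; rewrite lji/=.
have := @independent_expi _ _ _ P _ _ (fun i => M (A i)) (fun i => inner (c i))
  (fun i => basis_measurable basisM (bA i)) (basis_indep basisM bA tA) _.
have mi i : measurable_fun [set: borelType 'cV[R]_d]
    (inner (c i) : borelType 'cV[R]_d -> R).
  by apply: (@measurable_inner _ _ (borelType 'cV[R]_d)); exact: measurable_id.
move=> /(_ mi).
rewrite (eq_bigr (fun i => cexp (psi (c i) * (fine (leb (A i)))%:C%C))); last first.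
  by move=> i _; rewrite -psiM.
rewrite (big_nth (0, set0)) big_mkord (big_morph _ cexpD cexp0) => <-.
congr Cexpect; apply/funext => w; congr expi.
by rewrite /J (big_nth (0, set0)) big_mkord.
Qed.

Lemma phi_step_shift h L : step_ok L -> phi (J (step_shift h L)) = phi (J L).
Proof.
move=> oL; have [D [oD dD _ eD jD]] := step_disjointify oL.
rewrite -(phi_step_eq oD oL eD).
rewrite -(@phi_step_eq (step_shift h D) (step_shift h L)); last 3 first.
- exact: step_ok_shift.
- exact: step_ok_shift.
- by move=> x; rewrite !step_eval_shift.
rewrite !phi_disjoint//; [|exact: step_ok_shift|exact: step_disjoint_shift].
congr cexp; rewrite big_map; apply: eq_bigr => p _ /=.
by rewrite (leb_shift _ (- h)).
Qed.

Lemma phi_step_cat L L' : step_ok L -> step_ok L' ->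
  step_support L `&` step_support L' = set0 ->
  phi (J (L ++ L')) = phi (J L) * phi (J L').
Proof.
move=> oL oL' LL'.
have [D [oD dD sD eD jD]] := step_disjointify oL.
have [D' [oD' dD' sD' eD' jD']] := step_disjointify oL'.
rewrite -(phi_step_eq oD oL eD) -(phi_step_eq oD' oL' eD').
rewrite -(@phi_step_eq (D ++ D') (L ++ L')); last 3 first.
- exact: step_ok_cat.
- exact: step_ok_cat.
- by move=> x; rewrite !step_eval_cat eD eD'.
rewrite !phi_disjoint ?big_cat ?cexpD//; first exact: step_ok_cat.
apply: step_disjoint_cat => //; apply/seteqP; split=> // x [/sD h1 /sD' h2].
by rewrite -LL'.
Qed.

Lemma psi_bound (C : R) : exists2 S : R, 0 <= S & forall c, `|c| <= C ->
  `|Re (psi c)| <= S /\ `|Im (psi c)| <= S.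
Proof.
(* Compactness of closed balls is applied to row vectors, [psi] being composed with
   transposition. *)
pose K := [set v : 'rV[R]_d | `|v| <= C].
have cK : compact K.
  apply: bounded_closed_compact.
    exists C; split; first exact: num_real.
    by move=> N CN x Kx; apply: le_trans (ltW CN).
  apply: (@closed_comp _ _ (fun v : 'rV[R]_d => `|v|) [set y | y <= C]).
    by move=> ? _; exact: norm_continuous.
  exact: closed_le.
have trN (v : 'rV[R]_d) : `|v^T| <= C -> K v.
  move=> vC; have C0 : 0 <= C by apply: le_trans vC.
  by apply/(mx_norm_leP v C0) => i j; move/(mx_norm_leP _ C0) : vC => /(_ j i); rewrite mxE.
have bnd (F : R[i] -> R) : (forall c (e : R), 0 < e ->
      exists2 dl : R, 0 < dl & forall c', `|c - c'| < dl ->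
        `|F (psi c) - F (psi c')| < e) ->
    exists S : R, forall c, `|c| <= C -> `|F (psi c)| <= S.
  move=> hF; pose f (v : 'rV[R]_d) := F (psi v^T).
  have cf : continuous f.
    move=> v; apply: (@cvgrPdist_lt _ _ _ (nbhs v) (nbhs_filter v) f (f v)).2 => e e0.
    have [dl dl0 h] := hF v^T e e0.
    apply/nbhs_ballP; exists dl => // v'; rewrite -ball_normE /= => hv.
    apply: h; apply/mx_norm_ltP => // i j.
    by move/(mx_norm_ltP _ dl0) : hv => /(_ j i); rewrite !mxE.
  have /compact_bounded[S [_ hS]] : compact (f @` K).
    by apply: continuous_compact => //; exact: continuous_subspaceT.
  exists (S + 1) => c cC; apply: (hS (S + 1)); first by rewrite ltrDl.
  by exists c^T; [apply: trN; rewrite trmxK|rewrite /f trmxK].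
have [S1 h1] : exists S : R, forall c, `|c| <= C -> `|Re (psi c)| <= S.
  apply: (bnd (fun z => Re z)) => c e e0.
  have [dl dl0 h] := continuous_matrix_complex c psi_continuous e0.
  by exists dl => // c' /h[].
have [S2 h2] : exists S : R, forall c, `|c| <= C -> `|Im (psi c)| <= S.
  apply: (bnd (fun z => Im z)) => c e e0.
  have [dl dl0 h] := continuous_matrix_complex c psi_continuous e0.
  by exists dl => // c' /h[].
exists (Num.max 0 (Num.max S1 S2)); first by rewrite le_max lexx.
by move=> c cC; rewrite !le_max h1// h2// !orbT.
Qed.

Lemma psi_small (e : R) : 0 < e -> exists2 dl : R, 0 < dl & forall c, `|c| <= dl ->
  `|Re (psi c)| <= e /\ `|Im (psi c)| <= e.
Proof.
move=> e0; have [dl dl0 h] := continuous_matrix_complex 0 psi_continuous e0.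
exists (dl / 2); first by rewrite divr_gt0.
move=> c cdl; have cd : `|0 - c| < dl.
  by rewrite sub0r normrN (le_lt_trans cdl)// ltr_pdivrMr// ltr_pMr ?ltr1n.
by have := h c cd; rewrite psi0 !sub0r !normrN => -[/ltW h1 /ltW h2].
Qed.

(** The exponent of the characteristic function is the integral of [psi] along the step function,
    with real and imaginary parts at most [S Leb(E)]. As [eta] depends on [e] alone, the bound
    serves both for large values on a small set and for small values on a large set. *)
Lemma kappa_small (e : R) : 0 < e -> exists2 eta : R, 0 < eta &
  forall L (C S : R) E, step_ok L -> bounded_borel E -> 0 <= S ->
    (forall x, `|step_eval L x| <= C) -> (forall x, step_eval L x != 0 -> E x) ->
    (forall c, `|c| <= C -> `|Re (psi c)| <= S /\ `|Im (psi c)| <= S) ->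
    S * fine (leb E) <= eta -> kappa P (J L) <= e.
Proof.
move=> e0.
have [eta eta0 heta] : exists2 eta : R, 0 < eta &
    forall a b, `|a| <= eta -> `|b| <= eta -> 1 - expR a * cos b <= e.
  have e20 : 0 < e / 2 by rewrite divr_gt0.
  have /cvgrPdist_le/(_ _ e20)/nbhs_ballP[d1 /= d10 h1] : expR x @[x --> (0 : R)] --> expR (0 : R).
    exact: continuous_expR.
  have /cvgrPdist_le/(_ _ e20)/nbhs_ballP[d2 /= d20 h2] : cos x @[x --> (0 : R)] --> cos (0 : R).
    exact: continuous_cos.
  exists (Num.min d1 d2 / 2); first by rewrite divr_gt0// lt_min d10.
  move=> a b ha hb; have m12 : Num.min d1 d2 / 2 < Num.min d1 d2.
    by rewrite ltr_pdivrMr// ltr_pMr ?ltr1n// lt_min d10.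
  have := h1 a; rewrite /ball/= sub0r normrN expR0 (lt_le_trans (le_lt_trans ha m12)) ?ge_min ?lexx//.
  have := h2 b; rewrite /ball/= sub0r normrN cos0 (lt_le_trans (le_lt_trans hb m12)) ?ge_min ?lexx ?orbT//.
  move=> /(_ isT); rewrite ler_norml => /andP[_ hb2] /(_ isT); rewrite ler_norml => /andP[ha1 ha2].
  have := cos_le1 b; have := cos_geN1 b; have := expR_gt0 a; nra.
exists eta => // L C S E oL bE S0 evC evE hS hE.
have [D [oD dD _ eD jD]] := step_disjointify oL.
rewrite kappaE; last exact: measurable_step_integral.
rewrite -(phi_step_eq oD oL eD) phi_disjoint//.
have ReS : Re (\sum_(p <- D) psi p.1 * (fine (leb p.2))%:C%C) =
    \sum_(p <- D) Re (psi p.1) * fine (leb p.2).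
  rewrite (big_morph _ (@ReD R) (erefl : Re 0 = 0)); apply: eq_bigr => p _.
  by rewrite ReM /= mulr0 subr0.
have ImS : Im (\sum_(p <- D) psi p.1 * (fine (leb p.2))%:C%C) =
    \sum_(p <- D) Im (psi p.1) * fine (leb p.2).
  rewrite (big_morph _ (@ImD R) (erefl : Im 0 = 0)); apply: eq_bigr => p _.
  by rewrite ImM /= mulr0 add0r.
have evCD x : `|step_eval D x| <= C by rewrite eD.
have evED x : step_eval D x != 0 -> E x by rewrite eD; exact: evE.
rewrite /cexp ReM /= ReS ImS mul0r subr0; apply: heta; apply: le_trans hE.
  apply: (@step_sum_bound _ _ _ k_gt0 (fun c => Re (psi c)) C) => //.
    by rewrite psi0.
  by move=> c /hS[].
apply: (@step_sum_bound _ _ _ k_gt0 (fun c => Im (psi c)) C) => //.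
  by rewrite psi0.
by move=> c /hS[].
Qed.

Lemma leb_nonincreasing_cvg0 (F : nat -> set point) (e : R) :
  (forall n, bounded_borel (F n)) -> (forall n, F n.+1 `<=` F n) ->
  leb (\bigcap_n F n) = 0%E -> 0 < e ->
  exists N, forall n, (N <= n)%N -> fine (leb (F n)) <= e.
Proof.
move=> bF dF lF e0.
have cF : leb_measure k_gt0 (F n) @[n --> \oo] --> leb_measure k_gt0 (\bigcap_n F n).
  apply: nonincreasing_cvg_mu.
  - by rewrite /= -/(leb _) leb_lty//; case: (bF 0%N).
  - by move=> n; case: (bF n).
  - by apply: bigcapT_measurable => n; case: (bF n).
  - by apply/nonincreasing_seqP => n; apply/subsetPset; exact: dF.
have : leb (F n) @[n --> \oo] --> (0 : R)%:E.
  by rewrite (_ : (0 : R)%:E = leb (\bigcap_n F n)); [exact: cF|rewrite lF].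
move=> /fine_cvgP[_ /cvgrPdist_le/(_ _ e0)[N _ hN]].
exists N => n Nn; have := hN n Nn.
by rewrite /= sub0r normrN ger0_norm// fine_ge0// leb_ge0.
Qed.

Lemma step_eval_norm L x : `|step_eval L x| <= \sum_(p <- L) `|p.1|.
Proof.
apply: le_trans (ler_norm_sum _ _ _) _; apply: ler_sum => p _.
by rewrite normrZ indicE; case: (_ \in _); rewrite ?normr1 ?mul1r// normr0 mul0r.
Qed.

Lemma measurable_step_eval_norm L (e : R) : step_ok L ->
  measurable ([set x | e <= `|step_eval L x|] : set borel).
Proof.
move=> oL; apply: (@measurable_norm_ge _ _ borel).
apply/random_vectorP => i j; elim: L oL => [_|p L ih /= [[mp _] /ih mL]].
  rewrite (_ : (fun w => _) = fun=> 0); first exact: measurable_cst.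
  by apply/funext => x; rewrite /step_eval big_nil mxE.
rewrite (_ : (fun w => _) = fun x : borel => \1_(p.2 : set borel) x * p.1 i j + step_eval L x i j).
  by apply: measurable_funD => //; apply: measurable_funM.
by apply/funext => x; rewrite step_eval_cons !mxE.
Qed.

(** The integral over a disjoint union is almost surely the sum of the integrals. The second bound
    recovers a piece from the whole, which is how a hump on a part of a set is shown to persist on
    the set. *)
Lemma kappa_restrictU L A B : step_ok L -> measurable (A : set borel) ->
  measurable (B : set borel) -> A `&` B = set0 ->
  kappa P (J (step_restrict (A `|` B) L)) <=
    2 * kappa P (J (step_restrict A L)) + 2 * kappa P (J (step_restrict B L)) /\
  kappa P (J (step_restrict B L)) <=
    2 * kappa P (J (step_restrict (A `|` B) L)) + 2 * kappa P (J (step_restrict A L)).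
Proof.
move=> oL mA mB AB.
have oA := step_ok_restrict mA oL; have oB := step_ok_restrict mB oL.
have oAB := step_ok_restrict (measurableU _ _ mA mB) oL.
have mJA := measurable_step_integral oA; have mJB := measurable_step_integral oB.
have mJAB := measurable_step_integral oAB.
have H : {ae P, forall w, J (step_restrict (A `|` B) L) w =
    J (step_restrict A L) w + J (step_restrict B L) w}.
  have := step_integral_eq oAB (step_ok_cat oA oB) _.
  move=> /(_ _)H; have {H} : {ae P, forall w, J (step_restrict (A `|` B) L) w =
      J (step_restrict A L ++ step_restrict B L) w}.
    apply: H => x; rewrite step_eval_cat !step_eval_restrict -scalerDl.
    congr (_ *: _); rewrite !indicE in_setU.
    have [xA|xA] := boolP (x \in A); have [xB|xB] := boolP (x \in B) => //=.
    - have : (A `&` B) x by split; exact/set_mem.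
      by rewrite AB.
    - by rewrite addr0.
    - by rewrite add0r.
    - by rewrite addr0.
  by apply: filterS => w ->; rewrite step_integral_cat.
split.
  rewrite (@kappa_ae _ _ _ P _ (fun w => J (step_restrict A L) w + J (step_restrict B L) w))//.
    exact: kappaD.
  exact: measurable_funD.
rewrite (@kappa_ae _ _ _ P (J (step_restrict B L))
    (fun w => J (step_restrict (A `|` B) L) w - J (step_restrict A L) w))//.
  exact: kappaB.
  exact: measurable_funB.
by apply: filterS H => w ->; rewrite addrC addKr.
Qed.

(** * Integrals of step functions that tend to 0 almost everywhere *)

Section Uniqueness.
Variable V : nat -> step.
Hypothesis okV : forall n, step_ok (V n).
Hypothesis cvgV : leb [set x : point | ~ (step_eval (V n) x @[n --> \oo] --> (0 : 'cV[R]_d))] = 0%E.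
Let Jr A n := kappa P (J (step_restrict A (V n))).

(* The V n are bounded uniformly in n on G m, and the G m exhaust the set of
   convergence; this takes the place of Egorov's theorem. *)
Let G (m : nat) : set point :=
  [set x | `|x| < m%:R /\ forall n, `|step_eval (V n) x| < m%:R].

Let measurableG m : measurable (G m : set borel).
Proof.
rewrite (_ : G m = ~` [set x | m%:R <= `|x|] `&`
    \bigcap_n ~` [set x | m%:R <= `|step_eval (V n) x|]); last first.
  apply/seteqP; split=> x [h1 h2].
    by split=> [|n _] /=; apply/negP; rewrite -ltNge.
  split=> [|n]; first by rewrite ltNge; apply/negP.
  by rewrite ltNge; apply/negP; exact: (h2 n I).
apply: measurableI.
  apply: measurableC; apply: (@measurable_norm_ge _ _ borel _ _ (fun x => x)).
  exact: measurable_id.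
by apply: bigcapT_measurable => n; apply: measurableC; exact: measurable_step_eval_norm.
Qed.

Let boundedG m : bounded_borel (G m).
Proof.
split; first exact: measurableG.
by apply/bounded_setP; exists m%:R => x [/ltW].
Qed.

Let subG m m' : (m <= m')%N -> G m `<=` G m'.
Proof.
move=> mm' x [h1 h2]; have mm : m%:R <= m'%:R :> R by rewrite ler_nat.
by split=> [|n]; [exact: lt_le_trans h1 mm|exact: lt_le_trans (h2 n) mm].
Qed.

Let leb_null A : A `<=` [set x : point | ~ (step_eval (V n) x @[n --> \oo] --> (0 : 'cV[R]_d))] ->
  leb A = 0%E.
Proof.
by move=> /le_leb; rewrite cvgV => h; apply/eqP; rewrite eq_le h leb_ge0.
Qed.

Let coverG x : (step_eval (V n) x @[n --> \oo] --> (0 : 'cV[R]_d)) -> exists m, G m x.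
Proof.
move=> cx.
have [N _ hN] : \forall n \near \oo, `|step_eval (V n) x| < 1.
  apply: (@cvgr0_norm_lt _ _ _ _ _ (fun n => step_eval (V n) x) cx); exact: ltr01.
pose C := `|x| + 1 + \sum_(i < N) `|step_eval (V i) x|.
have sum0 : 0 <= \sum_(i < N) `|step_eval (V i) x| by apply: sumr_ge0.
have [m Cm] : exists m : nat, C < m%:R.
  by exists (Num.truncn C).+1; exact: truncnS_gt.
exists m; split=> [|n]; apply: le_lt_trans Cm; rewrite /C.
  by have := normr_ge0 x; lra.
have [/hN/ltW h|nN] := leqP N n.
  by apply: le_trans h _; have := normr_ge0 x; lra.
rewrite (bigD1 (Ordinal nN))//=.
have : 0 <= \sum_(i < N | i != Ordinal nN) `|step_eval (V i) x| by apply: sumr_ge0.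
by have := normr_ge0 x; lra.
Qed.

(** The part [E n] of [G m] where some later [V j] reaches [dl] decreases to a null set. On [B] the
    values of [V n] are either at least [dl], hence bounded by [m] on the small set [E n], or below
    [dl] on the set [G m] of finite measure; [kappa_small] handles both. The index [N] is uniform in
    [B], as the gliding hump requires. *)
Let small_inside m (e : R) : 0 < e -> exists N, forall n, (N <= n)%N ->
  forall B, measurable (B : set borel) -> B `<=` G m -> Jr B n <= e.
Proof.
move=> e0; have e40 : 0 < e / 4 by rewrite divr_gt0.
have [eta eta0 heta] := kappa_small e40.
pose lm := fine (leb (G m)); have lm0 : 0 <= lm by rewrite fine_ge0// leb_ge0.
have l10 : 0 < lm + 1 by rewrite ltr_wpDl.
have [dl dl0 hdl] := psi_small (divr_gt0 eta0 l10).
have [S S0 hS] := psi_bound m%:R.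
pose E n := G m `&` \bigcup_(j in [set j | (n <= j)%N]) [set x | dl <= `|step_eval (V j) x|].
have mE n : bounded_borel (E n).
  rewrite /E setIC; apply: bounded_borelI => //.
  by apply: bigcup_measurable => j _; exact: measurable_step_eval_norm.
have dE n : E n.+1 `<=` E n.
  by move=> x [Gx [j /= nj hj]]; split=> //; exists j => //=; exact: ltnW.
have lE : leb (\bigcap_n E n) = 0%E.
  apply: leb_null => x Ex cx.
  have [N _ hN] : \forall n \near \oo, `|step_eval (V n) x| < dl.
    exact: (@cvgr0_norm_lt _ _ _ _ _ (fun n => step_eval (V n) x) cx).
  have [_ [j /= Nj]] := Ex N I.
  by rewrite leNgt hN.
have S10 : 0 < S + 1 by rewrite ltr_wpDl.
have [N hN] := leb_nonincreasing_cvg0 mE dE lE (divr_gt0 eta0 S10).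
exists N => n Nn B mB BG.
pose D := [set x | dl <= `|step_eval (V n) x|].
have mD : measurable (D : set borel) by exact: measurable_step_eval_norm.
have oB A : measurable (A : set borel) -> step_ok (step_restrict A (V n)).
  by move=> mA; exact: step_ok_restrict.
have mBD : measurable (B `\` D : set borel) by exact: measurableD.
have mBI : measurable (B `&` D : set borel) by exact: measurableI.
have dBD : (B `&` D) `&` (B `\` D) = set0 by rewrite setDE setIACA setICr setI0.
have [h _] := kappa_restrictU (okV n) mBI mBD dBD.
rewrite /Jr -(setUIDK B D); apply: le_trans h _.
have k1 : kappa P (J (step_restrict (B `&` D) (V n))) <= e / 4.
  apply: (heta _ m%:R S (E n)) => //; first exact: oB.
  - move=> x; rewrite step_eval_restrict normrZ indicE.
    have [/set_mem[/BG[_ h] _]|_] := boolP (x \in _); last by rewrite normr0 mul0r.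
    by rewrite normr1 mul1r ltW.
  - move=> x; rewrite step_eval_restrict indicE.
    have [/set_mem[/BG Gx Dx] _|_] := boolP (x \in _); last by rewrite scale0r eqxx.
    by split=> //; exists n => //=.
  - apply: le_trans (_ : S * (eta / (S + 1)) <= _).
      by rewrite ler_wpM2l// hN.
    by rewrite mulrCA ler_piMr ?(ltW eta0)// ler_pdivrMr// mul1r lerDl.
have k2 : kappa P (J (step_restrict (B `\` D) (V n))) <= e / 4.
  apply: (heta _ dl (eta / (lm + 1)) (G m)) => //; first exact: oB.
  - by rewrite divr_ge0// ltW.
  - move=> x; rewrite step_eval_restrict normrZ indicE.
    have [/set_mem[_ /negP]|_] := boolP (x \in _); last by rewrite normr0 mul0r ltW.
    by rewrite -ltNge normr1 mul1r => /ltW.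
  - move=> x; rewrite step_eval_restrict indicE.
    have [/set_mem[/BG Gx _] _|_] := boolP (x \in _); last by rewrite scale0r eqxx.
    done.
  - rewrite -/lm mulrAC -mulrA ler_piMr ?(ltW eta0)// ler_pdivrMr// mul1r lerDl.
    done.
lra.
Qed.

(** For fixed [n] the function [V n] is bounded with bounded support, and the part of this support
    outside [G m] decreases to a null set as [m] grows. *)
Let small_outside n (e : R) : 0 < e -> exists m,
  forall B, measurable (B : set borel) -> B `&` G m = set0 -> Jr B n <= e.
Proof.
move=> e0; have [eta eta0 heta] := kappa_small e0.
pose C := \sum_(p <- V n) `|p.1|.
have [S S0 hS] := psi_bound C.
pose E m := step_support (V n) `\` G m.
have bE m : bounded_borel (E m).
  by apply: bounded_borelD => //; exact: step_support_bounded.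
have dE m : E m.+1 `<=` E m.
  by move=> x [sx Gx]; split=> // h; apply: Gx; exact: subG h.
have lE : leb (\bigcap_n E n) = 0%E.
  apply: leb_null => x Ex /coverG[m Gx].
  by have [] := Ex m I.
have S10 : 0 < S + 1 by rewrite ltr_wpDl.
have [m hm] := leb_nonincreasing_cvg0 bE dE lE (divr_gt0 eta0 S10).
exists m => B mB BG; apply: (heta _ C S (E m)) => //; first exact: step_ok_restrict.
- move=> x; rewrite step_eval_restrict normrZ indicE.
  apply: le_trans (_ : 1 * `|step_eval (V n) x| <= _).
    by rewrite ler_wpM2r//; case: (_ \in _); rewrite ?normr1 ?normr0.
  by rewrite mul1r step_eval_norm.
- move=> x; rewrite step_eval_restrict indicE.
  have [/set_mem Bx|_] := boolP (x \in _); last by rewrite scale0r eqxx.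
  rewrite scale1r => Vx; split; last by move=> Gx; have : (B `&` G m) x by []; rewrite BG.
  by apply: contrapT => /step_eval_notin sx; rewrite sx eqxx in Vx.
- apply: le_trans (_ : S * (eta / (S + 1)) <= _).
    by rewrite ler_wpM2l// hm.
  by rewrite mulrCA ler_piMr ?(ltW eta0)// ler_pdivrMr// mul1r lerDl.
Qed.

Hypothesis cauchyV : forall A (e : R), measurable (A : set borel) -> 0 < e ->
  exists N, forall n n', (N <= n)%N -> (N <= n')%N ->
  kappa P (fun w => J (step_restrict A (V n)) w - J (step_restrict A (V n')) w) <= e.

(* Gliding hump: if J (V n) does not tend to 0, choose alternately indices n and
   n' such that V n has most of its integral on a shell [G m1 `\` G m], while V n'
   has almost none on G m1. The integrals of the V n over the union A of these
   shells are then not Cauchy. *)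
Lemma step_integral_cvg0 (c : R) : 0 < c ->
  exists N, forall n, (N <= n)%N -> kappa P (J (V n)) <= c.
Proof.
move=> c0; apply: contrapT => /forallNP noN.
(* Four uses of a triangle inequality with factor 2 reduce the hump from [c] to about [c / 16],
   which must still exceed a few multiples of [eta]; 1000 leaves ample room. *)
pose eta := c / 1000; have eta0 : 0 < eta by rewrite /eta; lra.
have {}noN N : exists2 n, (N <= n)%N & c < Jr setT n.
  have /existsNP[n /not_implyP[Nn /negP]] := noN N.
  rewrite -ltNge => h; exists n => //; apply: lt_le_trans h _.
  rewrite /Jr (@kappa_ae _ _ _ P (J (V n)) (J (step_restrict setT (V n))))//.
  - exact: measurable_step_integral.
  - by apply/measurable_step_integral/step_ok_restrict.
  - apply: step_integral_eq => //; first exact: step_ok_restrict.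
    by move=> x; rewrite step_eval_restrict indicT scale1r.
(* Up to [eta], the integral of [V n] lives on the shell between [G m] and [G m1], and that of
   [V n'] on the gap between [G m1] and [G m2]. The union of the shells will contain the former and
   miss the latter. *)
pose good m N (q : nat * nat * nat * nat) := let: (n, m1, n', m2) := q in
  [/\ [/\ (N <= n)%N, (N <= n')%N, (m <= m1)%N & (m1 <= m2)%N], c < Jr setT n,
    (forall B, measurable (B : set borel) -> B `<=` G m -> Jr B n <= eta) /\
    (forall B, measurable (B : set borel) -> B `&` G m1 = set0 -> Jr B n <= eta) &
    (forall B, measurable (B : set borel) -> B `<=` G m1 -> Jr B n' <= eta) /\
    (forall B, measurable (B : set borel) -> B `&` G m2 = set0 -> Jr B n' <= eta)].
have out_mono m0 m1 B : (m0 <= m1)%N -> B `&` G m1 = set0 -> B `&` G m0 = set0.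
  move=> m01 h; apply/seteqP; split=> // x [Bx Gx].
  by rewrite -h; split=> //; exact: subG Gx.
have goodE mN : {q | good mN.1 mN.2 q}.
  apply: cid; case: mN => m N /=.
  have [N1 hN1] := small_inside m eta0.
  have [n Nn cn] := noN (maxn N N1).
  have [m0 hm0] := small_outside n eta0.
  pose m1 := maxn m m0.
  have [N2 hN2] := small_inside m1 eta0.
  pose n' := maxn N N2.
  have [m0' hm0'] := small_outside n' eta0.
  exists (n, m1, n', maxn m1 m0'); split=> //; split.
  - by rewrite (leq_trans _ Nn)// leq_maxl.
  - by rewrite leq_maxl.
  - by rewrite leq_maxl.
  - by rewrite leq_maxl.
  - by apply: hN1; rewrite (leq_trans _ Nn)// leq_maxr.
  - by move=> B mB h; apply: hm0 => //; apply: out_mono h; rewrite leq_maxr.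
  - by apply: hN2; rewrite leq_maxr.
  - by move=> B mB h; apply: hm0' => //; apply: out_mono h; rewrite leq_maxr.
pose q mN := sval (goodE mN).
(* [ms i] is the inner index of the [i]-th shell. Running the construction with [N = i] makes its
   two indices [n] and [n'] at least [i], so that stage [N] is beyond the Cauchy threshold [N]. *)
pose ms := fix ms i := if i is i'.+1 then (q (ms i', i')).2 else 0%N.
pose m1 i := (q (ms i, i)).1.1.2.
have mslt i : (ms i <= m1 i <= ms i.+1)%N.
  rewrite /m1 /= /q; case: (goodE _) => -[[[n a] n'] b] /= [[_ _ h1 h2] _ _ _].
  by rewrite h1 h2.
have ms_mono i j : (i <= j)%N -> (ms i <= ms j)%N.
  elim: j => [|j ih]; first by rewrite leqn0 => /eqP->.
  rewrite leq_eqVlt ltnS => /predU1P[->//|/ih h].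
  by apply: leq_trans h _; have /andP[] := mslt j; exact: leq_trans.
pose H i := G (m1 i) `\` G (ms i).
pose A := \bigcup_i H i.
have mH i : measurable (H i : set borel) by apply: measurableD.
have mA : measurable (A : set borel) by apply: bigcupT_measurable.
(* [A] has no points in the gap after the [i]-th shell: earlier shells lie inside [G (m1 i)], later
   ones outside [G (ms i.+1)]. *)
have AG i : A `&` G (ms i.+1) `<=` G (m1 i).
  move=> x [[j _ [Gj NGj]] Gx]; have [ji|ij] := leqP j i.
    apply: subG Gj; move: ji; rewrite leq_eqVlt => /predU1P[->//|ji].
    have /andP[_ h1] := mslt j; have /andP[h2 _] := mslt i.
    exact: leq_trans (leq_trans h1 (ms_mono _ _ ji)) h2.
  by exfalso; apply: NGj; apply: subG Gx; exact: ms_mono.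
have [N hN] := cauchyV mA eta0.
have := hN (q (ms N, N)).1.1.1 (q (ms N, N)).1.2.
have AGN := AG N; move: AGN; have HN : H N `<=` A by exact: bigcup_sup.
move: HN; rewrite /H /m1 /= /q; case: (goodE _) => -[[[n a] n'] b] /=.
move=> [[Nn Nn' ma ab] cn [n_in n_out] [n'_in n'_out]] HA AGN /(_ Nn Nn').
set m := ms N in ma n_in HA *.
have mG i : measurable (~` G i : set borel) by exact: measurableC.
(* The lower bound for [V n] passes from the whole space to [G a], to the shell, to the part of [A]
   in [G a], and finally to [A]; [hA'] bounds [V n'] on [A] from above. *)
have [hT _] := kappa_restrictU (okV n) (measurableG a) (mG a) (setICr _).
have [hGa _] := @kappa_restrictU (V n) (G m) (G a `\` G m) (okV n) (measurableG m)
  (measurableD (measurableG a) (measurableG m)) (setDIK _ _).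
have eGa : G m `|` (G a `\` G m) = G a by apply: setDUK; exact: subG.
rewrite eGa in hGa; rewrite setUv in hT.
have mAG i : measurable (A `&` G i : set borel) by exact: measurableI.
have mADG i : measurable (A `\` G i : set borel) by exact: measurableD.
have eA : (A `\` G a) `|` (A `&` G a) = A by rewrite setUC setUIDK.
have disjAm : (A `&` G m) `&` (G a `\` G m) = set0.
  by rewrite -setIA setDIK setI0.
have [_ hH] := @kappa_restrictU (V n) (A `&` G m) (G a `\` G m) (okV n) (mAG m)
  (measurableD (measurableG a) (measurableG m)) disjAm.
have eH : (A `&` G m) `|` (G a `\` G m) = A `&` G a.
  apply/seteqP; split=> x.
    by move=> [[Ax Gx]|[Gx NGx]]; split=> //; [exact: subG Gx|exact: HA].
  by move=> [Ax Gx]; have [Gm|Gm] := pselect (G m x); [left|right].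
rewrite eH in hH.
have disjA : (A `\` G a) `&` (A `&` G a) = set0.
  by rewrite setDE setIACA (setIC (~` _)) setICr setI0.
have [_ hAG] := kappa_restrictU (okV n) (mADG a) (mAG a) disjA.
have [hA' _] := kappa_restrictU (okV n') (mADG a) (mAG a) disjA.
rewrite eA in hAG hA'.
have b1 : Jr (G m) n <= eta by apply: n_in => //.
have b2 : Jr (~` G a) n <= eta by apply: n_out => //; rewrite setICl.
have b3 : Jr (A `&` G m) n <= eta by apply: n_in => //; exact: subIsetr.
have b4 : Jr (A `\` G a) n <= eta.
  by apply: n_out => //; rewrite setDE -setIA setICl setI0.
have b5 : Jr (A `&` G a) n' <= eta by apply: n'_in => //; exact: subIsetr.
have b6 : Jr (A `\` G a) n' <= eta.
  apply: n'_out => //; apply/seteqP; split=> // x [[Ax NGx] Gx].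
  by apply: NGx; exact: AGN.
have mJ i : mfun (J (step_restrict A (V i))).
  by apply/measurable_step_integral/step_ok_restrict.
have := kappaD P (measurable_funB (mJ n) (mJ n')) (mJ n').
rewrite (_ : (fun w => _ + _) = J (step_restrict A (V n))); last first.
  by apply/funext => w; rewrite subrK.
rewrite /Jr /eta in cn b1 b2 b3 b4 b5 b6 *; move: hT hGa hH hAG hA' cn b1 b2 b3 b4 b5 b6.
move: (kappa _ _) => *; lra.
Qed.

End Uniqueness.
End LevyBasis.

(** * Independence of the approximating sequence *)

Section Approximation.
Context {R : realType} {k d : nat} {d0 : measure_display} {T : measurableType d0}.
Hypothesis k_gt0 : (0 < k)%N.
Variables (P : probability T R) (M : set 'cV[R]_k -> T -> 'cV[R]_d).
Hypothesis basisM : homogeneous_levy_basis P M.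
Local Notation point := 'cV[R]_k.
Local Notation borel := (borelType 'cV[R]_k).
Local Notation step := (@step R k d).
Local Notation mfun := (measurable_fun [set: T]).
Local Notation Re := complex.Re.
Local Notation Im := complex.Im.
Local Notation J := (step_integral M).
Local Notation phi U := (Cexpect P (fun w => expi (U w))).
Implicit Types (L K : nat -> step) (g : point -> 'cV[R]_d) (U W : T -> R).

(** A scalar and weakened form of [levy_integral]: convergence is measured by [kappa], and the
    limits over Borel sets are replaced by Cauchy conditions. In this form it is stable under
    sums. *)
Record approximates g L W : Prop := Approximates {
  approx_ok : forall n, step_ok (L n) ;
  approx_cvg : leb [set x : point | ~ (step_eval (L n) x @[n --> \oo] --> g x)] = 0%E ;
  approx_cauchy : forall (A : set point) (e : R), measurable (A : set borel) -> 0 < e ->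
    exists N, forall n n', (N <= n)%N -> (N <= n')%N ->
    kappa P (fun w => J (step_restrict A (L n)) w - J (step_restrict A (L n')) w) <= e ;
  approx_measurable : mfun W ;
  approx_lim : forall e : R, 0 < e -> exists N, forall n, (N <= n)%N ->
    kappa P (fun w => J (L n) w - W w) <= e }.

Lemma leb_null_sub2 (A B C : set point) : A `<=` B `|` C -> leb B = 0%E ->
  leb C = 0%E -> leb A = 0%E.
Proof.
move=> ABC B0 C0; apply/eqP; rewrite eq_le leb_ge0 andbT.
apply: le_trans (le_leb ABC) _.
apply: le_trans (outer_measureU2 (leb_outer k_gt0) B C) _.
by rewrite /= B0 C0 adde0.
Qed.

Lemma step_restrict_cat (A : set point) (S S' : step) :
  step_restrict A (S ++ S') = step_restrict A S ++ step_restrict A S'.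
Proof. exact: map_cat. Qed.

Lemma step_restrict_neg (A : set point) (S : step) :
  step_restrict A (step_neg S) = step_neg (step_restrict A S).
Proof. by rewrite /step_restrict /step_neg -!map_comp. Qed.

Lemma mJ S : step_ok S -> mfun (J S).
Proof. exact: (measurable_step_integral basisM). Qed.

Lemma mJr (A : set point) S : measurable (A : set borel) -> step_ok S ->
  mfun (J (step_restrict A S)).
Proof. by move=> mA oS; apply/mJ/step_ok_restrict. Qed.

Lemma kappa_four (U1 U2 V1 V2 : T -> R) : mfun U1 -> mfun U2 -> mfun V1 -> mfun V2 ->
  kappa P (fun w => (U1 w + U2 w) - (V1 w + V2 w)) <=
  2 * kappa P (fun w => U1 w - V1 w) + 2 * kappa P (fun w => U2 w - V2 w).
Proof.
move=> m1 m2 m3 m4.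
rewrite (_ : (fun w => _) = fun w => (U1 w - V1 w) + (U2 w - V2 w)).
  by apply: kappaD; exact: measurable_funB.
by apply/funext => w; ring.
Qed.

Lemma approximatesD g g' L L' W W' : approximates g L W -> approximates g' L' W' ->
  approximates (fun x => g x + g' x) (fun n => L n ++ L' n) (fun w => W w + W' w).
Proof.
move=> [ok1 c1 h1 m1 l1] [ok2 c2 h2 m2 l2]; split.
- by move=> n; exact: step_ok_cat.
- apply: leb_null_sub2 c1 c2 => x /=.
  apply: contra_notP => /not_orP[/contrapT cx /contrapT cx'].
  rewrite (_ : (fun n => _) = fun n => step_eval (L n) x + step_eval (L' n) x).
    exact: cvgD.
  by apply/funext => n; rewrite step_eval_cat.
- move=> A e mA e0; have e40 : 0 < e / 4 by lra.
  have [N hN] := h1 A _ mA e40; have [N' hN'] := h2 A _ mA e40.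
  exists (maxn N N') => n n'; rewrite !geq_max => /andP[n1 n2] /andP[n3 n4].
  have := hN _ _ n1 n3; have := hN' _ _ n2 n4.
  rewrite !step_restrict_cat.
  rewrite (_ : (fun w => J (_ ++ _) w - _) = fun w =>
      (J (step_restrict A (L n)) w + J (step_restrict A (L' n)) w) -
      (J (step_restrict A (L n')) w + J (step_restrict A (L' n')) w)); last first.
    by apply/funext => w; rewrite !step_integral_cat.
  have := kappa_four (mJr mA (ok1 n)) (mJr mA (ok2 n)) (mJr mA (ok1 n')) (mJr mA (ok2 n')).
  lra.
- exact: measurable_funD.
- move=> e e0; have e40 : 0 < e / 4 by lra.
  have [N hN] := l1 _ e40; have [N' hN'] := l2 _ e40.
  exists (maxn N N') => n; rewrite geq_max => /andP[n1 n2].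
  have := hN _ n1; have := hN' _ n2.
  rewrite (_ : (fun w => J (_ ++ _) w - _) = fun w =>
      (J (L n) w + J (L' n) w) - (W w + W' w)); last first.
    by apply/funext => w; rewrite !step_integral_cat.
  have := kappa_four (mJ (ok1 n)) (mJ (ok2 n)) m1 m2.
  lra.
Qed.

Lemma kappa0 : kappa P (fun=> 0) = 0.
Proof. by rewrite /kappa; under eq_Rintegral do rewrite cos0 subrr; exact: expect_cst. Qed.

(** Allows a step function to be subtracted from an integral, so that an approximation error becomes
    itself an integral. *)
Lemma approximates_step (S : step) : step_ok S ->
  approximates (step_eval S) (fun=> S) (J S).
Proof.
move=> oS; split=> //.
- rewrite (_ : mkset _ = set0) ?leb_set0//.
  apply/seteqP; split=> // x /=; apply; exact: cvg_cst.
- move=> A e mA e0; exists 0%N => n n' _ _.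
  by under [fun w => _]eq_fun do rewrite subrr; rewrite kappa0 ltW.
- exact: mJ.
- move=> e e0; exists 0%N => n _.
  by under [fun w => _]eq_fun do rewrite subrr; rewrite kappa0 ltW.
Qed.

Variable psi : 'cV[R]_d -> R[i].
Hypothesis psi_continuous : continuous (psi : 'cV[R]_d -> (R[i] : numFieldType)).
Hypothesis psi0 : psi 0 = 0.
Hypothesis psiM : forall A theta, bounded_borel A ->
  charfun P (M A) theta = cexp (psi theta * (fine (leb A))%:C%C).

Lemma kappa_phi U W : mfun U -> mfun W -> phi U = phi W -> kappa P U = kappa P W.
Proof. by move=> mU mW UW; rewrite !kappaE// UW. Qed.

(** Restricting a translate to [A] amounts to translating the restriction to [A - h], and [kappa]
    only sees the characteristic function, which is invariant under translation. *)
Lemma kappa_step_shift (h : point) (A : set point) (S S' : step) :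
  measurable (A : set borel) -> step_ok S -> step_ok S' ->
  kappa P (fun w => J (step_restrict A (step_shift h S)) w -
                    J (step_restrict A (step_shift h S')) w) =
  kappa P (fun w => J (step_restrict [set x | A (x + h)] S) w -
                    J (step_restrict [set x | A (x + h)] S') w).
Proof.
move=> mA oS oS'; set B := [set x | A (x + h)].
have mB : measurable (B : set borel).
  have := measurable_shift (- h) mA.
  by congr measurable; apply/seteqP; split=> x; rewrite /B /= opprK.
have E C (S1 S2 : step) : (fun w => J (step_restrict C S1) w - J (step_restrict C S2) w) =
    J (step_restrict C (S1 ++ step_neg S2)).
  apply/funext => w.
  by rewrite step_restrict_cat step_restrict_neg step_integral_cat step_integral_neg.
have oN : step_ok (S ++ step_neg S') by apply: step_ok_cat => //; exact: step_ok_neg.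
have oA C (S1 S2 : step) : measurable (C : set borel) -> step_ok S1 -> step_ok S2 ->
    step_ok (step_restrict C (S1 ++ step_neg S2)).
  by move=> mC ok1 ok2; apply: step_ok_restrict => //; apply: step_ok_cat => //; exact: step_ok_neg.
rewrite !E; apply: kappa_phi.
- by apply/mJ/oA => //; exact: step_ok_shift.
- by apply/mJ/oA.
rewrite -(phi_step_shift basisM psiM h (oA B _ _ mB oS oS')).
apply: (phi_step_eq basisM).
- by apply: oA => //; exact: step_ok_shift.
- by apply/step_ok_shift/oA.
move=> x; rewrite step_eval_shift !step_eval_restrict !step_eval_cat !step_eval_neg.
rewrite !step_eval_shift (_ : \1_B (x - h) = \1_A x :> R)//.
rewrite !indicE; congr (_%:R); congr nat_of_bool.
by apply/idP/idP => /set_mem hx; apply/mem_set; rewrite /B /= ?subrK// in hx *.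
Qed.

(** The translates of the [L n] minus the [L' n] tend to 0 almost everywhere and have Cauchy
    integrals over every Borel set, so [step_integral_cvg0] applies to them. The case [h = 0] says
    that the law does not depend on the approximating sequence. *)
Lemma approximates_shift_law (h : point) g L L' W W' : approximates g L W ->
  approximates (fun x => g (x - h)) L' W' -> phi W = phi W'.
Proof.
move=> [ok1 c1 h1 m1 l1] [ok2 c2 h2 m2 l2].
pose V n := step_shift h (L n) ++ step_neg (L' n).
have oV n : step_ok (V n).
  by apply: step_ok_cat; [exact: step_ok_shift|exact: step_ok_neg].
have cV : leb [set x : point | ~ (step_eval (V n) x @[n --> \oo] --> (0 : 'cV[R]_d))] = 0%E.
  have c1' : leb [set x : point | ~ (step_eval (L n) (x - h) @[n --> \oo] --> g (x - h))] = 0%E.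
    exact: (etrans (leb_shift [set x : point | ~ (step_eval (L n) x @[n --> \oo] --> g x)] (- h)) c1).
  apply: leb_null_sub2 c1' c2 => x /=.
  apply: contra_notP => /not_orP[/contrapT cx /contrapT cx'].
  rewrite (_ : (fun n => _) = fun n => step_eval (L n) (x - h) - step_eval (L' n) x).
    by rewrite -(subrr (g (x - h))); exact: cvgB.
  by apply/funext => n; rewrite step_eval_cat step_eval_neg step_eval_shift.
have JV n w : J (V n) w = J (step_shift h (L n)) w - J (L' n) w.
  by rewrite step_integral_cat step_integral_neg.
have cauchyV (A : set point) (e : R) : measurable (A : set borel) -> 0 < e ->
    exists N, forall n n', (N <= n)%N -> (N <= n')%N ->
    kappa P (fun w => J (step_restrict A (V n)) w - J (step_restrict A (V n')) w) <= e.
  move=> mA e0; have e40 : 0 < e / 4 by lra.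
  have mB : measurable ([set x | A (x + h)] : set borel).
    have := measurable_shift (- h) mA.
    by congr measurable; apply/seteqP; split=> x; rewrite /= opprK.
  have [N hN] := h1 _ _ mB e40; have [N' hN'] := h2 A _ mA e40.
  exists (maxn N N') => n n'; rewrite !geq_max => /andP[n1 n2] /andP[n3 n4].
  have := hN _ _ n1 n3; have := hN' _ _ n2 n4.
  rewrite -kappa_step_shift// -(kappaN P (fun w => J _ w - _)).
  rewrite (_ : (fun w => - (J _ w - _)) = fun w =>
    - J (step_restrict A (L' n)) w - - J (step_restrict A (L' n')) w); last first.
    by apply/funext => w; rewrite opprB opprK addrC.
  rewrite (_ : (fun w => J (step_restrict A (V n)) w - _) = fun w =>
      (J (step_restrict A (step_shift h (L n))) w + - J (step_restrict A (L' n)) w) -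
      (J (step_restrict A (step_shift h (L n'))) w + - J (step_restrict A (L' n')) w));
      last first.
    apply/funext => w; rewrite !step_restrict_cat !step_restrict_neg.
    by rewrite !step_integral_cat !step_integral_neg.
  have mN S : step_ok S -> mfun (fun w => - J (step_restrict A S) w).
    by move=> oS; apply: (measurableT_comp _ (mJr mA oS)).
  have := kappa_four (mJr mA (step_ok_shift h (ok1 n))) (mN _ (ok2 n))
    (mJr mA (step_ok_shift h (ok1 n'))) (mN _ (ok2 n')).
  lra.
(* Three comparisons: [W] with [L n], the translate of [L n] with [L' n], and [L' n] with [W']. *)
have main (e : R) : 0 < e -> `|Re (phi W) - Re (phi W')| <= 3 * e /\
    `|Im (phi W) - Im (phi W')| <= 3 * e.
  move=> e0; have eta0 : 0 < e ^+ 2 / 2 by rewrite divr_gt0// exprn_gt0.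
  have [N1 hN1] := step_integral_cvg0 k_gt0 basisM psi_continuous psi0 psiM oV cV cauchyV eta0.
  have [N2 hN2] := l1 _ eta0; have [N3 hN3] := l2 _ eta0.
  pose n := maxn N1 (maxn N2 N3).
  have := hN1 n (leq_maxl _ _).
  have := hN2 n (leq_trans (leq_maxl _ _) (leq_maxr _ _)).
  have := hN3 n (leq_trans (leq_maxr _ _) (leq_maxr _ _)).
  rewrite (_ : J (V n) = fun w => J (step_shift h (L n)) w - J (L' n) w); last first.
    by apply/funext => w; exact: JV.
  move=> /(kappa_charfun (mJ (ok2 n)) m2 e0)[a1 a2].
  move=> /(kappa_charfun (mJ (ok1 n)) m1 e0)[a3 a4].
  move=> /(kappa_charfun (mJ (step_ok_shift h (ok1 n))) (mJ (ok2 n)) e0)[a5 a6].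
  rewrite (phi_step_shift basisM psiM h (ok1 n)) in a5 a6.
  move: a1 a2 a3 a4 a5 a6; rewrite !ler_norml.
  by move=> /andP[? ?] /andP[? ?] /andP[? ?] /andP[? ?] /andP[? ?] /andP[? ?];
    split; apply/andP; split; lra.
have small0 (x : R) : (forall e : R, 0 < e -> `|x| <= 3 * e) -> x = 0.
  move=> hx; apply/eqP; rewrite -normr_le0; apply/ler_addgt0Pr => e e0.
  rewrite add0r; apply: le_trans (hx (e / 3) _) _; lra.
apply: complex_ext; apply/eqP; rewrite -subr_eq0; apply/eqP; apply: small0 => e /main[] //.
Qed.

End Approximation.

(** * The integral with respect to a Levy basis *)

Section LevyIntegral.
Context {R : realType} {k d q : nat} {d0 : measure_display} {T : measurableType d0}.
Hypothesis k_gt0 : (0 < k)%N.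
Variables (P : probability T R) (M : set 'cV[R]_k -> T -> 'cV[R]_d).
Hypothesis basisM : homogeneous_levy_basis P M.
Local Notation mfun := (measurable_fun [set: T]).
Local Notation J := (step_integral M).
Implicit Types (s : simple_fun R k q d) (theta : 'cV[R]_q).

(** Transposition moves [theta] from the values of the integral to the integrand, leaving a scalar
    integral. *)
Definition simple_step theta s : step :=
  [seq ((sf_coef (s := s) i)^T *m theta, sf_set (s := s) i) | i <- index_enum 'I_(sf_size s)].

Lemma simple_step_ok theta s : step_ok (simple_step theta s).
Proof.
by rewrite /simple_step; elim: (index_enum _) => [//|i r ih] /=; split=> //;
  exact: sf_bounded_borel.
Qed.

Lemma simple_step_eval theta s x :
  step_eval (simple_step theta s) x = (sf_eval s x)^T *m theta.
Proof.
rewrite /step_eval /simple_step big_map /sf_eval raddf_sum mulmx_suml.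
by apply: eq_bigr => i _ /=; rewrite linearZ/= -scalemxAl.
Qed.

Lemma inner_tr_mulmx (A : 'M[R]_(q, d)) theta (c : 'cV[R]_d) :
  inner (A^T *m theta) c = inner theta (A *m c).
Proof.
rewrite /inner (eq_bigr (fun i => \sum_j A j i * theta j 0 * c i 0)); last first.
  by move=> i _; rewrite mxE big_distrl/=; apply: eq_bigr => j _; rewrite mxE.
rewrite exchange_big/=; apply: eq_bigr => j _; rewrite mxE big_distrr/=.
by apply: eq_bigr => i _; ring.
Qed.

Lemma inner_sumr (n : nat) (I : Type) (r : seq I) (t : 'cV[R]_n) (F : I -> 'cV[R]_n) :
  inner t (\sum_(i <- r) F i) = \sum_(i <- r) inner t (F i).
Proof.
elim: r => [|i r ih]; first by rewrite !big_nil inner0r.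
by rewrite !big_cons innerDr ih.
Qed.

Lemma simple_step_integral theta s A w :
  J (step_restrict A (simple_step theta s)) w = inner theta (sf_integral M A s w).
Proof.
rewrite /step_integral /step_restrict /simple_step -map_comp big_map.
rewrite /sf_integral inner_sumr; apply: eq_bigr => i _ /=.
by rewrite inner_tr_mulmx.
Qed.

Lemma measurable_sf_integral (A : set 'cV[R]_k) s :
  measurable (A : set (borelType 'cV[R]_k)) -> random_vector (sf_integral M A s).
Proof.
move=> mA; apply/random_vectorP => i j.
rewrite (_ : (fun w => _) = fun w => \sum_(a < sf_size s) \sum_b
    sf_coef (s := s) a i b * M (A `&` sf_set (s := s) a) w b j).
  apply: measurable_sum => a; apply: measurable_sum => b.
  apply: measurable_funM => //.
  apply: (random_vectorP _).1; apply: (basis_measurable basisM).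
  by apply: bounded_borelI => //; exact: sf_bounded_borel.
by apply/funext => w; rewrite /sf_integral summxE; apply: eq_bigr => a _; rewrite mxE.
Qed.

Lemma tr_mulmx_norm (A : 'M[R]_(q, d)) theta :
  `|A^T *m theta| <= (\sum_i `|theta i 0|) * `|A|.
Proof.
have S0 : 0 <= \sum_i `|theta i 0| by apply: sumr_ge0.
apply/mx_norm_leP => [|i j]; first by rewrite mulr_ge0.
rewrite mxE big_distrl/=; apply: le_trans (ler_norm_sum _ _ _) _; apply: ler_sum => a _.
rewrite (ord1 j) normrM mulrC ler_wpM2l// mxE.
by apply: (mx_norm_leP A (normr_ge0 A)).1.
Qed.

(** Cramer-Wold reduction to scalar integrals. The limits [ZA] over the Borel sets give the Cauchy
    conditions through [kappa_triangle]. *)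
Lemma levy_integral_approximates (g : 'cV[R]_k -> 'M[R]_(q, d)) (Z : T -> 'cV[R]_q)
    theta : levy_integral P M g Z ->
  exists L, approximates P M (fun x => (g x)^T *m theta) L (fun w => inner theta (Z w)).
Proof.
move=> [s [sg sA sZ]]; exists (fun n => simple_step theta (s n)); split.
- by move=> n; exact: simple_step_ok.
- apply/eqP; rewrite eq_le leb_ge0 andbT -sg; apply: le_leb => x /=.
  apply: contra_not => cx; apply/cvgrPdist_lt => e e0.
  pose S := \sum_i `|theta i 0|; have S0 : 0 <= S by apply: sumr_ge0.
  have S10 : 0 < S + 1 by rewrite ltr_wpDl.
  move/cvgrPdist_lt : cx => /(_ _ (divr_gt0 e0 S10)); apply: filterS => n hn.
  rewrite simple_step_eval -mulmxBl -linearB; apply: le_lt_trans (tr_mulmx_norm _ _) _.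
  rewrite -/S; apply: le_lt_trans (_ : (S + 1) * `|g x - sf_eval (s n) x| < _).
    by rewrite ler_wpM2r// lerDl.
  by rewrite mulrC -ltr_pdivlMr.
- move=> A e mA e0; have [ZA cA] := sA A mA.
  have mI n : random_vector (sf_integral M A (s n)) by exact: measurable_sf_integral.
  have e40 : 0 < e / 4 by lra.
  have := cvg_in_prob_kappa theta mI cA => /cvgrPdist_le/(_ _ e40)[N _ hN].
  have mZA : random_vector ZA by case: cA.
  exists N => n n' Nn Nn'; have := hN n Nn; have := hN n' Nn'.
  rewrite /= !sub0r !normrN !ger0_norm ?kappa_ge0// => h1 h2.
  under [fun w => _]eq_fun do rewrite !simple_step_integral.
  have := @kappa_triangle _ _ _ P (fun w => inner theta (sf_integral M A (s n) w))
    (fun w => inner theta (ZA w)) (fun w => inner theta (sf_integral M A (s n') w))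
    (measurable_inner _ (mI n)) (measurable_inner _ mZA) (measurable_inner _ (mI n')).
  rewrite -[kappa P (fun w => inner theta (ZA w) - _)]kappaN.
  rewrite (_ : (fun w => - (inner theta (ZA w) - _)) = fun w =>
    inner theta (sf_integral M A (s n') w) - inner theta (ZA w)); last first.
    by apply/funext => w; rewrite opprB.
  by move=> h3; apply: le_trans h3 _; lra.
- by apply: measurable_inner; case: sZ.
- move=> e e0.
  have mI n : random_vector (sf_integral M setT (s n)) by exact: measurable_sf_integral.
  have := cvg_in_prob_kappa theta mI sZ => /cvgrPdist_le/(_ _ e0)[N _ hN].
  exists N => n Nn; have := hN n Nn.
  rewrite /= sub0r normrN ger0_norm ?kappa_ge0//.
  rewrite (_ : (fun w => J _ w - _) = fun w =>
    inner theta (sf_integral M setT (s n) w) - inner theta (Z w))//.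
  apply/funext => w; rewrite -simple_step_integral; congr (_ - _).
  rewrite /step_integral /step_restrict [RHS]big_map; apply: eq_bigr => p _ /=.
  by rewrite setTI.
Qed.

Lemma levy_integral_approximates_sum (m : nat) (g : 'I_m -> 'cV[R]_k -> 'M[R]_(q, d))
    (Z : 'I_m -> T -> 'cV[R]_q) (theta : 'I_m -> 'cV[R]_q) :
  (forall j, levy_integral P M (g j) (Z j)) ->
  exists L, approximates P M (fun x => \sum_j (g j x)^T *m theta j) L
    (fun w => \sum_j inner (theta j) (Z j w)).
Proof.
move=> hg; elim: (index_enum _) => [|j r [L hL]].
  exists (fun=> [::]); have := @approximates_step _ _ _ _ _ k_gt0 P M basisM [::] I.
  rewrite (_ : step_eval [::] = fun x => \sum_(j <- [::]) (g j x)^T *m theta j); last first.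
    by apply/funext => x; rewrite /step_eval !big_nil.
  rewrite (_ : step_integral M [::] = fun w => \sum_(j <- [::]) inner (theta j) (Z j w))//.
  by apply/funext => w; rewrite /step_integral !big_nil.
have [L' hL'] := levy_integral_approximates (theta j) (hg j).
exists (fun n => L' n ++ L n); have := approximatesD k_gt0 basisM hL' hL.
rewrite (_ : (fun x => _ + _) = fun x => \sum_(i <- j :: r) (g i x)^T *m theta i); last first.
  by apply/funext => x; rewrite big_cons.
rewrite (_ : (fun w => inner _ _ + _) = fun w => \sum_(i <- j :: r) inner (theta i) (Z i w))//.
by apply/funext => w; rewrite big_cons.
Qed.

End LevyIntegral.

(** * Expectations under equal laws *)

Section LawTransfer.
Context {R : realType} {d1 d2 : measure_display}
  {T1 : measurableType d1} {T2 : measurableType d2}.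
Variables (P1 : probability T1 R) (P2 : probability T2 R).

Lemma eq_law_expect (m n : nat) (Z1 : T1 -> 'M[R]_(m, n)) (Z2 : T2 -> 'M[R]_(m, n))
    (h : 'M[R]_(m, n) -> R) : random_vector Z1 -> random_vector Z2 ->
  eq_law P1 P2 Z1 Z2 -> bounded_rv (T := borelType 'M[R]_(m, n)) h ->
  \int[P1]_w h (Z1 w) = \int[P2]_w h (Z2 w).
Proof.
move=> mZ1 mZ2 Z12 [mh [C hC]].
have b1 : bounded_rv (fun w => h (Z1 w)).
  by split; [exact: measurableT_comp mh mZ1|exists C].
have b2 : bounded_rv (fun w => h (Z2 w)).
  by split; [exact: measurableT_comp mh mZ2|exists C].
have e1 := @integral_pushforward _ _ T1 (borelType 'M[R]_(m, n)) R Z1 mZ1 P1 setT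
  (EFin \o h) ((measurable_EFinP _ _).2 mh) (bounded_rv_integrable P1 b1) measurableT.
have e2 := @integral_pushforward _ _ T2 (borelType 'M[R]_(m, n)) R Z2 mZ2 P2 setT
  (EFin \o h) ((measurable_EFinP _ _).2 mh) (bounded_rv_integrable P2 b2) measurableT.
congr fine; rewrite !preimage_setT in e1 e2.
rewrite -[LHS]e1 -[RHS]e2; apply: eq_measure_integral => A mA _; exact: Z12.
Qed.

End LawTransfer.

(** * Moving averages *)

Section Marginals.
Context {R : realType} {l q : nat}.
Local Notation phi P U := (Cexpect P (fun w => expi (U w))).

Lemma block_innerE (T : Type) (m : nat) (theta : 'I_m -> 'cV[R]_q)
    (Y : 'cV[R]_l -> T -> 'cV[R]_q) (s : 'I_m -> 'cV[R]_l) w :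
  block_inner theta Y s w =
  mxinner (\matrix_(i, j) theta j i 0) (marginal Y s w).
Proof.
rewrite /block_inner /mxinner exchange_big/=; apply: eq_bigr => j _.
by apply: eq_bigr => i _; rewrite !mxE.
Qed.

Lemma mxinner_marginal (T : Type) (m : nat) (t : 'M[R]_(q, m))
    (Y : 'cV[R]_l -> T -> 'cV[R]_q) (s : 'I_m -> 'cV[R]_l) w :
  mxinner t (marginal Y s w) = block_inner (fun j => col j t) Y s w.
Proof.
by rewrite block_innerE; congr mxinner; apply/matrixP => i j; rewrite !mxE.
Qed.

Lemma random_vector_marginal (d0 : measure_display) (T : measurableType d0) (m : nat)
    (Y : 'cV[R]_l -> T -> 'cV[R]_q) (s : 'I_m -> 'cV[R]_l) :
  random_field Y -> random_vector (marginal Y s).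
Proof.
move=> mY; apply/random_vectorP => i j.
rewrite (_ : (fun w => _) = fun w => Y (s j) w i 0).
  by apply: (random_vectorP _).1; exact: mY.
by apply/funext => w; rewrite mxE.
Qed.

Lemma measurable_block_inner (d0 : measure_display) (T : measurableType d0) (m : nat)
    (theta : 'I_m -> 'cV[R]_q) (Y : 'cV[R]_l -> T -> 'cV[R]_q) (s : 'I_m -> 'cV[R]_l) :
  random_field Y -> measurable_fun [set: T] (block_inner theta Y s).
Proof.
by move=> mY; apply: measurable_sum => j; apply: measurable_inner; exact: mY.
Qed.

(** Joins two groups of [m] points into one marginal with [2 m] points, since equality of finite
    dimensional laws speaks of one family of points at a time. *)
Definition ord_cat (V : Type) (m : nat) (a b : 'I_m -> V) (i : 'I_(m + m)) : V :=
  match fintype.split i with inl j => a j | inr j => b j end.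

Lemma block_inner_ord_cat (T : Type) (m : nat) (theta1 theta2 : 'I_m -> 'cV[R]_q)
    (Y : 'cV[R]_l -> T -> 'cV[R]_q) (s p : 'I_m -> 'cV[R]_l) w :
  block_inner (ord_cat theta1 theta2) Y (ord_cat s p) w =
  block_inner theta1 Y s w + block_inner theta2 Y p w.
Proof.
rewrite /block_inner big_split_ord/= /ord_cat; congr (_ + _); apply: eq_bigr => j _.
  by rewrite (unsplitK (inl j)).
by rewrite (unsplitK (inr j)).
Qed.

Context {d1 d2 : measure_display} {T1 : measurableType d1} {T2 : measurableType d2}.
Variables (P1 : probability T1 R) (P2 : probability T2 R).
Variables (Y1 : 'cV[R]_l -> T1 -> 'cV[R]_q) (Y2 : 'cV[R]_l -> T2 -> 'cV[R]_q).
Hypotheses (mY1 : random_field Y1) (mY2 : random_field Y2).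

Lemma phi_marginal_eq (m : nat) (theta : 'I_m -> 'cV[R]_q) (s1 s2 : 'I_m -> 'cV[R]_l) :
  eq_law P1 P2 (marginal Y1 s1) (marginal Y2 s2) ->
  phi P1 (block_inner theta Y1 s1) = phi P2 (block_inner theta Y2 s2).
Proof.
move=> Y12; pose t : 'M[R]_(q, m) := \matrix_(i, j) theta j i 0.
have mt := measurable_mxinner t.
rewrite (_ : block_inner theta Y1 s1 = fun w => mxinner t (marginal Y1 s1 w)); last first.
  by apply/funext => w; exact: block_innerE.
rewrite (_ : block_inner theta Y2 s2 = fun w => mxinner t (marginal Y2 s2 w)); last first.
  by apply/funext => w; exact: block_innerE.
have m1 := random_vector_marginal s1 mY1; have m2 := random_vector_marginal s2 mY2.
apply: complex_ext => /=.
  apply: (@eq_law_expect _ _ _ _ _ P1 P2 _ _ _ _ (fun x => cos (mxinner t x))) => //.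
  exact: (@bounded_rv_cos _ _ (borelType 'M[R]_(q, m)) _ mt).
apply: (@eq_law_expect _ _ _ _ _ P1 P2 _ _ _ _ (fun x => sin (mxinner t x))) => //.
exact: (@bounded_rv_sin _ _ (borelType 'M[R]_(q, m)) _ mt).
Qed.

Lemma eq_law_marginal (m : nat) (s1 s2 : 'I_m -> 'cV[R]_l) :
  (forall theta, phi P1 (block_inner theta Y1 s1) = phi P2 (block_inner theta Y2 s2)) ->
  eq_law P1 P2 (marginal Y1 s1) (marginal Y2 s2).
Proof.
move=> h; apply: eq_law_charfun.
- exact: random_vector_marginal.
- exact: random_vector_marginal.
- move=> t; have := congr1 (fun z => complex.Re z) (h (fun j => col j t)).
  rewrite /= => h'; under eq_Rintegral do rewrite mxinner_marginal.
  by under [RHS]eq_Rintegral do rewrite mxinner_marginal.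
- move=> t; have := congr1 (fun z => complex.Im z) (h (fun j => col j t)).
  rewrite /= => h'; under eq_Rintegral do rewrite mxinner_marginal.
  by under [RHS]eq_Rintegral do rewrite mxinner_marginal.
Qed.

End Marginals.

(** * Limits of complex sequences *)

Section ComplexLimit.

Lemma cvg_of_norm_lt (K : numFieldType) (z : nat -> K) (l : K) :
  (forall e : K, 0 < e -> exists N, forall n, (N <= n)%N -> `|l - z n| < e) ->
  z n @[n --> \oo] --> l.
Proof. by move=> h; apply/cvgrPdist_lt => e /h[N hN]; exists N. Qed.

Lemma normc_lt (R : rcfType) (z : R[i]) (a : R) :
  `|complex.Re z| < a / 2 -> `|complex.Im z| < a / 2 -> `|z| < a%:C%C.
Proof.
case: z => x y /= hx hy; rewrite ltcR.
have a0 : 0 < a by have := normr_ge0 x; lra.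
rewrite -(ger0_norm (ltW a0)) -sqrtr_sqr ltr_sqrt ?exprn_gt0//.
move: hx hy; rewrite -(real_normK (num_real x)) -(real_normK (num_real y)).
have := normr_ge0 x; have := normr_ge0 y; rewrite !expr2.
move: (`|x|) (`|y|) => u v *; nra.
Qed.

Lemma cvg_complex (R : realType) (z : nat -> R[i]) (l : R[i]) :
  (forall e : R, 0 < e -> exists N, forall n, (N <= n)%N ->
     `|complex.Re l - complex.Re (z n)| < e /\ `|complex.Im l - complex.Im (z n)| < e) ->
  (z : nat -> (R[i] : numFieldType)) n @[n --> \oo] --> (l : (R[i] : numFieldType)).
Proof.
(* The tolerance is an element of [R[i]], and being positive there forces its imaginary part to be
   0. *)
move=> h; apply: cvg_of_norm_lt => -[a b]; rewrite ltcE /= => /andP[/eqP-> a0].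
have [N hN] := h (a / 2) (divr_gt0 a0 (ltr0Sn _ 1)); exists N => n /hN[h1 h2].
by clear h hN; apply: normc_lt; move: h1 h2; case: (z n) l => [u v] [u' v'].
Qed.

End ComplexLimit.

(** * Translations along the last [l] coordinates *)

Section Coordinates.
Context {R : realType} {k l : nat}.
Variable le_lk : (l <= k)%N.
Implicit Types (x y : 'cV[R]_k) (h : 'cV[R]_l).

Definition embedS h : 'cV[R]_k :=
  castmx (subnK le_lk, erefl 1%N) (col_mx (0 : 'cV[R]_(k - l)) h).

Lemma embedSK h : castmx (esym (subnK le_lk), erefl 1%N) (embedS h) = col_mx 0 h.
Proof. by rewrite /embedS castmx_comp castmx_id. Qed.

Lemma coordBB x y : coordB le_lk (x - y) = coordB le_lk x - coordB le_lk y.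
Proof. by apply/matrixP => i j; rewrite /coordB !(mxE, castmxE). Qed.

Lemma coordSB x y : coordS le_lk (x - y) = coordS le_lk x - coordS le_lk y.
Proof. by apply/matrixP => i j; rewrite /coordS !(mxE, castmxE). Qed.

Lemma coordB_embedS h : coordB le_lk (embedS h) = 0.
Proof. by rewrite /coordB embedSK col_mxKu. Qed.

Lemma coordS_embedS h : coordS le_lk (embedS h) = h.
Proof. by rewrite /coordS embedSK col_mxKd. Qed.

Lemma embedS_norm h : `|h| <= `|embedS h|.
Proof.
apply/mx_norm_leP => // i j; rewrite -[in leLHS](coordS_embedS h) /coordS.
move: (embedS h) => x; rewrite !(mxE, castmxE).
by apply: (mx_norm_leP x (normr_ge0 x)).1.
Qed.

End Coordinates.

(** * Stationarity and asymptotic independence of the integrals *)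

Section MovingAverage.
Context {R : realType} {k l d q : nat} {d0 : measure_display} {T : measurableType d0}.
Hypothesis k_gt0 : (0 < k)%N.
Variable le_lk : (l <= k)%N.
Variables (P : probability T R) (M : set 'cV[R]_k -> T -> 'cV[R]_d).
Hypothesis basisM : homogeneous_levy_basis P M.
Variables (f : 'cV[R]_(k - l) -> 'cV[R]_l -> 'M[R]_(q, d)).
Variable Z : 'cV[R]_l -> T -> 'cV[R]_q.
Let kernel t x := f (coordB le_lk x) (t - coordS le_lk x).
Hypothesis integralZ : forall t, levy_integral P M (kernel t) (Z t).
Local Notation Re := complex.Re.
Local Notation Im := complex.Im.
Local Notation J := (step_integral M).
Local Notation phi U := (Cexpect P (fun w => expi (U w))).
Local Notation mfun := (measurable_fun [set: T]).

Lemma moving_average_random_field : random_field Z.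
Proof. by move=> t; have [s [_ _ []]] := integralZ t. Qed.
Let mZ := moving_average_random_field.

(** Since [(t + h) - s = t - (s - h)], a shift of the parameter of the field is a translation of the
    integrand in R^k. *)
Let kernel_shift t h x : kernel (t + h) x = kernel t (x - embedS le_lk h).
Proof.
rewrite /kernel coordBB coordSB coordB_embedS coordS_embedS subr0.
by rewrite opprB addrA (addrAC t) .
Qed.

Let block_approx (m : nat) (theta : 'I_m -> 'cV[R]_q) (s : 'I_m -> 'cV[R]_l) :
  exists L, approximates P M (fun x => \sum_j (kernel (s j) x)^T *m theta j) L
    (block_inner theta Z s).
Proof.
exact: (levy_integral_approximates_sum k_gt0 basisM theta (fun j => integralZ (s j))).
Qed.

Let kernel_sum_shift (m : nat) (theta : 'I_m -> 'cV[R]_q) (s : 'I_m -> 'cV[R]_l) h :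
  (fun x => \sum_j (kernel (s j + h) x)^T *m theta j) =
  (fun x => \sum_j (kernel (s j) (x - embedS le_lk h))^T *m theta j).
Proof. by apply/funext => x; apply: eq_bigr => j _; rewrite kernel_shift. Qed.

Lemma moving_average_phi_shift (m : nat) (theta : 'I_m -> 'cV[R]_q)
    (s : 'I_m -> 'cV[R]_l) h :
  phi (block_inner theta Z (fun j => s j + h)) = phi (block_inner theta Z s).
Proof.
have [psi [[mu [_ cpsi psi0 _]] psiM]] := basis_charfun basisM.
have [L hL] := block_approx theta s.
have [L' hL'] := block_approx theta (fun j => s j + h).
rewrite kernel_sum_shift in hL'.
by rewrite (approximates_shift_law k_gt0 basisM cpsi psi0 psiM hL hL').
Qed.

Let phi_le1 U : mfun U -> `|Re (phi U)| <= 1 /\ `|Im (phi U)| <= 1.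
Proof.
move=> mU; rewrite /= !ler_norml; split; apply/andP; split.
- rewrite -[leLHS](expect_cst P); apply: le_expect; [exact: bounded_rv_cst|exact: bounded_rv_cos|].
  by move=> w; exact: cos_geN1.
- by apply: le_expect_cst => [|w]; [exact: bounded_rv_cos|exact: cos_le1].
- rewrite -[leLHS](expect_cst P); apply: le_expect; [exact: bounded_rv_cst|exact: bounded_rv_sin|].
  by move=> w; exact: sin_geN1.
- by apply: le_expect_cst => [|w]; [exact: bounded_rv_sin|exact: sin_le1].
Qed.

(** Real and imaginary parts of [z1 z2 - z1' z2' = z1 (z2 - z2') + (z1 - z1') z2'], which is why
    only [z1] and [z2'] are assumed bounded by 1. Each part has two real products, each moved by at
    most [2 e]. *)
Let product_close (a1 b1 a2 b2 a1' b1' a2' b2' e : R) :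
  `|a1| <= 1 -> `|b1| <= 1 -> `|a2'| <= 1 -> `|b2'| <= 1 ->
  `|a1 - a1'| <= e -> `|b1 - b1'| <= e -> `|a2 - a2'| <= e -> `|b2 - b2'| <= e ->
  `|(a1 * a2 - b1 * b2) - (a1' * a2' - b1' * b2')| <= 4 * e /\
  `|(a1 * b2 + b1 * a2) - (a1' * b2' + b1' * a2')| <= 4 * e.
Proof.
have mul_close (x y x' y' : R) : `|x| <= 1 -> `|y'| <= 1 -> `|x - x'| <= e ->
    `|y - y'| <= e -> `|x * y - x' * y'| <= 2 * e.
  move=> hx hy hxx hyy.
  have -> : x * y - x' * y' = x * (y - y') + (x - x') * y' by ring.
  apply: le_trans (ler_normD _ _) _; rewrite !normrM.
  have := normr_ge0 x; have := normr_ge0 (y - y'); have := normr_ge0 (x - x').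
  have := normr_ge0 y'; nra.
move=> h1 h2 h3 h4 h5 h6 h7 h8; split.
  have -> : (a1 * a2 - b1 * b2) - (a1' * a2' - b1' * b2') =
    (a1 * a2 - a1' * a2') - (b1 * b2 - b1' * b2') by ring.
  apply: le_trans (ler_normB _ _) _.
  have := mul_close _ _ _ _ h1 h3 h5 h7; have := mul_close _ _ _ _ h2 h4 h6 h8; lra.
have -> : (a1 * b2 + b1 * a2) - (a1' * b2' + b1' * a2') =
  (a1 * b2 - a1' * b2') + (b1 * a2 - b1' * a2') by ring.
apply: le_trans (ler_normD _ _) _.
have := mul_close _ _ _ _ h1 h4 h5 h8; have := mul_close _ _ _ _ h2 h3 h6 h7; lra.
Qed.

Let norm_unbounded (t : nat -> 'cV[R]_l) : `|t n| @[n --> \oo] --> +oo ->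
  forall C : R, exists N, forall n, (N <= n)%N -> C < `|t n|.
Proof. by move=> ht C; have [N _ hN] := cvgry_gt ht C; exists N. Qed.

(* Both integrals are approximated by integrals of step functions of bounded
   support; translating the second one by a large [t n] makes the supports
   disjoint, and by [approximates_shift_law] the error of the approximation
   does not depend on [n]. *)
Lemma moving_average_asymptotic_independence (m : nat) (theta1 theta2 : 'I_m -> 'cV[R]_q)
    (s p : 'I_m -> 'cV[R]_l) (t : nat -> 'cV[R]_l) (e : R) :
  `|t n| @[n --> \oo] --> +oo -> 0 < e ->
  exists N, forall n, (N <= n)%N ->
    let c := phi (block_inner theta1 Z s) * phi (block_inner theta2 Z p) in
    let cn := phi (fun w => block_inner theta1 Z s w +
                            block_inner theta2 Z (fun j => p j + t n) w) in
    `|Re c - Re cn| <= 5 * e /\ `|Im c - Im cn| <= 5 * e.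
Proof.
move=> ht e0; have [psi [[mu [_ cpsi psi0 _]] psiM]] := basis_charfun basisM.
(* Two errors of size [e ^+ 2 / 8], doubled when added, stay within the threshold [e ^+ 2 / 2] of
   [kappa_charfun]. The final [5 e] is [4 e] for the product and [e] for the joint exponential. *)
have eta0 : 0 < e ^+ 2 / 8 by rewrite divr_gt0// exprn_gt0.
have [L1 [ok1 c1 h1 m1 l1]] := block_approx theta1 s.
have [L2 hL2] := block_approx theta2 p; have [ok2 c2 h2 m2 l2] := hL2.
have [N1 hN1] := l1 _ eta0; have [N2 hN2] := l2 _ eta0.
pose K1 := L1 N1; pose K2 := L2 N2.
have oK1 : step_ok K1 by exact: ok1.
have oK2 : step_ok K2 by exact: ok2.
have mK1 := measurable_step_integral basisM oK1.
have mK2 := measurable_step_integral basisM oK2.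
have [_ /bounded_setP[C1 hC1]] := step_support_bounded oK1.
have [_ /bounded_setP[C2 hC2]] := step_support_bounded oK2.
have [N hN] := norm_unbounded ht (C1 + C2).
exists N => n Nn c cn; rewrite /c /cn {c cn}.
set U1 := block_inner theta1 Z s; set U2 := block_inner theta2 Z (fun j => p j + t n).
set W2 := block_inner theta2 Z p.
have mU1 : mfun U1 by exact: measurable_block_inner.
have mU2 : mfun U2 by exact: measurable_block_inner.
have mW2 : mfun W2 by exact: measurable_block_inner.
pose h := embedS le_lk (t n); pose K2n := step_shift h K2.
have oK2n : step_ok K2n by exact: step_ok_shift.
have mK2n := measurable_step_integral basisM oK2n.
have k1 : kappa P (fun w => J K1 w - U1 w) <= e ^+ 2 / 8 by exact: hN1.
have k2 : kappa P (fun w => J K2 w - W2 w) <= e ^+ 2 / 8 by exact: hN2.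
have k3 : kappa P (fun w => J K2n w - U2 w) <= e ^+ 2 / 8.
  have [L' hL'] := block_approx theta2 (fun j => p j + t n).
  rewrite kernel_sum_shift -/h in hL'.
  (* The errors before and after the shift are integrals of integrands that are translates of one
     another by [h], so they have the same characteristic function and the same [kappa]. *)
  have a2 := approximatesD k_gt0 basisM hL2
    (approximates_step k_gt0 basisM (step_ok_neg oK2)).
  have a2n := approximatesD k_gt0 basisM hL'
    (approximates_step k_gt0 basisM (step_ok_neg oK2n)).
  rewrite (_ : (fun x => _ + step_eval (step_neg K2n) x) = fun x =>
    (fun y => \sum_j (kernel (p j) y)^T *m theta2 j + step_eval (step_neg K2) y) (x - h))
    in a2n; last first.
    by apply/funext => x; rewrite !step_eval_neg step_eval_shift.
  have := approximates_shift_law k_gt0 basisM cpsi psi0 psiM a2 a2n.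
  move=> /(kappa_phi (approx_measurable a2) (approx_measurable a2n)).
  move: k2; rewrite -(kappaN P (fun w => J K2 w - W2 w)) -(kappaN P (fun w => J K2n w - U2 w)).
  rewrite (_ : (fun w => - (J K2 w - W2 w)) = fun w => W2 w + J (step_neg K2) w); last first.
    by apply/funext => w; rewrite step_integral_neg opprB.
  rewrite (_ : (fun w => - (J K2n w - U2 w)) = fun w => U2 w + J (step_neg K2n) w); last first.
    by apply/funext => w; rewrite step_integral_neg opprB.
  by move=> h' <-.
(* A common point [x] would give [|h| <= |x| + |x - h| <= C1 + C2], against the choice of [N]. *)
have disjK : step_support K1 `&` step_support K2n = set0.
  apply/seteqP; split=> // x [/hC1 x1 /step_support_shift/hC2 x2].
  have := hN n Nn; rewrite ltNge => /negP; apply.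
  apply: le_trans (embedS_norm le_lk _) _; rewrite -/h.
  rewrite (_ : h = x - (x - h)); last by rewrite subKr.
  by apply: le_trans (ler_normB _ _) _; exact: lerD.
have prodK := phi_step_cat basisM psiM oK1 oK2n disjK.
rewrite (phi_step_shift basisM psiM h oK2) in prodK.
have e28 : e ^+ 2 / 8 <= e ^+ 2 / 2.
  by have := sqr_ge0 e; lra.
have [r1 i1] := kappa_charfun mK1 mU1 e0 (le_trans k1 e28).
have [r2 i2] := kappa_charfun mK2 mW2 e0 (le_trans k2 e28).
have mS : mfun (fun w => U1 w + U2 w) by exact: measurable_funD.
have mJS := measurable_step_integral basisM (step_ok_cat oK1 oK2n).
have k12 : kappa P (fun w => J (K1 ++ K2n) w - (U1 w + U2 w)) <= e ^+ 2 / 2.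
  rewrite (_ : (fun w => _) = fun w => (J K1 w + J K2n w) - (U1 w + U2 w)); last first.
    by apply/funext => w; rewrite step_integral_cat.
  have := kappa_four P mK1 mK2n mU1 mU2; lra.
have [r3 i3] := kappa_charfun mJS mS e0 k12.
rewrite prodK ReM ImM in r3 i3.
have [a1 b1] := phi_le1 mK1; have [a2 b2] := phi_le1 mW2.
have triangle (x y z : R) : `|x - z| <= e -> `|x - y| <= 4 * e -> `|y - z| <= 5 * e.
  by move=> xz xy; apply: le_trans (ler_distD x _ _) _; rewrite distrC; lra.
have [r4 i4] := product_close a1 b1 a2 b2 r1 i1 r2 i2.
by rewrite ReM ImM; split; [exact: triangle r3 r4|exact: triangle i3 i4].
Qed.

End MovingAverage.

(** * Mixing, transferred from the field of integrals to a field with the same finite dimensional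
    laws *)

Theorem corollary3p9 (R : realType) (k l d q : nat)
  (l_gt0 : (0 < l)%N) (d_gt0 : (0 < d)%N) (q_gt0 : (0 < q)%N)
  (le_lk : (l <= k)%N)
  (d0 : measure_display) (Omega : measurableType d0) (P : probability Omega R)
  (X : 'cV[R]_k -> Omega -> 'cV[R]_d)
  (LX : set 'cV[R]_k -> Omega -> 'cV[R]_d)
  (T : 'cV[R]_k -> Omega -> R)
  (LT : set 'cV[R]_k -> Omega -> R)
  (M : set 'cV[R]_k -> Omega -> 'cV[R]_d)
  (f : 'cV[R]_(k - l) -> 'cV[R]_l -> 'M[R]_(q, d))
  (Z : 'cV[R]_l -> Omega -> 'cV[R]_q)
  (d1 : measure_display) (Omega' : measurableType d1)
  (P' : probability Omega' R)
  (Y : 'cV[R]_l -> Omega' -> 'cV[R]_q) :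
  homogeneous_levy_sheet P X ->
  basis_induced_by P LX X ->
  homogeneous_levy_sheet P (to_vec1 T) ->
  (forall a b, vle a b ->
     {ae P, forall w, 0 <= increment ((to_vec1 T) ^~ w) a b 0 0}) ->
  basis_induced_by P (to_vec1 LT) (to_vec1 T) ->
  (forall A w, bounded_borel A -> 0 <= LT A w) ->
  extended_subordination LX LT M ->
  homogeneous_levy_basis P M ->
  measurable_fun [set: borelType 'cV[R]_(k - l) * borelType 'cV[R]_l]
    ((fun p => f p.1 p.2) :
       borelType 'cV[R]_(k - l) * borelType 'cV[R]_l ->
       borelType 'M[R]_(q, d)) ->
  (forall t : 'cV[R]_l,
     levy_integral P M
       (fun x => f (coordB le_lk x) (t - coordS le_lk x)) (Z t)) ->
  random_field Y ->
  eq_fdd P' P Y Z ->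
  mixing P' Y.
Proof.
move=> _ _ _ _ _ _ _ basisM _ hZ mY YZ.
have k_gt0 : (0 < k)%N := leq_trans l_gt0 le_lk.
have mZ := moving_average_random_field hZ.
have YZphi m (theta : 'I_m -> 'cV[R]_q) (s : 'I_m -> 'cV[R]_l) :
    Cexpect P' (fun w => expi (block_inner theta Y s w)) =
    Cexpect P (fun w => expi (block_inner theta Z s w)).
  exact (phi_marginal_eq mY mZ theta (YZ m s)).
split=> [h m s|m s p theta1 theta2 t ht].
  apply: (@eq_law_marginal _ _ _ _ _ _ _ P' P' (fun u => Y (u + h)) Y) => //.
  move=> theta.
  rewrite (YZphi m theta s).
  rewrite -(moving_average_phi_shift k_gt0 basisM hZ theta s h).
  exact: (YZphi m theta (fun j => s j + h)).
(* The bound is [5 (e / 6)], which leaves the strict inequality that convergence asks for. *)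
apply: cvg_complex => e e0; have e60 : 0 < e / 6 by lra.
have [N hN] := moving_average_asymptotic_independence k_gt0 basisM hZ theta1 theta2 s p ht e60.
rewrite (YZphi _ theta1 s) (YZphi _ theta2 p); exists N => n Nn.
have -> : Cexpect P' (fun w => expi (block_inner theta1 Y s w +
      block_inner theta2 Y (fun j => p j + t n) w)) =
    Cexpect P (fun w => expi (block_inner theta1 Z s w +
      block_inner theta2 Z (fun j => p j + t n) w)).
  (* The points [s] and [p + t n] are taken as one family of [2 m] points, so that the joint
     exponential is also determined by the finite dimensional laws. *)
  have := YZphi _ (ord_cat theta1 theta2) (ord_cat s (fun j => p j + t n)).
  rewrite (_ : (fun w => _) = fun w => expi (block_inner theta1 Y s w +
      block_inner theta2 Y (fun j => p j + t n) w)); last first.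
    by apply/funext => w; rewrite block_inner_ord_cat.
  move=> ->; congr Cexpect; apply/funext => w.
  by rewrite block_inner_ord_cat.
by have [h1 h2] := hN n Nn; split; [apply: le_lt_trans h1 _|apply: le_lt_trans h2 _]; lra.
Qed.
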